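(* Let $N\in\mathbb{N}$, $h>0$ and $0<\alpha<1$. Then the fundamental solution $$\mathcal{G}^{\alpha}_{n,h}(x):=\sum_{j=1}^{\infty}\varphi^h_{\alpha,1-\alpha}(n-1,j-1)\,\mathcal{G}_{j,h}(x)$$ is equivalently given by $$\mathcal{G}^{\alpha}_{n,h}(x)=\frac{1}{h^n}\int_0^\infty\int_0^\infty e^{-s/h}\frac{s^{n-1}}{(n-1)!}\,\psi_{\alpha,1-\alpha}(s,t)\,G_t(x)\,ds\,dt,\qquad n\in\mathbb{N},\ x\in\mathbb{R}^N\setminus\{0\}.$$
   Context: Here $\mathbb{N}=\{1,2,\dots\}$ and $\mathbb{N}_0=\{0,1,2,\dots\}$. Discrete scaled Wright function: for $0<\alpha<1$, $\beta\ge0$, $h>0$, $n,j\in\mathbb{N}_0$, $$\varphi^h_{\alpha,\beta}(n,j)=\frac{1}{2\pi i}\int_{\Upsilon}\frac{1}{z^{n+1}}\frac{\left(1-h(\frac{1-z}{h})^{\alpha}\right)^{j}}{(\frac{1-z}{h})^{\beta}}\,dz,$$ where $\Upsilon$ is the positively oriented circle centred at $0$ of radius $r\in(0,1)$ (principal powers). Scaled Wright function: for $0<\alpha<1$, $\beta\ge0$, $t>0$, $s\in\mathbb{C}$, $\psi_{\alpha,\beta}(t,s)=t^{\beta-1}W_{-\alpha,\beta}(-st^{-\alpha})$, where $W_{\lambda,\mu}(z)=\sum_{m=0}^\infty\frac{z^m}{m!\,\Gamma(\lambda m+\mu)}$ for $\lambda>-1$, $\mu\ge0$, $z\in\mathbb{C}$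 (with $1/\Gamma=0$ at the poles of $\Gamma$). Gaussian kernel: $G_t(x)=(4\pi t)^{-N/2}e^{-|x|^2/(4t)}$, $t>0$, $x\in\mathbb{R}^N$. Discrete Gaussian kernel: $\mathcal{G}_{n,h}(x)=\frac{1}{h^n\Gamma(n)}\int_0^\infty e^{-t/h}t^{n-1}G_t(x)\,dt$, $n\in\mathbb{N}$.
   Formalization: The series defining G^α_{n,h}(x) diverges when h^{1-α}>2 (e.g. n=1, α=1/2, h=9), so the identity is stated whenever the series converges; its convergence is proved for h^{1-α}<2, and convergence of the double integral for every h>0. *)

(* Defs.v *)
From HB Require Import structures.
From mathcomp Require Export all_boot all_order all_algebra.
From mathcomp Require Export all_classical all_reals all_analysis.
From mathcomp Require Export complex.

Set Implicit Arguments.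
Unset Strict Implicit.
Unset Printing Implicit Defensive.

Export Order.TTheory GRing.Theory Num.Theory.
Export numFieldNormedType.Exports.

Open Scope classical_set_scope.
Open Scope ring_scope.
Open Scope complex_scope.

(* R[i]^o is R[i] with its normed space structure over itself, which carries
   the usual topology of the complex plane. *)
Definition cseries_cvg (R : realType) (u : nat -> R[i]) : Prop :=
  cvgn (series (u : nat -> R[i]^o)).

Definition cseries_sum (R : realType) (u : nat -> R[i]) : R[i] :=
  limn (series (u : nat -> R[i]^o)).

Definition cintegrable (R : realType) (D : set R) (f : R -> R[i]) : Prop :=
  lebesgue_measure.-integrable D (fun x => (complex.Re (f x))%:E) /\
  lebesgue_measure.-integrable D (fun x => (complex.Im (f x))%:E).

Definition cintegral (R : realType) (D : set R) (f : R -> R[i]) : R[i] :=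
  (\int[lebesgue_measure]_(x in D) complex.Re (f x)) +i*
  (\int[lebesgue_measure]_(x in D) complex.Im (f x)).

Definition cis (R : realType) (theta : R) : R[i] := cos theta +i* sin theta.

(* Integral over the positively oriented circle z = r e^{i theta},
   with dz = i z dtheta. *)
Definition circle_integral (R : realType) (r : R) (f : R[i] -> R[i]) : R[i] :=
  cintegral `[0, 2 * pi] (fun theta =>
    let z := r%:C * cis theta in f z * (0 +i* 1) * z).

Definition cmod (R : realType) (z : R[i]) : R := complex.Re `|z|.

(* Principal argument, in ]-pi, pi], for z != 0. *)
Definition carg (R : realType) (z : R[i]) : R :=
  if 0 <= complex.Im z then acos (complex.Re z / cmod z)
  else - acos (complex.Re z / cmod z).

(* Principal power z^a, for z != 0. *)
Definition cpow (R : realType) (z : R[i]) (a : R) : R[i] :=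
  (cmod z `^ a)%:C * cis (a * carg z).

Definition Gamma_pos (R : realType) (x : R) : R :=
  \int[lebesgue_measure]_(t in `]0, +oo[) (t `^ (x - 1) * expR (- t)).

(* For x <= 0 the integral is continued by Gamma(x + 1) = x * Gamma(x). At the
   poles 0, -1, -2, ... the product is 0, so that Gamma x = 0 and
   (Gamma x)^-1 = 0, which is the convention 1/Gamma = 0. *)
Definition Gamma (R : realType) (x : R) : R :=
  if 0 < x then Gamma_pos x
  else let k := (Num.truncn (- x)).+1 in
       Gamma_pos (x + k%:R) / \prod_(i < k) (x + i%:R).

Definition wright (R : realType) (lambda mu : R) (z : R[i]) : R[i] :=
  cseries_sum (fun m : nat =>
    z ^+ m * ((m`!%:R)^-1 * (Gamma (lambda * m%:R + mu))^-1)%:C).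

Definition scaled_wright (R : realType) (alpha beta t : R) (s : R[i]) : R[i] :=
  (t `^ (beta - 1))%:C * wright (- alpha) beta (- s * (t `^ (- alpha))%:C).

(* r is the radius of the contour. *)
Definition discrete_wright (R : realType) (r h alpha beta : R) (n j : nat) :
    R[i] :=
  ((2 * pi)%:C * (0 +i* 1))^-1 *
  circle_integral r (fun z =>
    (z ^+ n.+1)^-1 *
    ((1 - h%:C * cpow ((1 - z) / h%:C) alpha) ^+ j /
     cpow ((1 - z) / h%:C) beta)).

(* The norm of 'rV[R]_N in the library is the sup norm; this is |x|^2 for the
   Euclidean norm. *)
Definition sqnorm (R : realType) (N : nat) (x : 'rV[R]_N) : R :=
  \sum_(i < N) x ord0 i ^+ 2.

Definition gauss (R : realType) (N : nat) (t : R) (x : 'rV[R]_N) : R :=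
  (4 * pi * t) `^ (- (N%:R / 2)) * expR (- (sqnorm x / (4 * t))).

Definition discrete_gauss (R : realType) (N : nat) (n : nat) (h : R)
    (x : 'rV[R]_N) : R :=
  (h ^+ n * Gamma n%:R)^-1 *
  \int[lebesgue_measure]_(t in `]0, +oo[)
    (expR (- (t / h)) * t ^+ n.-1 * gauss t x).

(* The terms of the series over j = 1, 2, ..., reindexed from 0. *)
Definition fund_sol_term (R : realType) (N : nat) (r alpha : R) (n : nat)
    (h : R) (x : 'rV[R]_N) (j : nat) : R[i] :=
  discrete_wright r h alpha (1 - alpha) n.-1 j * (discrete_gauss j.+1 h x)%:C.

Definition fund_sol (R : realType) (N : nat) (r alpha : R) (n : nat)
    (h : R) (x : 'rV[R]_N) : R[i] :=
  cseries_sum (fund_sol_term r alpha n h x).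

Definition subord_integrand (R : realType) (N : nat) (alpha : R) (n : nat)
    (h : R) (x : 'rV[R]_N) (s t : R) : R[i] :=
  (expR (- (s / h)) * (s ^+ n.-1 / (n.-1)`!%:R))%:C *
  scaled_wright alpha (1 - alpha) s t%:C * (gauss t x)%:C.

(* Main.v *)
Require Import Defs.
From mathcomp Require Import ring lra zify measurable_realfun.

(** Both sides integrate the kernel t |-> G_t(x) against an explicit density in
    t, and the two densities turn out to be the same finite sum.

    Put k = n - 1, w = h^(1 - alpha), y = t / h, and let [bcoef x k] be the
    coefficient of z^k in (1 - z)^(-x).  As a function of l, the coefficient
    bcoef (1 - alpha - alpha l) k is a polynomial of degree k; its Newton
    expansion has coefficients (-1)^m D_m with D_m = [newton alpha (1 - alpha) m k],
    where D_m >= 0 and D_k = alpha^k ([bcoef_newton_trunc], [newton_diag]).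

    Left side.  Expanding the j-th power under the contour integral leaves the
    integrals of z^(-k-1) (1 - z)^a over the circle, which are the Taylor
    coefficients bcoef (-a) k up to 2 pi i.  They are computed with real
    integrals over [0, 2 pi], by a recursion on k and independence of the
    radius ([Icos_bcoef], [Isin_eq0]).  Summing over l with the Newton
    expansion gives ([discrete_wright_newton])
      phi(k, j) = w sum_m D_m w^m C(j, m) (1 - w)^(j - m).
    As G_{j+1,h} averages G_t against e^(-y) y^j / j!, and
      sum_j C(j, m) (1 - w)^(j - m) y^j / j! = y^m / m! e^((1 - w) y),
    the series should be the integral of G_t against
      (w / h) e^(-w y) sum_m D_m (w y)^m / m!.

    Right side.  The same density comes out of the inner integral
    ([integral_wmoment], [wcoefE]).  The number
      c_k(tau) = e^(-tau) sum_m D_m tau^m / m!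
    is also the k-th Taylor coefficient of
      (1 - z)^(alpha - 1) exp(- tau (1 - z)^alpha),
    and the step functions built from these coefficients on a grid of mesh 1/n
    converge to psi(., t), by Gauss's limit for 1/Gamma and dominated series.
    Hence psi is nonnegative, and its Laplace transform is
    lambda^(alpha - 1) exp(- t lambda^alpha) ([laplace_wfun]).  Expanding this
    transform in powers of z at lambda = (1 - z) / h gives the integrals of
    e^(-s/h) s^k / k! psi(s, t) in s.

    Interchange of sum and integral.  If w < 2, partial sums are dominated and
    the series converges to the integral ([mix_series_cvg]).  If w = 2, the
    same holds for the Abel means of the series, and when the series converges
    its sum is their limit ([abel_limit]).  If w > 2 the series diverges
    ([mix_series_diverges]): the averages of the Gaussian kernel dominate a
    multiple of (w - 1)^(-j), so vanishing terms would force a polynomial in j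
    with leading coefficient proportional to D_k to tend to 0. *)

Set Implicit Arguments.
Unset Strict Implicit.
Unset Printing Implicit Defensive.

(** * Dominated series and coefficients of the binomial series *)

Section tannery.
Context {R : realType}.
Implicit Types (f g v : nat -> R).

Lemma dominated_cvg_series f g : (forall m, `|f m| <= g m) ->
  cvgn (series g) -> cvgn (series f).
Proof.
move=> fg cg; apply: normed_cvg; apply: series_le_cvg cg => //= m.
exact: le_trans (normr_ge0 _) (fg m).
Qed.

(** The tail bound is uniform over all series with the same majorant, which is
    what makes Tannery's theorem below work. *)
Lemma dominated_series_tail f g K : (forall m, `|f m| <= g m) ->
  cvgn (series g) ->
  `|limn (series f) - series f K| <= limn (series g) - series g K.
Proof.
move=> fg cg; have cf := dominated_cvg_series fg cg.
have h1 : `|series f n - series f K| @[n --> \oo] -->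
    `|limn (series f) - series f K|.
  by apply: cvg_norm; apply: cvgB => //; exact: cvg_cst.
have h2 : series g n - series g K @[n --> \oo] -->
    limn (series g) - series g K.
  by apply: cvgB => //; exact: cvg_cst.
rewrite -(cvg_lim _ h1)// -(cvg_lim _ h2)//.
apply: ler_lim; [by apply: cvgP h1|by apply: cvgP h2|].
near=> n.
have Kn : (K <= n)%N by near: n; exact: nbhs_infty_ge.
rewrite !sub_series_geq//; apply: (le_trans (ler_norm_sum _ _ _)).
exact: ler_sum.
Unshelve. all: by end_near. Qed.

Lemma norm_limn_series f g : (forall m, `|f m| <= g m) ->
  cvgn (series g) -> `|limn (series f)| <= limn (series g).
Proof.
move=> fg cg; have := dominated_series_tail 0 fg cg.
by rewrite /series /= !big_geq// !subr0.
Qed.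

Lemma tannery (u : nat -> nat -> R) g v :
  (forall n m, `|u n m| <= g m) -> cvgn (series g) ->
  (forall m, u n m @[n --> \oo] --> v m) ->
  limn (series (u n)) @[n --> \oo] --> limn (series v).
Proof.
move=> ug cg uv.
have vg m : `|v m| <= g m.
  have h : `|u n m| @[n --> \oo] --> `|v m| by apply: cvg_norm; exact: uv.
  rewrite -(cvg_lim _ h)//; apply: limr_le; first by apply: cvgP h.
  exact: nearW.
apply/cvgrPdist_le => e e0.
have /cvgrPdist_le/(_ (e / 3))/= : series g n @[n --> \oo] --> limn (series g).
  by [].
rewrite divr_gt0// => /(_ isT)[K _ /(_ K (leqnn K)) gK].
have sK : series (u n) K @[n --> \oo] --> series v K.
  rewrite /series /=.
  by apply: cvg_big => //; apply: add_continuous.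
move/cvgrPdist_le : sK => /(_ (e / 3)); rewrite divr_gt0// => /(_ isT) sK.
near=> n.
rewrite (_ : limn (series v) - limn (series (u n)) =
  (limn (series v) - series v K) + ((series v K - series (u n) K) +
  (series (u n) K - limn (series (u n))))); last by ring.
rewrite (_ : e = e / 3 + (e / 3 + e / 3)); last by field.
rewrite (le_trans (ler_normD _ _))//; apply: lerD.
  apply: le_trans (dominated_series_tail K vg cg) _.
  by apply: le_trans gK; rewrite ler_norm.
rewrite (le_trans (ler_normD _ _))//; apply: lerD; first by near: n.
rewrite distrC.
apply: le_trans (dominated_series_tail K (ug n) cg) _.
by apply: le_trans gK; rewrite ler_norm.
Unshelve. all: by end_near. Qed.

End tannery.

Section rising.
Context {R : realType}.
Implicit Types (x p : R).

Definition rising x (k : nat) : R := \prod_(i < k) (x + i%:R).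

(** The coefficient of z^k in (1 - z)^(-x); it is C(x + k - 1, k) for positive
    integers x. *)
Definition bcoef x (k : nat) : R := rising x k / k`!%:R.

Lemma rising0 x : rising x 0 = 1.
Proof. by rewrite /rising big_ord0. Qed.

Lemma risingSr x k : rising x k.+1 = rising x k * (x + k%:R).
Proof. by rewrite /rising big_ord_recr. Qed.

Lemma risingSl x k : rising x k.+1 = x * rising (x + 1) k.
Proof.
rewrite /rising big_ord_recl addr0; congr (_ * _); apply: eq_bigr => i _.
by rewrite /= /bump leq0n add1n -natr1 -addrA (addrC 1).
Qed.

Lemma factr_neq0 k : k`!%:R != 0 :> R.
Proof. by rewrite pnatr_eq0 -lt0n fact_gt0. Qed.

Lemma factr_gt0 k : 0 < k`!%:R :> R.
Proof. by rewrite ltr0n fact_gt0. Qed.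

Lemma bcoef0 x : bcoef x 0 = 1.
Proof. by rewrite /bcoef rising0 fact0 divr1. Qed.

Lemma bcoefSr x k : bcoef x k.+1 = bcoef x k * ((x + k%:R) / k.+1%:R).
Proof.
by rewrite /bcoef risingSr factS natrM invfM [_^-1 * _]mulrC mulrACA.
Qed.

Lemma bcoefSl x k : k.+1%:R * bcoef x k.+1 = x * bcoef (x + 1) k.
Proof.
by rewrite /bcoef risingSl factS natrM invfM mulrCA mulVKf// mulrA.
Qed.

Lemma bcoef_ge0 x k : 0 <= x -> 0 <= bcoef x k.
Proof.
move=> x0; rewrite /bcoef divr_ge0 ?ler0n// /rising prodr_ge0// => i _.
by rewrite addr_ge0.
Qed.

(** A bound for |bcoef (1 - p) k| (k + 1)^p uniform in k ([bcoef_bound]). Its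
    growth in p, about p^p, is slow enough for the Wright series because
    p = alpha (m + 1) with alpha < 1. *)
Definition bbound p : R := expR p * (p + 1) `^ p.

Lemma bbound_ge0 p : 0 <= bbound p.
Proof. by rewrite mulr_ge0 ?expR_ge0 ?powR_ge0. Qed.

(** For i < k <= p the i-th factor has absolute value p - 1 - i, between 0 and
    p. *)
Lemma bcoef_bound_small p k : 0 < p -> k%:R <= p ->
  `|bcoef (1 - p) k| <= p ^+ k / k`!%:R.
Proof.
move=> p0 kp; rewrite /bcoef normrM normfV (ger0_norm (ler0n _ _)).
rewrite ler_wpM2r ?invr_ge0// /rising normr_prod.
rewrite -[X in _ <= _ ^+ X]card_ord -prodr_const; apply: ler_prod => i _.
rewrite normr_ge0 /=.
have ik : (i.+1%:R : R) <= k%:R by rewrite ler_nat.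
rewrite -natr1 in ik.
have : (0:R) <= i%:R by [].
by move=> ?; rewrite ler0_norm; lra.
Qed.

Lemma pow_le_fact_expR (x : R) k : 0 <= x -> x ^+ k / k`!%:R <= expR x.
Proof.
move=> x0; rewrite /expR.
have h : cvgn (series (exp_coeff x)) by exact: is_cvg_series_exp_coeff.
apply: le_trans (nondecreasing_cvgn_le _ h k.+1).
  rewrite seriesSr lerDr /series /= sumr_ge0// => i _.
  exact: exp_coeff_ge0.
apply/nondecreasing_seqP => n; rewrite seriesSr lerDl.
exact: exp_coeff_ge0.
Qed.

(** Up to k = p the coefficient is at most p^k / k! <= e^p; beyond, the
    sequence |bcoef (1 - p) k| (k + 1)^p is nonincreasing, since (1 - p/(k+1))
    (1 + 1/(k+1))^p <= 1 by comparing both factors with exponentials. *)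
Lemma bcoef_bound p k : 0 < p ->
  `|bcoef (1 - p) k| * k.+1%:R `^ p <= bbound p.
Proof.
move=> p0; elim: k => [|k IH].
  rewrite bcoef0 normr1 mul1r powR1 /bbound.
  have : 1 <= expR p by rewrite -expR0 ler_expR ltW.
  have : 1 <= (p + 1) `^ p.
    have p1 : 1 <= p + 1 by rewrite lerDr ltW.
    have := ge0_ler_powR (ltW p0) _ _ p1; rewrite powR1; apply;
      by rewrite nnegrE ?(le_trans _ p1).
  by move=> a b; rewrite -[leLHS](mulr1 1) ler_pM.
have [kp|pk] := leP k.+1%:R p.
  apply: ler_pM => //; rewrite ?powR_ge0//.
    apply: le_trans (bcoef_bound_small p0 kp) _.
    by apply: pow_le_fact_expR; exact: ltW.
  have kp1 : k.+2%:R <= p + 1 by rewrite -natr1 lerD2r.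
  by apply: (ge0_ler_powR (ltW p0)) kp1; rewrite nnegrE//;
    apply: addr_ge0 => //; exact: ltW.
apply: le_trans IH.
rewrite bcoefSr normrM -mulrA ler_wpM2l//.
have k10 : 0 < k.+1%:R :> R by [].
rewrite (_ : (1 - p + k%:R) / k.+1%:R = 1 - p / k.+1%:R); last first.
  by rewrite -natr1; field; rewrite natr1.
rewrite ger0_norm; last by rewrite subr_ge0 ler_pdivrMr// mul1r ltW.
rewrite -[k.+2%:R]natr1.
rewrite (_ : k.+1%:R + 1 = k.+1%:R * (1 + k.+1%:R^-1) :> R); last first.
  by field; rewrite nat1r.
rewrite powRM//.
rewrite mulrCA ger_pMr ?powR_gt0//.
(* The two exponential bounds cancel in the product. *)
have h1 : 1 - p / k.+1%:R <= expR (- (p / k.+1%:R)).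
  exact: expR_ge1Dx.
have h2 : (1 + k.+1%:R^-1) `^ p <= expR (p / k.+1%:R).
  rewrite mulrC expRM ge0_ler_powR ?nnegrE ?expR_ge0 ?expR_ge1Dx ?(ltW p0)//.
apply: le_trans (ler_pM _ _ h1 h2) _; rewrite ?powR_ge0//.
  by rewrite subr_ge0 ler_pdivrMr// mul1r ltW.
by rewrite -expRD addNr expR0.
Qed.

End rising.

(** * Sum of the binomial series, summability of the Wright series *)

Section binomial_series.
Context {R : realType}.
Implicit Types (x z : R).

(** The product of the series of parameter x + 1 with 1 - z, read on
    coefficients. *)
Lemma bcoefD1 x k : bcoef x k.+1 = bcoef (x + 1) k.+1 - bcoef (x + 1) k.
Proof.
have k0 : k.+1%:R != 0 :> R by [].
apply: (mulfI k0); rewrite bcoefSl bcoefSr; set b := bcoef _ _.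
rewrite (_ : k.+1%:R * _ = b * (x + 1 + k%:R) - k.+1%:R * b); last first.
  rewrite mulrBr; congr (_ - _).
  by rewrite mulrCA [X in _ * X]mulrCA mulfV// mulr1.
by rewrite -natr1; ring.
Qed.

Lemma eventually_decreasing_bounded (a : nat -> R) k0 :
  (forall k, 0 <= a k) -> (forall k, (k0 <= k)%N -> a k.+1 <= a k) ->
  exists B, forall k, a k <= B.
Proof.
move=> a0 dec; exists (\sum_(i < k0.+1) a i); elim=> [|k IH].
  by rewrite big_ord_recl/= lerDl sumr_ge0.
have [k0k|kk0] := leqP k0 k; first exact: le_trans (dec _ k0k) IH.
by rewrite (bigD1 (Ordinal (kk0 : k.+1 < k0.+1)%N))//= lerDl sumr_ge0.
Qed.

(** The ratio of consecutive coefficients tends to 1, so that q^k eventually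
    makes the sequence decrease. *)
Lemma bcoef_geometric_bounded x (q : R) : 0 < q < 1 ->
  exists B, forall k, `|bcoef x k| * q ^+ k <= B.
Proof.
move=> /andP[q0 q1].
(* From this index on, |x + k| q <= k + 1. *)
pose k0 := (Num.truncn (`|x| / (q^-1 - 1))).+1.
have q1' : 0 < q^-1 - 1 by rewrite subr_gt0 invf_gt1.
apply: (@eventually_decreasing_bounded _ k0) => k.
  by rewrite mulr_ge0 ?exprn_ge0// ltW.
move=> k0k.
have h : `|(x + k%:R) / k.+1%:R| * q <= 1.
  rewrite normrM normfV (ger0_norm (ler0n _ _)) mulrAC ler_pdivrMr// mul1r.
  rewrite -ler_pdivlMr//.
  apply: le_trans (ler_normD _ _) _; rewrite (ger0_norm (ler0n _ _)).
  have /ltW : `|x| / (q^-1 - 1) < k%:R.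
    apply: lt_le_trans (_ : k0%:R <= _); last by rewrite ler_nat.
    by rewrite /k0 truncnS_gt.
  rewrite ler_pdivrMr// => h.
  have : 0 < q^-1 by rewrite invr_gt0.
  rewrite -natr1; lra.
rewrite bcoefSr normrM exprS (mulrC q) mulrACA ler_piMr//.
by rewrite mulr_ge0 ?exprn_ge0// ltW.
Qed.

Lemma is_cvg_bcoef x z : `|z| < 1 -> cvgn (pseries (bcoef x) z).
Proof.
move=> z1; pose q := (1 + `|z|) / 2.
have zq : `|z| < q by rewrite /q; lra.
have q1 : q < 1 by rewrite /q; lra.
have q0 : 0 < q by rewrite (le_lt_trans _ zq).
have [|B hB] := @bcoef_geometric_bounded x q; first by rewrite q0.
apply: normed_cvg; apply: (@series_le_cvg _ _ (geometric B (`|z| / q))).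
- by move=> n /=.
- move=> n /=; apply: mulr_ge0; last by rewrite exprn_ge0// divr_ge0// ltW.
  by apply: le_trans (hB 0); rewrite expr0 mulr1.
- move=> n /=; rewrite normrM normrX expr_div_n [leRHS]mulrCA [leRHS]mulrC.
  by rewrite ler_wpM2r ?exprn_ge0// ler_pdivlMr ?exprn_gt0// hB.
- apply: is_cvg_geometric_series; rewrite ger0_norm ?divr_ge0 ?(ltW q0)//.
  by rewrite ltr_pdivrMr// mul1r.
Qed.

Definition bsum x z := limn (pseries (bcoef x) z).

Lemma bsum0 x : bsum x 0 = 1.
Proof.
rewrite /bsum; apply/cvg_lim => //; rewrite -cvg_shiftS /=.
rewrite [X in X @ _](_ : _ = fun=> 1); first exact: cvg_cst.
apply/funext => n.
rewrite /pseries /series /= big_nat_recl// bcoef0 expr0 mulr1 big1 ?addr0// => i _.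
by rewrite exprS mul0r mulr0.
Qed.

Lemma bsumD1 x z : `|z| < 1 -> bsum x z = (1 - z) * bsum (x + 1) z.
Proof.
move=> z1; have h := @is_cvg_bcoef (x + 1) _ z1.
rewrite /bsum; apply/cvg_lim => //; rewrite -cvg_shiftS /= mulrBl mul1r.
have -> : (fun n => pseries (bcoef x) z n.+1) =
   (fun n => pseries (bcoef (x + 1)) z n.+1 - z * pseries (bcoef (x + 1)) z n).
  apply/funext => n; rewrite /pseries /series /= !big_nat_recl// !bcoef0.
  rewrite !expr0 !mulr1 -addrA; congr (_ + _).
  rewrite mulr_sumr -sumrB; apply: eq_bigr => i _.
  by rewrite bcoefD1 exprS; ring.
apply: cvgB; first by rewrite cvg_shiftS.
by apply: cvgM => //; exact: cvg_cst.
Qed.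

Lemma pseries_diffs_bcoef x :
  pseries_diffs (bcoef x) = (fun k => x * bcoef (x + 1) k).
Proof. by apply/funext => k; rewrite /pseries_diffs bcoefSl. Qed.

Lemma pseriesZ (f : nat -> R) c z :
  pseries (fun k => c * f k) z = c *: pseries f z.
Proof.
apply/funext => n; rewrite /pseries /series /=.
rewrite -[RHS]/(c * _) mulr_sumr.
by apply: eq_bigr => i _; rewrite mulrA.
Qed.

Lemma is_derive_bsum x z : `|z| < 1 ->
  is_derive z 1 (bsum x) (x * bsum (x + 1) z).
Proof.
move=> z1; pose q := (1 + `|z|) / 2.
have zq : `|z| < q by rewrite /q; lra.
have q1 : q < 1 by rewrite /q; lra.
have q0 : 0 < q by rewrite (le_lt_trans _ zq).
have q1' : `|q| < 1 by rewrite gtr0_norm.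
have -> : x * bsum (x + 1) z = limn (pseries (pseries_diffs (bcoef x)) z).
  rewrite pseries_diffs_bcoef pseriesZ limZl_tmp//.
  exact: is_cvg_bcoef.
apply: (@pseries_snd_diffs _ _ q); last by rewrite [ltRHS]gtr0_norm.
- exact: is_cvg_bcoef.
- rewrite pseries_diffs_bcoef pseriesZ; apply: is_cvgZl_tmp.
  exact: is_cvg_bcoef.
- rewrite pseries_diffs_bcoef.
  have -> : pseries_diffs (fun k => x * bcoef (x + 1) k) =
     (fun k => (x * (x + 1)) * bcoef (x + 1 + 1) k).
    apply/funext => k; rewrite /pseries_diffs mulrCA bcoefSl; ring.
  rewrite pseriesZ; apply: is_cvgZl_tmp; exact: is_cvg_bcoef.
Qed.

(** The function bsum x z (1 - z)^x has zero derivative: the derivative of the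
    series with parameter x is x times the series with parameter x + 1, which
    in turn is the series with parameter x divided by 1 - z. *)
Lemma bsumE x z : 0 <= z < 1 -> bsum x z = (1 - z) `^ (- x).
Proof.
move=> /andP[z0 z1].
pose f (y : R) := bsum x y * (1 - y) `^ x.
have df (y : R) : 0 <= y < 1 -> is_derive y 1 f 0.
  move=> /andP[y0 y1].
  have y1' : `|y| < 1 by rewrite ger0_norm.
  have dy := is_derive_bsum x y1'.
  have dl : is_derive y 1 (fun y : R => 1 - y) (-1).
    rewrite -[X in is_derive _ _ _ X]sub0r.
    exact: (is_deriveB (is_derive_cst (1 : R) y 1) (is_derive_id y 1)).
  have y10 : 0 < 1 - y by rewrite subr_gt0.
  have dp := @is_derive1_comp _ (fun y : R => y `^ x) (fun y : R => 1 - y) y _ _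
    (is_derive1_powR x y10) dl.
  apply: (is_derive_eq (is_deriveM dy dp)).
  rewrite -[_ *: _]/(_ * _) -[X in _ + X = _]/(_ * _) /=.
  have -> : (1 - y) `^ x = (1 - y) * (1 - y) `^ (x - 1).
    rewrite -[X in X * _](powRr1 (ltW y10)) -powRD ?addrNK ?subrKC//.
    by rewrite (gt_eqF y10) implybT.
  by rewrite (bsumD1 x y1'); ring.
have fz : f z = 1.
  have f0 : f 0 = 1 by rewrite /f bsum0 subr0 powR1 mulr1.
  have [->//|zn0] := eqVneq z 0.
  have z0' : 0 < z by rewrite lt_neqAle eq_sym zn0.
  have [||c _] := @MVT _ f (fun=> 0) 0 z z0'.
  - by move=> y /andP[]; rewrite !bnd_simp => y0 yz; apply: df; rewrite ltW//= (lt_trans yz).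
  - apply: derivable_within_continuous => y /andP[]; rewrite !bnd_simp => y0 yz.
    by apply: (@ex_derive _ _ _ _ _ _ _ (df y _)); rewrite y0 (le_lt_trans yz).
  by rewrite mul0r f0 => /eqP; rewrite subr_eq0 => /eqP.
have h : (1 - z) `^ x != 0 by rewrite gt_eqF//; apply: powR_gt0; rewrite subr_gt0.
by apply: (mulIf h); rewrite -/(f z) fz powRN mulVf.
Qed.

End binomial_series.

Section wright_summability.
Context {R : realType}.
Implicit Types (al T p : R).

(** Since p = alpha (m + 1), the bound p^p is controlled by (m!)^alpha up to
    geometric factors. *)
Lemma bbound_fact al m : 0 < al < 1 ->
  bbound (al * m.+1%:R) <= expR 1 * expR 2 * (2 * expR 2) ^+ m * m`!%:R `^ al.
Proof.
move=> /andP[al0 al1]; rewrite /bbound.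
set p := al * m.+1%:R.
have m1 : 0 < m.+1%:R :> R by [].
have pm : p <= m.+1%:R by rewrite /p ler_piMl// ltW.
have p0 : 0 <= p by rewrite /p mulr_ge0// ltW.
have h1 : expR p <= expR 1 ^+ m.+1 by rewrite -expRM_natr mul1r ler_expR.
have h2 : (p + 1) `^ p <= (m.+2%:R ^+ m.+1) `^ al.
  rewrite -powR_mulrn// -powRrM [X in _ <= _ `^ X]mulrC.
  have pm1 : p + 1 <= m.+2%:R by rewrite -[m.+2%:R]natr1 lerD2r.
  by apply: (ge0_ler_powR p0) pm1; rewrite nnegrE//; apply: addr_ge0.
have h3 : (m.+2%:R ^+ m.+1) `^ al <= (expR 1 ^+ m.+2 * (m.+1)`!%:R) `^ al.
  have h : m.+2%:R ^+ m.+1 <= expR 1 ^+ m.+2 * (m.+1)`!%:R :> R.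
    rewrite -ler_pdivrMr ?factr_gt0// -expRM_natr mul1r.
    exact: pow_le_fact_expR.
  apply: (ge0_ler_powR (ltW al0)) h; rewrite nnegrE ?exprn_ge0//.
have h4 : (expR 1 ^+ m.+2 * (m.+1)`!%:R) `^ al <=
    expR 1 ^+ m.+2 * 2 ^+ m * m`!%:R `^ al.
  have : 1 <= expR 1 ^+ m.+2 :> R by apply: exprn_ege1; rewrite -expR0 ler_expR.
  move: (expR 1 ^+ m.+2) => E E1; have E0 := le_trans ler01 E1.
  rewrite factS natrM mulrA powRM ?mulr_ge0// ler_wpM2r ?powR_ge0//.
  have e1 : 1 <= E * m.+1%:R.
    by rewrite -[leLHS]mulr1; apply: ler_pM => //; rewrite ler1n.
  apply: le_trans (ler1_powR e1 (ltW al1)) _.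
  by rewrite ler_wpM2l// -natrX ler_nat ltn_expl.
apply: le_trans (ler_pM (expR_ge0 _) (powR_ge0 _ _) h1
  (le_trans h2 (le_trans h3 h4))) _.
rewrite (_ : expR 2 = expR 1 * expR 1); last by rewrite -expRD.
rewrite !exprS !exprMn le_eqVlt; apply/orP; left; apply/eqP; ring.
Qed.

(** Take the ga-th power of the bound y^m / m! <= e^y at y = X^(1/ga). *)
Lemma pow_fact_bounded ga (X : R) : 0 < ga -> 0 <= X ->
  exists B, forall m, X ^+ m / m`!%:R `^ ga <= B.
Proof.
move=> ga0 X0; exists (expR (X `^ ga^-1) `^ ga) => m.
have -> : X ^+ m / m`!%:R `^ ga = ((X `^ ga^-1) ^+ m / m`!%:R) `^ ga.
  rewrite powRM ?exprn_ge0 ?powR_ge0 ?invr_ge0//.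
  rewrite -[X in _ = X `^ ga * _]powR_mulrn ?powR_ge0// -!powRrM.
  rewrite [m%:R * ga]mulrC mulKf ?gt_eqF// powR_mulrn//; congr (_ * _).
  by rewrite -[X in _ = X `^ ga]powR_inv1// -powRrM mulN1r powRN.
have h := pow_le_fact_expR m (powR_ge0 X ga^-1).
apply: (ge0_ler_powR (ltW ga0)) h; rewrite nnegrE ?expR_ge0//.
by rewrite divr_ge0// exprn_ge0// powR_ge0.
Qed.

(** The terms are at most C^m / (m!)^(1 - alpha) up to a constant; doubling C
    in the boundedness lemma leaves a geometric series of ratio 1/2. *)
Lemma is_cvg_bbound al T : 0 < al < 1 -> 0 <= T ->
  cvgn (series (fun m => T ^+ m / m`!%:R * bbound (al * m.+1%:R))).
Proof.
move=> al01 T0; have /andP[al0 al1] := al01.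
(* The factor 2 in front leaves the geometric series of ratio 1/2 after the
   bound at X. *)
pose X := 2 * (T * (2 * expR 2)).
have X0 : 0 <= X by rewrite /X !mulr_ge0 ?expR_ge0.
have [|B hB] := @pow_fact_bounded (1 - al) X _ X0; first by rewrite subr_gt0.
apply: (@series_le_cvg _ _ (geometric (expR 1 * expR 2 * B) 2^-1)).
- by move=> m /=; rewrite mulr_ge0 ?bbound_ge0// divr_ge0// exprn_ge0.
- move=> m /=; rewrite mulr_ge0 ?exprn_ge0 ?mulr_ge0 ?expR_ge0//.
  by apply: le_trans (hB 0); rewrite divr_ge0 ?powR_ge0 ?exprn_ge0.
- move=> m /=.
  apply: le_trans (ler_wpM2l _ (bbound_fact m al01)) _.
    by rewrite divr_ge0// exprn_ge0.
  rewrite -[leRHS]mulrA -[leRHS]mulrA [leRHS]mulrA.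
  rewrite [leLHS](_ : _ = (expR 1 * expR 2) * ((X ^+ m / m`!%:R `^ (1 - al)) * 2^-1 ^+ m)).
    by rewrite ler_wpM2l ?mulr_ge0 ?expR_ge0// ler_wpM2r ?hB.
  rewrite powRB; last by rewrite factr_neq0 implybT.
  rewrite powRr1// invf_div /X exprMn [2^-1 ^+ m]exprVn !exprMn.
  have : 2 ^+ m != 0 :> R by rewrite expf_neq0.
  move: (2 ^+ m) (factr_neq0 (R := R) m) => w f0 w0; field.
  by rewrite f0 w0.
- by apply: is_cvg_geometric_series; rewrite ger0_norm ?invf_lt1 ?ltr1n.
Qed.

End wright_summability.

(** * The Gamma integral *)

Section improper.
Context {R : realType}.
Notation mu := (@lebesgue_measure R).

(** The fundamental theorem of calculus; two-sided derivatives at the end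
    points keep one-sided limits out of the hypotheses. *)
Lemma derive_integral (f F : R -> R) (a b : R) : a < b ->
  (forall x, a <= x <= b -> is_derive x 1 F (f x)) ->
  (forall x, a <= x <= b -> {for x, continuous f}) ->
  (\int[mu]_(x in `[a, b]) (f x)%:E = (F b - F a)%:E)%E.
Proof.
move=> ab dF cf; have cF x : a <= x <= b -> {for x, continuous F}.
  by move=> /dF h; apply/differentiable_continuous/derivable1_diffP; exact: ex_derive.
rewrite EFinB; apply: continuous_FTC2 => //.
- apply: continuous_in_subspaceT => x; rewrite inE/= in_itv/=; exact: cf.
- split.
  + move=> x; rewrite in_itv/= => /andP[ax xb].
    by apply: (@ex_derive _ _ _ _ _ _ _ (dF x _)); rewrite !ltW.
  + by apply: cvg_at_right_filter; apply: cF; rewrite lexx ltW.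
  + by apply: cvg_at_left_filter; apply: cF; rewrite lexx ltW.
- move=> x; rewrite in_itv/= => /andP[ax xb].
  by rewrite derive1E; apply: (@derive_val _ _ _ _ _ _ _ (dF x _)); rewrite !ltW.
Qed.

(** Both ends move, so that integrals singular at 0 and extending to infinity
    are limits of integrals of continuous functions on segments. *)
Definition exhaust (k : nat) : set R := `[k.+2%:R^-1, k.+2%:R].

Lemma bigcup_exhaust : \bigcup_k exhaust k = `]0, +oo[%classic.
Proof.
apply/seteqP; split => x /=.
  move=> [k _]; rewrite /exhaust /= in_itv/= => /andP[h _].
  by rewrite in_itv/= andbT (lt_le_trans _ h).
rewrite in_itv/= andbT => x0; pose k := Num.truncn (x + x^-1).
have h : x + x^-1 < k.+1%:R by rewrite truncnS_gt.
have xi : 0 < x^-1 by rewrite invr_gt0.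
have h2 : x + x^-1 <= k.+2%:R by rewrite (le_trans (ltW h))// ler_nat.
exists k => //; rewrite /exhaust/= in_itv/=; apply/andP; split; last by lra.
by rewrite invf_ple ?posrE//; lra.
Qed.

Lemma nondecreasing_exhaust : nondecreasing_seq exhaust.
Proof.
apply/nondecreasing_seqP => k; rewrite subsetEset => x.
rewrite /exhaust/= !in_itv/= => /andP[h1 h2]; apply/andP; split.
  by apply: le_trans h1; rewrite lef_pV2 ?posrE// ler_nat.
by apply: le_trans h2 _; rewrite ler_nat.
Qed.

Lemma exhaust_sub k : exhaust k `<=` `]0, +oo[%classic.
Proof. by rewrite -bigcup_exhaust; exact: bigcup_sup. Qed.

Lemma improper_cvg (f : R -> R) : measurable_fun (`]0, +oo[%classic : set R) f ->
  (forall x, 0 < x -> 0 <= f x) ->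
  (\int[mu]_(x in exhaust k) (f x)%:E @[k --> \oo] -->
   \int[mu]_(x in `]0%R, +oo[) (f x)%:E)%E.
Proof.
move=> mf f0; rewrite -bigcup_exhaust.
apply: (@ge0_nondecreasing_set_cvg_integral _ (measurableTypeR R) R exhaust (EFin \o f) mu).
- exact: nondecreasing_exhaust.
- by move=> k; exact: measurable_itv.
- move=> k; apply/measurable_EFinP; apply: measurable_funS mf => //.
  exact: exhaust_sub.
- move=> k x /exhaust_sub/=; rewrite in_itv/= andbT => x0.
  by rewrite lee_fin f0.
Qed.

End improper.

Section gamma.
Context {R : realType}.
Notation mu := (@lebesgue_measure R).
Implicit Types (x y t : R).

Definition gfun x (t : R) : R := t `^ (x - 1) * expR (- t).

Definition gint x : \bar R := (\int[mu]_(t in `]0%R, +oo[) (gfun x t)%:E)%E.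

Lemma gfun_ge0 x t : 0 <= gfun x t.
Proof. by rewrite mulr_ge0 ?powR_ge0 ?expR_ge0. Qed.

Lemma measurable_gfun x (D : set R) : measurable_fun D (gfun x).
Proof.
apply: measurable_funTS; apply: measurable_funM => //.
exact: (measurableT_comp (@measurable_expR R)).
Qed.

Lemma continuous_gfun x t : 0 < t -> {for t, continuous (gfun x)}.
Proof.
move=> t0; apply: continuousM.
  apply/differentiable_continuous/derivable1_diffP.
  by apply: derivable_powR; rewrite in_itv/= andbT.
apply: continuous_comp; first exact: opp_continuous.
exact: continuous_expR.
Qed.

Lemma is_derive_gfun x t : 0 < t ->
  is_derive t 1 (gfun (x + 1)) (x * gfun x t - gfun (x + 1) t).
Proof.
move=> t0.
have d1 : is_derive t 1 (fun s : R => s `^ (x + 1 - 1)) ((x + 1 - 1) * t `^ (x + 1 - 1 - 1)).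
  exact: is_derive1_powR.
have d2 : is_derive t 1 (fun t : R => expR (- t)) (- expR (- t)).
  rewrite -[X in is_derive _ _ _ X]mulrN1.
  by apply: (@is_derive1_comp _ expR -%R t); exact: is_deriveNid.
apply: (is_derive_eq (is_deriveM d1 d2)).
rewrite -[_ *: _]/(_ * _) -[X in _ + X = _]/(_ * _) /= /gfun addrK; ring.
Qed.

Lemma gfun_cvg0 x : 0 < x -> gfun (x + 1) k.+2%:R^-1 @[k --> \oo] --> 0.
Proof.
move=> x0; rewrite /gfun addrK -[X in _ --> X](mul0r (expR (- 0))).
have hk : (k.+2%:R^-1 : R) @[k --> \oo] --> 0.
  by have := @cvg_harmonic R; rewrite -cvg_shiftS.
apply: cvgM.
  by have /cvg_at_rightP := @powR_cvg0 R x x0; apply; split.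
apply: continuous_cvg; first exact: continuous_expR.
exact: cvgN.
Qed.

Lemma gfun_cvgy x : 0 < x -> gfun (x + 1) k.+2%:R @[k --> \oo] --> 0.
Proof.
move=> x0; rewrite /gfun addrK; pose n := (Num.truncn x).+1.
have nx : x <= n%:R by rewrite ltW// truncnS_gt.
apply: (@squeeze_cvgr _ _ _ _ (fun=> 0) (fun k => n.+1`!%:R * k.+2%:R^-1)).
- apply: nearW => k; rewrite mulr_ge0 ?powR_ge0 ?expR_ge0//=.
  have k1 : 1 <= k.+2%:R :> R by rewrite ler1n.
  apply: le_trans (ler_wpM2r (expR_ge0 _) (ler_powR k1 nx)) _.
  rewrite powR_mulrn// expRN ler_pdivrMr ?expR_gt0//.
  have := @pow_le_fact_expR R k.+2%:R n.+1 (ler0n _ _).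
  rewrite ler_pdivrMr ?factr_gt0// => h.
  rewrite mulrAC ler_pdivlMr// mulrC -exprS (le_trans h)// mulrC.
  by [].
- exact: cvg_cst.
- rewrite -[X in _ --> X](mulr0 n.+1`!%:R); apply: cvgM; first exact: cvg_cst.
  by have := @cvg_harmonic R; rewrite -cvg_shiftS.
Qed.

(** Integration by parts, done by integrating the derivative of t^x e^(-t)
    over a segment and letting both ends go to their limits. *)
Lemma gintS x : 0 < x -> (gint (x + 1) = x%:E * gint x)%E.
Proof.
move=> x0.
have h k : (x%:E * \int[mu]_(t in exhaust k) (gfun x t)%:E +
    (gfun (x + 1) k.+2%:R^-1)%:E = \int[mu]_(t in exhaust k) (gfun (x + 1) t)%:E +
    (gfun (x + 1) k.+2%:R)%:E)%E.
  have kk : (k.+2%:R^-1 : R) < k.+2%:R.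
    by rewrite (lt_trans (_ : _ < 1)) ?invf_lt1 ?ltr1n.
  have pos (t : R) : k.+2%:R^-1 <= t <= k.+2%:R -> 0 < t.
    by move=> /andP[h _]; apply: lt_le_trans h.
  have pos' t : exhaust k t -> 0 < t.
    by rewrite /exhaust/= in_itv/=; exact: pos.
  have mE : measurable (exhaust k : set (measurableTypeR R)).
    exact: measurable_itv.
  have int y : mu.-integrable (exhaust k) (EFin \o gfun y).
    apply: continuous_compact_integrable; first exact: segment_compact.
    apply: continuous_in_subspaceT => t /set_mem/pos' t0.
    exact: continuous_gfun.
  have := @derive_integral R (fun t => x * gfun x t - gfun (x + 1) t) (gfun (x + 1))
    _ _ kk (fun t ht => is_derive_gfun x (pos t ht)).
  rewrite -/(exhaust k) => E.
  have {E} : (\int[mu]_(t in exhaust k) (x * gfun x t - gfun (x + 1) t)%:E =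
      (gfun (x + 1) k.+2%:R - gfun (x + 1) k.+2%:R^-1)%:E)%E.
    apply: E => t /pos t0; apply: continuousB; last exact: continuous_gfun.
    by apply: continuousM; [exact: cst_continuous|exact: continuous_gfun].
  have ix : mu.-integrable (exhaust k) (EFin \o (fun t => x * gfun x t)).
    have := integrableZl mE x (int x).
    by apply: eq_integrable => // t _ /=; rewrite EFinM.
  rewrite integralB_EFin//.
  have -> : (\int[mu]_(t in exhaust k) (x * gfun x t)%:E =
      x%:E * \int[mu]_(t in exhaust k) (gfun x t)%:E)%E.
    by under eq_integral do rewrite EFinM; exact: (integralZl mE (int x)).
  have := integrable_fin_num _ (int x).
  have := integrable_fin_num _ (int (x + 1)).
  rewrite /comp.
  move=> /(_ mE)/fineK <- /(_ mE)/fineK <-.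
  rewrite -!EFinM -EFinB -!EFinD => -[E]; congr EFin; lra.
have h1 := @improper_cvg _ _ (@measurable_gfun x _) (fun t _ => gfun_ge0 x t).
have h2 := @improper_cvg _ _ (@measurable_gfun (x + 1) _) (fun t _ => gfun_ge0 (x + 1) t).
have l1 : (x%:E * \int[mu]_(t in exhaust k) (gfun x t)%:E +
    (gfun (x + 1) k.+2%:R^-1)%:E @[k --> \oo] --> x%:E * gint x + 0%:E)%E.
  apply: cvgeD; first by rewrite fin_num_adde_defl.
    by apply: cvgeZl.
  by apply/fine_cvgP; split; [exact: nearW|exact: gfun_cvg0].
have l2 : (\int[mu]_(t in exhaust k) (gfun (x + 1) t)%:E +
    (gfun (x + 1) k.+2%:R)%:E @[k --> \oo] --> gint (x + 1) + 0%:E)%E.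
  apply: cvgeD; first by rewrite fin_num_adde_defl.
    by [].
  by apply/fine_cvgP; split; [exact: nearW|exact: gfun_cvgy].
rewrite -[LHS]adde0 -[RHS]adde0; apply: cvg_unique l2 _ => //.
by rewrite -(funext h).
Qed.

End gamma.

Section gamma2.
Context {R : realType}.
Notation mu := (@lebesgue_measure R).
Implicit Types (x y t : R).

Lemma measurable_ray : measurable (`]0%R, +oo[%classic : set (measurableTypeR R)).
Proof. exact: measurable_itv. Qed.
Hint Resolve measurable_ray : core.

Lemma integral_expRN (c : R) : 0 < c ->
  (\int[mu]_(t in `]0%R, +oo[) (expR (- (c * t)))%:E = (c^-1)%:E)%E.
Proof.
move=> c0.
have dF t : is_derive t 1 (fun t => - (c^-1 * expR (- (c * t)))) (expR (- (c * t))).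
  have d1 : is_derive t 1 (fun t : R => - (c * t)) (- c).
    rewrite -[X in is_derive _ _ _ (- X)]mulr1.
    exact: (is_deriveN (is_deriveZ c (is_derive_id t 1))).
  have d2 := @is_derive1_comp _ expR _ t _ _ (is_derive_expR _) d1.
  apply: (is_derive_eq (is_deriveN (is_deriveZ c^-1 d2))).
  rewrite -[_ *: _]/(_ * _) /=.
  by rewrite mulrN mulrN opprK mulrCA mulVf ?mulr1// gt_eqF.
have h k : (\int[mu]_(t in exhaust k) (expR (- (c * t)))%:E =
    (c^-1 * expR (- (c * k.+2%:R^-1)) - c^-1 * expR (- (c * k.+2%:R)))%:E)%E.
  have kk : (k.+2%:R^-1 : R) < k.+2%:R.
    by rewrite (lt_trans (_ : _ < 1)) ?invf_lt1 ?ltr1n.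
  rewrite (derive_integral kk (fun t _ => dF t)).
    by congr EFin; ring.
  move=> t _; apply: continuous_comp; last exact: continuous_expR.
  by apply: continuousN; apply: mulrl_continuous.
have me : measurable_fun (`]0, +oo[%classic : set R) (fun t : R => expR (- (c * t))).
  apply: measurable_funTS; apply: (measurableT_comp (@measurable_expR R)).
  by apply: measurable_funN; apply: measurable_funM.
have := improper_cvg me (fun t _ => expR_ge0 _).
rewrite (funext h) => l1.
apply: (cvg_unique _ l1) => //.
apply/fine_cvgP; split; first exact: nearW.
have hk : (k.+2%:R^-1 : R) @[k --> \oo] --> 0.
  by have := @cvg_harmonic R; rewrite -cvg_shiftS.
have a1 : c^-1 * expR (- (c / k.+2%:R)) @[k --> \oo] --> c^-1 * expR (- (c * 0)).
  apply: cvgM; first exact: cvg_cst.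
  apply: continuous_cvg; first exact: continuous_expR.
  by apply: cvgN; apply: cvgM => //; exact: cvg_cst.
have a2 : expR (- (c * k.+2%:R)) @[k --> \oo] --> (0 : R).
  apply: (@squeeze_cvgr _ _ _ _ (fun=> 0) (fun k => c^-1 * k.+2%:R^-1)).
  - apply: nearW => k; rewrite expR_ge0/= expRN -invfM lef_pV2 ?posrE ?expR_gt0 ?mulr_gt0//.
    by apply: le_trans (expR_ge1Dx _); rewrite lerDr.
  - exact: cvg_cst.
  - have : c^-1 * k.+2%:R^-1 @[k --> \oo] --> c^-1 * 0.
      by apply: cvgM => //; exact: cvg_cst.
    by rewrite mulr0.
have a3 : c^-1 * expR (- (c * k.+2%:R)) @[k --> \oo] --> c^-1 * 0.
  by apply: cvgM => //; exact: cvg_cst.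
have := cvgB a1 a3.
by rewrite !mulr0 oppr0 expR0 mulr1 addr0; apply.
Qed.

Lemma gint_ge0 x : (0 <= gint x)%E.
Proof. by apply: integral_ge0 => t _; rewrite lee_fin gfun_ge0. Qed.

Lemma gint1 : gint (1 : R) = 1%E.
Proof.
rewrite -[RHS]/((1 : R)%:E) -[X in _ = X%:E]invr1 -integral_expRN//.
by apply: eq_integral => t _; rewrite /gfun subrr powRr0 !mul1r.
Qed.

Lemma gint_nat n : gint (n.+1%:R : R) = (n`!%:R)%:E.
Proof.
elim: n => [|n IH]; first by rewrite fact0 gint1.
by rewrite -natr1 gintS// IH -EFinM factS natrM.
Qed.

(** Comparing t^x with 1 + t^n shows that Gamma(x + 1) is at most 1 + n!, and
    the recursion passes from x + 1 to x. *)
Lemma gint_lty x : 0 < x -> (gint x < +oo)%E.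
Proof.
move=> x0; have xi : 0 < x^-1 by rewrite invr_gt0.
have : (gint (x + 1) < +oo)%E.
  pose n := (Num.truncn x).+1.
  have nx : x <= n%:R by rewrite ltW// truncnS_gt.
  have : (gint (x + 1) <= gint (1 : R) + gint (n.+1%:R : R))%E.
    rewrite /gint -ge0_integralD//; last first.
    - by apply/measurable_EFinP; exact: measurable_gfun.
    - by move=> t _; rewrite lee_fin gfun_ge0.
    - by apply/measurable_EFinP; exact: measurable_gfun.
    - by move=> t _; rewrite lee_fin gfun_ge0.
    apply: ge0_le_integral => //.
    - by move=> t _; rewrite lee_fin gfun_ge0.
    - by apply/measurable_EFinP; exact: measurable_gfun.
    - apply/measurable_EFinP; apply: measurable_funD; exact: measurable_gfun.
    - move=> t; rewrite /= in_itv/= andbT => t0.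
      rewrite -EFinD lee_fin /gfun -mulrDl ler_wpM2r ?expR_ge0//.
      rewrite addrK subrr powRr0 -natr1 addrK.
      have [t1|/ltW t1] := leP 1 t.
        by apply: le_trans (ler_powR t1 nx) _; rewrite lerDr.
      have := @ger_powR _ t _ _ _ (ltW x0); rewrite powRr0 t0 t1 => /(_ isT) h.
      by apply: le_trans h _; rewrite lerDl powR_ge0.
  by rewrite gint1 gint_nat => h; apply: le_lt_trans h _; rewrite -EFinD ltry.
rewrite gintS//; have := gint_ge0 x; case: (gint x) => [r _ _|_|//].
  by rewrite ltry.
by rewrite gt0_muley ?lte_fin.
Qed.

Lemma Gamma_posE x : 0 < x -> (Gamma_pos x)%:E = gint x.
Proof. by move=> x0; rewrite fineK// ge0_fin_numE ?gint_ge0// gint_lty. Qed.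

Lemma Gamma_posS x : 0 < x -> Gamma_pos (x + 1) = x * Gamma_pos x.
Proof.
by move=> x0; apply: EFin_inj; rewrite EFinM !Gamma_posE ?addr_gt0// gintS.
Qed.

Lemma Gamma_pos1 : Gamma_pos (1 : R) = 1.
Proof. by apply: EFin_inj; rewrite Gamma_posE// gint1. Qed.

Lemma Gamma_pos_nat n : Gamma_pos (n.+1%:R : R) = n`!%:R.
Proof. by apply: EFin_inj; rewrite Gamma_posE// gint_nat. Qed.

(** Weighted arithmetic-geometric mean, from the convexity of the
    exponential. *)
Lemma powR_young (q u : R) : 0 <= q <= 1 -> 0 < u -> u `^ q <= 1 - q + q * u.
Proof.
move=> q01 u0.
have /andP[q0 q1] := q01.
have := @convex_expR R (Itv01 q0 q1) (ln u) 0.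
rewrite !convRE /= !mulr0 !addr0 expR0 mulr1 lnK ?posrE// /powR gt_eqF//.
by rewrite [leRHS]addrC.
Qed.

(** A log-convexity bound for Gamma: with t^q = x^q (t/x)^q <= x^q
    (1 - q + q t/x) the two resulting integrals are Gamma(x) and
    Gamma(x + 1) = x Gamma(x), and the weights add up to 1. *)
Lemma Gamma_pos_powR x q : 0 < x -> 0 <= q <= 1 ->
  Gamma_pos (x + q) <= x `^ q * Gamma_pos x.
Proof.
move=> x0 q01; have /andP[q0 q1] := q01.
have xq0 : 0 < x + q by rewrite ltr_pwDl.
rewrite -lee_fin EFinM !Gamma_posE//.
have e : ((x `^ q)%:E * gint x = (x `^ q * (1 - q))%:E * gint x +
    (x `^ q * q / x)%:E * gint (x + 1))%E.
  rewrite -!Gamma_posE ?addr_gt0// Gamma_posS// -!EFinM -EFinD; congr EFin.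
  by field; rewrite gt_eqF.
rewrite e /gint -!ge0_integralZl//; last first.
- by rewrite lee_fin mulr_ge0 ?powR_ge0// subr_ge0.
- by move=> t _; rewrite lee_fin gfun_ge0.
- by apply/measurable_EFinP; exact: measurable_gfun.
- by rewrite lee_fin !mulr_ge0 ?powR_ge0// ?invr_ge0 ltW.
- by move=> t _; rewrite lee_fin gfun_ge0.
- by apply/measurable_EFinP; exact: measurable_gfun.
rewrite -ge0_integralD//; last first.
- by apply/measurable_EFinP; apply: measurable_funM => //; exact: measurable_gfun.
- move=> t _; rewrite -EFinM lee_fin; apply: mulr_ge0; last exact: gfun_ge0.
  by rewrite !mulr_ge0 ?powR_ge0// ?invr_ge0 ltW.
- by apply/measurable_EFinP; apply: measurable_funM => //; exact: measurable_gfun.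
- move=> t _; rewrite -EFinM lee_fin; apply: mulr_ge0; last exact: gfun_ge0.
  by rewrite mulr_ge0 ?powR_ge0// subr_ge0.
apply: ge0_le_integral => //.
- by move=> t _; rewrite lee_fin gfun_ge0.
- by apply/measurable_EFinP; exact: measurable_gfun.
- apply/measurable_EFinP; apply: measurable_funD;
    by apply: measurable_funM => //; exact: measurable_gfun.
- move=> t; rewrite /= in_itv/= andbT => t0.
  rewrite -!EFinM -EFinD lee_fin /gfun.
  have tx0 : 0 < t / x by rewrite divr_gt0.
  have h := powR_young q01 tx0.
  have -> : t `^ (x + q - 1) = x `^ q * (t / x) `^ q * t `^ (x - 1).
    rewrite -powRM ?(ltW x0) ?(ltW tx0)// mulrCA mulfV ?gt_eqF// mulr1.
    by rewrite -powRD ?(gt_eqF t0) ?implybT//; congr (_ `^ _); ring.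
  have -> : t `^ (x + 1 - 1) = t * t `^ (x - 1).
    by rewrite addrK mulr_powRB1// ltW.
  have -> : x `^ q * (1 - q) * (t `^ (x - 1) * expR (- t)) +
     x `^ q * q / x * (t * t `^ (x - 1) * expR (- t)) =
     x `^ q * (1 - q + q * (t / x)) * t `^ (x - 1) * expR (- t).
    by field; rewrite gt_eqF.
  by rewrite ler_wpM2r ?expR_ge0// ler_wpM2r ?powR_ge0// ler_wpM2l ?powR_ge0.
Qed.

Lemma Gamma_pos_gt0 x : 0 < x <= 1 -> 0 < Gamma_pos x.
Proof.
move=> /andP[x0 x1]; have := @Gamma_pos_powR x (1 - x) x0.
rewrite subrKC Gamma_pos1 subr_ge0 x1 lerBlDr lerDl (ltW x0) => /(_ isT) h.
by have := lt_le_trans ltr01 h; rewrite pmulr_rgt0// powR_gt0.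
Qed.

Lemma rising_Gamma x k : 0 < x -> Gamma_pos (x + k%:R) = rising x k * Gamma_pos x.
Proof.
move=> x0; elim: k => [|k IH]; first by rewrite addr0 rising0 mul1r.
have xk : 0 < x + k%:R by rewrite ltr_pwDl.
by rewrite -natr1 addrA (Gamma_posS xk) IH risingSr; ring.
Qed.

(** Gauss's limit for 1/Gamma on ]0, 1]. The ratio Gamma(x + k) / k! is
    squeezed by two uses of the log-convexity bound, between k and k + x and
    between k + x and k + 1. *)
Lemma gauss_limit01 x : 0 < x <= 1 ->
  bcoef x k * k%:R `^ (1 - x) @[k --> \oo] --> (Gamma_pos x)^-1.
Proof.
move=> x01; have /andP[x0 x1] := x01; have G0 := Gamma_pos_gt0 x01.
have x1' : 0 <= 1 - x <= 1 by rewrite subr_ge0 x1 lerBlDr lerDl ltW.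
have x01' : 0 <= x <= 1 by rewrite x1 ltW.
have rE k : bcoef x k.+1 = Gamma_pos (x + k.+1%:R) / k.+1`!%:R / Gamma_pos x.
  by rewrite /bcoef rising_Gamma// mulrAC mulfK// gt_eqF.
rewrite -cvg_shiftS /=.
apply: (@squeeze_cvgr _ _ _ _ (fun k => (1 - x * k.+1%:R^-1) / Gamma_pos x)
   (fun=> (Gamma_pos x)^-1)).
- apply: nearW => k; set K : R := k.+1%:R.
  have K0 : 0 < K by rewrite /K.
  have kx : 0 < K + x by rewrite addr_gt0.
  have up : Gamma_pos (x + K) <= K `^ x * k`!%:R.
    by rewrite addrC -Gamma_pos_nat; exact: Gamma_pos_powR.
  (* Here (k+1)! = Gamma(K + 1) with K + 1 = (K + x) + (1 - x). *)
  have lo : k.+1`!%:R <= (K + x) `^ (1 - x) * Gamma_pos (x + K).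
    rewrite -Gamma_pos_nat -[k.+2%:R]natr1 -/K.
    rewrite (_ : K + 1 = (K + x) + (1 - x)); last by ring.
    by rewrite (addrC x); exact: Gamma_pos_powR.
  have f0 := factr_gt0 (R := R) k.+1.
  rewrite rE (_ : _ * K `^ (1 - x) =
    (Gamma_pos (x + K) / k.+1`!%:R * K `^ (1 - x)) / Gamma_pos x); last by ring.
  rewrite -[X in _ && (_ <= X)]mul1r !ler_wpM2r ?invr_ge0 ?(ltW G0)//=.
    rewrite mulrAC ler_pdivrMr// mul1r factS natrM -/K.
    apply: le_trans (ler_wpM2r (powR_ge0 _ _) up) _.
    rewrite mulrAC -powRD ?(gt_eqF K0) ?implybT// subrKC powRr1//; exact: ltW.
  have B0 : 0 < (K + x) `^ (1 - x) by rewrite powR_gt0.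
  have h1 : 1 - x * K^-1 <= K / (K + x).
    move: (K) K0 kx => J J0 Jx; rewrite ler_pdivlMr//.
    rewrite [leLHS](_ : _ = J - x ^+ 2 / J); last by field; rewrite gt_eqF.
    by rewrite gerBl divr_ge0 ?sqr_ge0// ltW.
  have h2 : K / (K + x) <= K `^ (1 - x) / (K + x) `^ (1 - x).
    have K1 : 0 < K / (K + x) <= 1.
      by rewrite divr_gt0//= ler_pdivrMr// mul1r lerDl ltW.
    have := ger1_powR K1 (proj2 (andP x1')).
    rewrite powRM ?invr_ge0 ?(ltW K0) ?(ltW kx)//.
    suff -> : (K + x)^-1 `^ (1 - x) = ((K + x) `^ (1 - x))^-1 by [].
    by rewrite -(powR_inv1 (ltW kx)) -powRrM mulN1r powRN.
  apply: le_trans h1 (le_trans h2 _).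
  rewrite mulrC ler_wpM2r ?powR_ge0// ler_pdivlMr// mulrC ler_pdivrMr//.
  by rewrite [leRHS]mulrC.
- have hk : (k.+1%:R^-1 : R) @[k --> \oo] --> 0 by exact: cvg_harmonic.
  have : (1 - x * k.+1%:R^-1) / Gamma_pos x @[k --> \oo] -->
      (1 - x * 0) / Gamma_pos x.
    apply: cvgM; last exact: cvg_cst.
    by apply: cvgB; [exact: cvg_cst|apply: cvgM => //; exact: cvg_cst].
  by rewrite mulr0 subr0 mul1r.
- exact: cvg_cst.
Qed.

(** Going from x to x - 1 multiplies both sides by x - 1, up to a factor
    k / (k + x - 1) that tends to 1. At a pole of Gamma the limit is 0, in
    accordance with 1/Gamma = 0. *)
Lemma gauss_limit_pred x L :
  bcoef x k * k%:R `^ (1 - x) @[k --> \oo] --> L ->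
  bcoef (x - 1) k * k%:R `^ (1 - (x - 1)) @[k --> \oo] --> (x - 1) * L.
Proof.
move=> h.
have h1 : (1 + (x - 1) * k%:R^-1)^-1 @[k --> \oo] --> (1 + (x - 1) * 0)^-1.
  apply: cvgV; first by rewrite mulr0 addr0.
  apply: cvgD; first exact: cvg_cst.
  apply: cvgM; first exact: cvg_cst.
  by rewrite -cvg_shiftS; exact: cvg_harmonic.
have h2 : (x - 1) * (bcoef x k * k%:R `^ (1 - x)) * (1 + (x - 1) * k%:R^-1)^-1
    @[k --> \oo] --> (x - 1) * L * (1 + (x - 1) * 0)^-1.
  by apply: cvgM => //; apply: cvgM => //; exact: cvg_cst.
rewrite mulr0 addr0 invr1 mulr1 in h2.
apply: cvg_trans h2; apply: near_eq_cvg.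
near=> k.
have k0 : 0 < k%:R :> R by rewrite ltr0n; near: k; exact: nbhs_infty_gt.
have kx : x - 1 + k%:R != 0.
  suff : 1 - x < k%:R by move=> ?; rewrite gt_eqF//; lra.
  near: k; exact: nbhs_infty_gtr.
have e : bcoef (x - 1) k * (x - 1 + k%:R) = (x - 1) * bcoef x k.
  by rewrite /bcoef mulrAC -risingSr risingSl subrK mulrA.
have -> : k%:R `^ (1 - (x - 1)) = k%:R * k%:R `^ (1 - x).
  rewrite -[X in X * _]powRr1// -powRD ?(gt_eqF k0) ?implybT//.
  by congr (_ `^ _); ring.
rewrite mulrA -e (_ : (1 + (x - 1) * k%:R^-1) = (x - 1 + k%:R) / k%:R).
  by field; rewrite (gt_eqF k0).
by field; rewrite gt_eqF.
Unshelve. all: by end_near. Qed.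

(** Gauss's limit for every x <= 1, in the form needed for the terms of the
    Wright series, where x = 1 - alpha (m + 1). *)
Lemma gauss_limit x : x <= 1 ->
  bcoef x k * k%:R `^ (1 - x) @[k --> \oo] --> (Gamma x)^-1.
Proof.
move=> x1; rewrite /Gamma; case: ifPn => [x0|]; first by apply: gauss_limit01; rewrite x0.
rewrite -leNgt => x0; set K := (Num.truncn (- x)).+1; rewrite invfM invrK.
have K1 : - x < K%:R by rewrite truncnS_gt.
have K2 : (K.-1)%:R <= - x by rewrite truncn_le// oppr_ge0.
have y01 : 0 < x + K%:R <= 1.
  rewrite -[K%:R]natr1 in K1 *.
  apply/andP; split; first by lra.
  by move: K2; rewrite /=; lra.
have -> : \prod_(i < K) (x + i%:R) = rising x K by [].
(* With y = x + K in ]0, 1], the claim at y - K follows by K downward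
   steps. *)
clearbody K; have {1 2 4}-> : x = x + K%:R - K%:R by rewrite addrK.
move: (x + K%:R) y01 => y y01; clear K1 K2; elim: K => [|n IH].
  rewrite subr0 rising0 mulr1; exact: gauss_limit01.
have := gauss_limit_pred IH.
have -> : y - n.+1%:R = y - n%:R - 1 by rewrite -natr1 opprD addrA.
have -> : rising (y - n%:R - 1) n.+1 = (y - n%:R - 1) * rising (y - n%:R) n.
  by rewrite risingSl subrK.
by rewrite [(Gamma_pos y)^-1 * (_ * _)]mulrCA.
Qed.

End gamma2.

(** * Newton expansion of binomial coefficients *)

Section vandermonde.
Context {R : realType}.
Implicit Types (x y al : R).

(** The Cauchy product of two binomial series, proved on coefficients from the
    first order recurrence that both sides satisfy. *)
Lemma bcoef_vandermonde x y k :
  bcoef (x + y) k = \sum_(i < k.+1) bcoef x i * bcoef y (k - i).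
Proof.
have bS z i : i.+1%:R * bcoef z i.+1 = (z + i%:R) * bcoef z i.
  by rewrite bcoefSr mulrCA [X in _ * X]mulrCA mulfV// mulr1 mulrC.
elim: k => [|k IH]; first by rewrite big_ord1 !bcoef0 mulr1.
have k0 : k.+1%:R != 0 :> R by [].
apply: (mulfI k0); rewrite bS {}IH.
(* The factor k + 1 is split as i + (k + 1 - i), and each part shifts one of
   the two indices. *)
transitivity (\sum_(i < k.+2) i%:R * bcoef x i * bcoef y (k.+1 - i) +
  \sum_(i < k.+2) bcoef x i * ((k.+1 - i)%:R * bcoef y (k.+1 - i))).
  rewrite [X in _ = X + _]big_ord_recl !mul0r add0r.
  rewrite [X in _ = _ + X]big_ord_recr /= subnn mul0r mulr0 addr0.
  rewrite -big_split mulr_sumr; apply: eq_bigr => i _.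
  rewrite /= bS /bump leq0n add1n subSS subSn ?leq_ord// bS.
  rewrite (_ : k%:R = i%:R + (k - i)%:R); last by rewrite -natrD subnKC// leq_ord.
  ring.
rewrite -big_split mulr_sumr; apply: eq_bigr => i _ /=.
rewrite (_ : k.+1%:R = i%:R + (k.+1 - i)%:R); last first.
  by rewrite -natrD subnKC// leq_ord.
ring.
Qed.

(** Coefficient of z^k in (1 - z)^(-x) (1 - (1 - z)^al)^m, whose second factor
    is a power series with nonnegative coefficients al / (j + 1) bcoef
    (1 - al) j and no constant term. The recursion on m makes nonnegativity
    and vanishing for k < m visible. *)
Fixpoint newton al x (m k : nat) : R :=
  if m is m'.+1 then
    \sum_(j < k) al / j.+1%:R * bcoef (1 - al) j * newton al x m' (k - j.+1)
  else bcoef x k.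

(** Multiplying by 1 - (1 - z)^al replaces x by x - al in the subtracted term,
    so newton iterates the difference operator of step -al in x. *)
Lemma newtonS al x m k :
  newton al x m.+1 k = newton al x m k - newton al (x - al) m k.
Proof.
elim: m k => [|m IH] k.
  rewrite /= (addrC x) bcoef_vandermonde big_ord_recl bcoef0 mul1r subn0 opprD addNKr.
  rewrite -sumrN; apply: eq_bigr => i _; rewrite /= /bump leq0n add1n -mulNr.
  congr (_ * _); have i0 : i.+1%:R != 0 :> R by [].
  apply: (mulfI i0); rewrite mulrN bcoefSl mulNr opprK (addrC (- al)).
  by move: (bcoef (1 - al) i) => b; rewrite !mulrA [i.+1%:R * al]mulrC mulfK.
rewrite -[LHS]/(\sum_(j < k) al / j.+1%:R * bcoef (1 - al) j *
  newton al x m.+1 (k - j.+1)).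
rewrite -[newton al x m.+1 k]/(\sum_(j < k) al / j.+1%:R * bcoef (1 - al) j *
  newton al x m (k - j.+1)).
rewrite -[newton al (x - al) m.+1 k]/(\sum_(j < k) al / j.+1%:R *
  bcoef (1 - al) j * newton al (x - al) m (k - j.+1)).
by rewrite -sumrB; apply: eq_bigr => j _; rewrite IH mulrBr.
Qed.

(** Newton's formula for l steps of size -al. *)
Lemma bcoef_newton al x l k :
  bcoef (x - al * l%:R) k = \sum_(m < l.+1) (-1) ^+ m * newton al x m k *+ 'C(l, m).
Proof.
elim: l x => [|l IH] x.
  by rewrite mulr0 subr0 big_ord1 expr0 mul1r bin0 mulr1n.
rewrite (_ : x - al * l.+1%:R = (x - al) - al * l%:R); last first.
  by rewrite -natr1; ring.
rewrite IH [RHS]big_ord_recl bin0 expr0 mul1r mulr1n.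
have E (i : 'I_l.+1) : true -> (-1) ^+ bump 0 i * newton al x (bump 0 i) k *+
    'C(l.+1, bump 0 i) = - (-1) ^+ i * newton al x i.+1 k *+ 'C(l, i.+1) +
    (- (-1) ^+ i * newton al x i.+1 k *+ 'C(l, i)).
  by rewrite /bump leq0n add1n binS mulrnDr exprS mulN1r.
rewrite [X in _ = _ + X](eq_bigr _ E) big_split /= addrA.
have -> : newton al x 0 k + \sum_(i < l.+1)
   - (-1) ^+ i * newton al x i.+1 k *+ 'C(l, i.+1) =
   \sum_(m < l.+1) (-1) ^+ m * newton al x m k *+ 'C(l, m).
  rewrite [RHS]big_ord_recl expr0 mul1r bin0 mulr1n; congr (_ + _).
  rewrite big_ord_recr /= bin_small// mulr0n addr0; apply: eq_bigr => i _.
  by rewrite /bump leq0n add1n exprS mulN1r.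
rewrite -big_split /=; apply: eq_bigr => i _.
rewrite -mulrnDl; congr (_ *+ _).
rewrite -[\sum_(j < k) _]/(newton al x i.+1 k) newtonS; ring.
Qed.

Lemma newton_gt al x m k : (k < m)%N -> newton al x m k = 0.
Proof.
elim: m k => // m IH k km; rewrite /= big1// => j _.
by rewrite IH ?mulr0//; have := ltn_ord j; lia.
Qed.

Lemma newton_ge0 al x m k : 0 < al < 1 -> 0 <= x -> 0 <= newton al x m k.
Proof.
move=> /andP[al0 al1] x0; elim: m k => [|m IH] k; first exact: bcoef_ge0.
rewrite /= sumr_ge0// => j _; apply: mulr_ge0 => //; apply: mulr_ge0.
  by rewrite divr_ge0// ltW.
by rewrite bcoef_ge0// subr_ge0 ltW.
Qed.

Lemma newton_diag al x k : newton al x k k = al ^+ k.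
Proof.
elim: k => [|k IH]; first by rewrite /= bcoef0.
rewrite /= big_ord_recl subn1 /= IH bcoef0 divr1 mulr1 big1 ?addr0 ?exprS// => j _.
by rewrite newton_gt ?mulr0//= /bump leq0n; have := ltn_ord j; lia.
Qed.

(** Differences of order more than k vanish, so the number of terms does not
    depend on l and the formula can be summed over l. *)
Lemma bcoef_newton_trunc al x l k :
  bcoef (x - al * l%:R) k =
  \sum_(m < k.+1) (-1) ^+ m * newton al x m k * 'C(l, m)%:R.
Proof.
rewrite bcoef_newton.
have -> : \sum_(m < l.+1) (-1) ^+ m * newton al x m k *+ 'C(l, m) =
   \sum_(m < l.+1 + k.+1) (-1) ^+ m * newton al x m k *+ 'C(l, m).
  rewrite big_split_ord /= [X in _ = _ + X]big1 ?addr0// => i _.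
  by rewrite bin_small ?mulr0n//; lia.
rewrite (addnC l.+1) big_split_ord [X in _ + X = _]big1 ?addr0.
  by apply: eq_bigr => i _; rewrite mulr_natr.
by move=> i _; rewrite newton_gt ?mulr0 ?mul0rn//=; lia.
Qed.

End vandermonde.

(** * The discrete Wright coefficients *)

Section sums.
Context {R : realType}.

Lemma cvg_sumr (I : Type) (r : seq I) (P : pred I) (f : I -> nat -> R) (l : I -> R) :
  (forall i, P i -> f i n @[n --> \oo] --> l i) ->
  \sum_(i <- r | P i) f i n @[n --> \oo] --> \sum_(i <- r | P i) l i.
Proof. by move=> h; apply: cvg_big => //; apply: add_continuous. Qed.

Lemma cvg_seriesZr (f : nat -> R) c : cvgn (series f) ->
  series (fun m => f m * c) n @[n --> \oo] --> limn (series f) * c.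
Proof.
move=> cf; have -> : series (fun m => f m * c) = (fun n => series f n * c).
  by apply/funext => n; rewrite /series /= mulr_suml.
by apply: cvgM => //; exact: cvg_cst.
Qed.

(** The terms with j < m vanish, and C(j, m) / j! = 1 / (m! (j - m)!) turns
    the others into the exponential series. *)
Lemma exp_binomial_cvg (q Y : R) m :
  series (fun j => 'C(j, m)%:R * q ^+ (j - m) * (Y ^+ j / j`!%:R)) n @[n --> \oo] -->
  Y ^+ m / m`!%:R * expR (q * Y).
Proof.
rewrite -(cvg_shiftn m) /=.
have -> : (fun n => series (fun j => 'C(j, m)%:R * q ^+ (j - m) * (Y ^+ j / j`!%:R)) (n + m)%N) =
    (fun n => Y ^+ m / m`!%:R * series (exp_coeff (q * Y)) n).
  apply/funext => n; rewrite /series /= addnC.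
  rewrite (big_cat_nat (n := m)) ?leq_addr//= big_nat big1 ?add0r => [|i /andP[_ im]]; last first.
    by rewrite bin_small// !mul0r.
  rewrite -[X in \sum_(X <= _ < _) _]add0n big_addn addKn mulr_sumr; apply: eq_bigr => i _.
  rewrite addnK /exp_coeff /= (addnC i) exprD exprMn.
  have := @bin_fact (m + i) m; rewrite leq_addr addKn => /(_ isT) e.
  have {}e : 'C(m + i, m)%:R / (m + i)`!%:R = (m`!%:R * i`!%:R)^-1 :> R.
    rewrite -e !natrM [in LHS]invfM mulrA mulfV ?mul1r//.
    by rewrite pnatr_eq0 -lt0n bin_gt0 leq_addr.
  rewrite (_ : _ * (_ / _) = q ^+ i * Y ^+ m * Y ^+ i * ('C(m + i, m)%:R / (m + i)`!%:R)).
    by rewrite e invfM; ring.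
  by move: 'C(m + i, m)%:R (m + i)`!%:R => u v; ring.
by apply: cvgM; [exact: cvg_cst|exact: is_cvg_series_exp_coeff].
Qed.

End sums.

Section wcoef.
Context {R : realType} (al : R) (al01 : 0 < al < 1).
Implicit Types (tau z p : R).

Let al0 : 0 < al. Proof. by case/andP: al01. Qed.

(** The exponent p in the m-th term s^(-p) / Gamma(1 - p) of the Wright
    function. *)
Definition wexp (m : nat) : R := al * m.+1%:R.

Lemma wexp_gt0 m : 0 < wexp m.
Proof. by rewrite mulr_gt0. Qed.

Lemma bcoef_le_bbound (p : R) k : 0 < p -> `|bcoef (1 - p) k| <= bbound p.
Proof.
move=> p0; apply: le_trans (bcoef_bound k p0); rewrite ler_peMr//.
have k1 : 1 <= k.+1%:R :> R by rewrite ler1n.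
by have := ler_powR k1 (ltW p0); rewrite powRr0.
Qed.

Definition wterm tau k m : R := (- tau) ^+ m / m`!%:R * bcoef (1 - wexp m) k.

(** The Taylor coefficient of z^k in (1 - z)^(al - 1) exp(- tau (1 - z)^al),
    obtained by expanding the exponential ([wcoef_gf]). *)
Definition wcoef tau k : R := limn (series (wterm tau k)).

Lemma wterm_bound tau k m : 0 <= tau ->
  `|wterm tau k m| <= tau ^+ m / m`!%:R * bbound (wexp m).
Proof.
move=> t0; rewrite /wterm normrM normrM normfV normrX normrN (ger0_norm t0).
rewrite (ger0_norm (ler0n _ _)) ler_wpM2l ?divr_ge0 ?exprn_ge0//.
by rewrite bcoef_le_bbound// wexp_gt0.
Qed.

Lemma is_cvg_wterm tau k : 0 <= tau -> cvgn (series (wterm tau k)).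
Proof.
move=> t0; apply: dominated_cvg_series (is_cvg_bbound al01 t0) => m.
exact: wterm_bound.
Qed.

(** The closed form shows nonnegativity, and it is the density met on both
    sides of the final identity. It follows from the Newton expansion in the
    summation index, as the sum of C(l, m) (- tau)^l / l! is again an
    exponential. *)
Lemma wcoefE tau k :
  wcoef tau k = expR (- tau) * \sum_(m < k.+1) newton al (1 - al) m k * tau ^+ m / m`!%:R.
Proof.
apply/cvg_lim => //.
have -> : series (wterm tau k) = (fun n => \sum_(m < k.+1) (-1) ^+ m * newton al (1 - al) m k *
    series (fun l => 'C(l, m)%:R * 1 ^+ (l - m) * ((- tau) ^+ l / l`!%:R)) n).
  apply/funext => n; rewrite /series/=; under [RHS]eq_bigr do rewrite mulr_sumr.
  rewrite exchange_big /=; apply: eq_bigr => l _; rewrite /wterm.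
  rewrite (_ : 1 - wexp l = (1 - al) - al * l%:R); last by rewrite /wexp -natr1; ring.
  rewrite bcoef_newton_trunc mulr_sumr; apply: eq_bigr => m _.
  by rewrite expr1n; move: 'C(l, m)%:R => c; ring.
rewrite mulr_sumr.
apply: cvg_sumr => m _.
rewrite (_ : expR (- tau) * _ = (-1) ^+ m * newton al (1 - al) m k *
    ((- tau) ^+ m / m`!%:R * expR (1 * - tau))); last first.
  rewrite mul1r.
  rewrite [(- tau) ^+ m]exprNn.
  have : (-1) ^+ m * (-1) ^+ m = 1 :> R by rewrite -expr2 sqrr_sign.
  move: ((-1) ^+ m) => w w2; rewrite -[LHS]mul1r -w2; ring.
by apply: cvgM; [exact: cvg_cst|exact: exp_binomial_cvg].
Qed.

Lemma wcoef_ge0 tau k : 0 <= tau -> 0 <= wcoef tau k.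
Proof.
have /andP[_ al1] := al01.
move=> t0; rewrite wcoefE mulr_ge0 ?expR_ge0// sumr_ge0// => m _.
by rewrite divr_ge0// mulr_ge0 ?exprn_ge0// newton_ge0// subr_ge0 ltW.
Qed.

(** The expansion in m and the expansion in z are interchanged by Tannery's
    theorem: the m-th term is bounded uniformly in the truncation of the
    z-series, and each z-series is a binomial series. *)
Lemma wcoef_gf tau z : 0 <= tau -> 0 <= z < 1 ->
  series (fun k => wcoef tau k * z ^+ k) n @[n --> \oo] -->
  (1 - z) `^ (al - 1) * expR (- (tau * (1 - z) `^ al)).
Proof.
move=> t0 z01; have /andP[z0 z1] := z01; have z1' : 0 < 1 - z by rewrite subr_gt0.
have zn : `|z| < 1 by rewrite ger0_norm.
(* The m-th term of the exponential expansion, with its z-series truncated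
   at n. *)
pose u n m := (- tau) ^+ m / m`!%:R * pseries (bcoef (1 - wexp m)) z n.
have -> : (fun n => series (fun k => wcoef tau k * z ^+ k) n) =
    (fun n => limn (series (u n))).
  apply/funext => n; apply/esym/cvg_lim => //.
  have -> : series (u n) = (fun N => \sum_(0 <= k < n) series (wterm tau k) N * z ^+ k).
    apply/funext => N; rewrite /series /=.
    under [RHS]eq_bigr do rewrite mulr_suml.
    rewrite exchange_big /=; apply: eq_bigr => m _.
    rewrite /u /pseries /series /= mulr_sumr; apply: eq_bigr => k _.
    by rewrite /wterm mulrA.
  apply: cvg_sumr => k _; apply: cvgM; last exact: cvg_cst.
  exact: is_cvg_wterm.
have -> : (1 - z) `^ (al - 1) * expR (- (tau * (1 - z) `^ al)) =
   limn (series (fun m => (- tau) ^+ m / m`!%:R * (1 - z) `^ (wexp m - 1))).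
  apply/esym/cvg_lim => //.
  have -> : series (fun m => (- tau) ^+ m / m`!%:R * (1 - z) `^ (wexp m - 1)) =
     (fun n => (1 - z) `^ (al - 1) * series (exp_coeff (- (tau * (1 - z) `^ al))) n).
    apply/funext => n; rewrite /series /= mulr_sumr; apply: eq_bigr => m _.
    rewrite /exp_coeff /= -mulNr exprMn -[X in _ = _ * (_ * X / _)]powR_mulrn ?powR_ge0//.
    rewrite -powRrM (_ : wexp m - 1 = (al - 1) + al * m%:R); last first.
      by rewrite /wexp -natr1; ring.
    rewrite powRD; last by rewrite (gt_eqF z1') implybT.
    ring.
  apply: cvgM; first exact: cvg_cst.
  exact: is_cvg_series_exp_coeff.
apply: (@tannery _ u (fun m => (tau ^+ m / m`!%:R * bbound (wexp m)) * (1 - z)^-1)).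
- move=> n m; rewrite /u normrM normrM normfV normrX normrN (ger0_norm t0).
  rewrite normr_nat -[leRHS]mulrA ler_wpM2l ?divr_ge0 ?exprn_ge0//.
  rewrite /pseries /series /=; apply: le_trans (ler_norm_sum _ _ _) _.
  apply: (@le_trans _ _ (bbound (wexp m) * series (geometric 1 z) n)).
    rewrite /series/= mulr_sumr; apply: ler_sum => k _.
    rewrite normrM normrX (ger0_norm z0) mul1r ler_wpM2r ?exprn_ge0//.
    by rewrite bcoef_le_bbound// wexp_gt0.
  rewrite ler_wpM2l ?bbound_ge0//.
  have h := @cvg_geometric_series R 1 z zn; rewrite div1r in h.
  rewrite -(cvg_lim _ h)//; apply: nondecreasing_cvgn_le; last by apply: cvgP h.
  apply: nondecreasing_series => k _ _ /=; rewrite mul1r; exact: exprn_ge0.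
- by apply: cvgP; apply: cvg_seriesZr; exact: is_cvg_bbound.
- move=> m; apply: cvgM; first exact: cvg_cst.
  have := @is_cvg_bcoef R (1 - wexp m) _ zn.
  rewrite -[X in _ --> _ `^ X]opprB -bsumE//; exact.
Qed.

End wcoef.

(** * Step functions on a grid *)

Section step_functions.
Context {R : realType}.
Notation mu := (@lebesgue_measure R).
Implicit Types (a : nat -> R) (M s : R).

Definition cell M (k : nat) : set R := `[k%:R / M, k.+1%:R / M[.

Lemma cellP M k s : 0 < M -> cell M k s <-> 0 <= s /\ Num.truncn (s * M) = k.
Proof.
move=> M0; rewrite /cell/= in_itv/= ler_pdivrMr// ltr_pdivlMr//; split.
  move=> /andP[h1 h2]; split.
    by rewrite -(pmulr_lge0 _ M0) (le_trans _ h1).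
  by apply: truncn_def; rewrite h1.
move=> [s0 <-]; have sM : 0 <= s * M by rewrite mulr_ge0// ltW.
by rewrite truncn_le sM truncnS_gt.
Qed.

Lemma bigcup_cell M : 0 < M -> \bigcup_k cell M k = `[0, +oo[%classic.
Proof.
move=> M0; apply/seteqP; split => s.
  by move=> [k _] /(cellP _ _ M0)[s0 _]; rewrite /= in_itv/= s0.
rewrite /= in_itv/= andbT => s0; exists (Num.truncn (s * M)) => //.
by apply/cellP.
Qed.

Lemma measurable_step a M : 0 < M ->
  measurable_fun (`[0, +oo[%classic : set R) (fun s => a (Num.truncn (s * M))).
Proof.
move=> M0 _ Y mY.
have -> : `[0, +oo[%classic `&` (fun s => a (Num.truncn (s * M))) @^-1` Y =
    \bigcup_(k in [set k | Y (a k)]) cell M k.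
  apply/seteqP; split => s.
    rewrite /= in_itv/= andbT => -[s0 Ys]; exists (Num.truncn (s * M)) => //.
    by apply/cellP.
  by move=> [k /= Yk] /(cellP _ _ M0)[s0 e]; rewrite /= in_itv/= s0 e.
by apply: bigcup_measurable => k _; exact: measurable_itv.
Qed.

Lemma sub_ray : (`]0, +oo[%classic : set R) `<=` `[0, +oo[%classic.
Proof. by move=> s /=; rewrite !in_itv/= !andbT => /ltW. Qed.

(** The half-line is cut into the cells where the integer part is constant. *)
Lemma integral_step a M : 0 < M -> (forall k, 0 <= a k) ->
  (\int[mu]_(s in `]0%R, +oo[) (a (Num.truncn (s * M)))%:E =
   \sum_(k <oo) (a k / M)%:E)%E.
Proof.
move=> M0 a0; have m := measurable_step a M0.
rewrite integral_itv_obnd_cbnd; last first.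
  by apply/measurable_EFinP; apply: measurable_funS m => //; exact: sub_ray.
rewrite -(bigcup_cell M0).
rewrite ge0_integral_bigcup//; last first.
- apply/trivIsetP => i j _ _ ij; apply/seteqP; split => // s [].
  move=> /(cellP _ _ M0)[_ e1] /(cellP _ _ M0)[_ e2].
  by move: ij; rewrite -e1 -e2 eqxx.
- by move=> s _; rewrite lee_fin.
- by apply/measurable_EFinP; rewrite (bigcup_cell M0).
- by move=> k; exact: measurable_itv.
apply: eq_eseriesr => k _.
transitivity (\int[mu]_(s in cell M k) (cst (a k)%:E s))%E.
  by apply: eq_integral => s /set_mem/(cellP _ _ M0)[_ ->].
rewrite integral_cst; last exact: measurable_itv.
rewrite /cell [X in (_ * X)%E]lebesgue_measure_itv /= lte_fin ltr_pM2r ?invr_gt0// ltr_nat ltnSn.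
by rewrite -EFinB -EFinM -mulrBl -natr1 addrAC subrr add0r mul1r.
Qed.

End step_functions.

(** * The Wright function as a limit of step functions *)

Section wfun.
Context {R : realType} (al : R) (al01 : 0 < al < 1).
Notation mu := (@lebesgue_measure R).
Implicit Types (t s d lam M : R).

Let al0 : 0 < al. Proof. by case/andP: al01. Qed.
Let al1 : al < 1. Proof. by case/andP: al01. Qed.

(** The terms of psi_{al, 1 - al}(s, t), with the prefactor s^(-al)
    distributed; the arguments are in the order t, s since t is a parameter in
    all integrals over s. *)
Definition wfun_term t s (m : nat) : R :=
  (- t) ^+ m / m`!%:R * (s `^ (- wexp al m) * (Gamma (1 - wexp al m))^-1).

Definition wfun t s : R := limn (series (wfun_term t s)).

(** The approximation of the Wright function on the grid of mesh 1/(n+1): s is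
    replaced by an index k with k/(n+1) close to s, and s^(-p) / Gamma(1 - p)
    by (n+1)^p bcoef (1 - p) k, to which Gauss's limit applies. *)
Definition wstep t (n : nat) s : R :=
  n.+1%:R `^ al * wcoef al (t * n.+1%:R `^ al) (Num.truncn (s * n.+1%:R)).

(** A majorant of the terms of all approximations at once, decreasing in s. *)
Definition wbound_term t s (m : nat) : R :=
  t ^+ m / m`!%:R * (s `^ (- wexp al m) * bbound (wexp al m)).

Definition wbound t s : R := limn (series (wbound_term t s)).

Lemma wbound_termE t s m : 0 < s ->
  wbound_term t s m = (t * s `^ (- al)) ^+ m / m`!%:R * bbound (wexp al m) * s `^ (- al).
Proof.
move=> s0; rewrite /wbound_term exprMn -[(s `^ (- al)) ^+ m]powR_mulrn ?powR_ge0//.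
rewrite -[_ `^ _ `^ _]powRrM (_ : - wexp al m = - al * m%:R - al); last first.
  by rewrite /wexp -natr1; ring.
by rewrite powRD ?(gt_eqF s0) ?implybT//; ring.
Qed.

Lemma is_cvg_wbound t s : 0 <= t -> 0 < s -> cvgn (series (wbound_term t s)).
Proof.
move=> t0 s0; rewrite (funext (fun m => wbound_termE t m s0)).
apply: cvgP; apply: cvg_seriesZr; apply: is_cvg_bbound => //.
by rewrite mulr_ge0 ?powR_ge0.
Qed.

Definition wstep_term t n s m : R := (- t) ^+ m / m`!%:R *
  (n.+1%:R `^ wexp al m * bcoef (1 - wexp al m) (Num.truncn (s * n.+1%:R))).

Lemma wstep_termE t n s m : wstep_term t n s m =
  n.+1%:R `^ al * wterm al (t * n.+1%:R `^ al) (Num.truncn (s * n.+1%:R)) m.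
Proof.
rewrite /wstep_term /wterm -[- (t * _)]mulNr exprMn -[(n.+1%:R `^ al) ^+ m]powR_mulrn ?powR_ge0//.
rewrite -[_ `^ _ `^ _]powRrM (_ : wexp al m = al * m%:R + al); last first.
  by rewrite /wexp -natr1; ring.
by rewrite [X in _ * (X * _) = _]powRD ?pnatr_eq0 ?implybT//; ring.
Qed.

Lemma wstepE t n s : 0 <= t -> wstep t n s = limn (series (wstep_term t n s)).
Proof.
move=> t0; apply/esym/cvg_lim => //.
have -> : wstep_term t n s = (fun m => wterm al (t * n.+1%:R `^ al)
    (Num.truncn (s * n.+1%:R)) m * n.+1%:R `^ al).
  by apply/funext => m; rewrite wstep_termE mulrC.
rewrite /wstep [n.+1%:R `^ al * _]mulrC.
by apply: cvg_seriesZr; apply: is_cvg_wterm => //; rewrite mulr_ge0 ?powR_ge0.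
Qed.

(** With k the integer part of s (n + 1), we have n + 1 <= (k + 1) / s, so
    (n + 1)^p can be traded for s^(-p) (k + 1)^p and the uniform coefficient
    bound applies. *)
Lemma wstep_term_bound t n s m : 0 <= t -> 0 < s ->
  `|wstep_term t n s m| <= wbound_term t s m.
Proof.
move=> t0 s0; rewrite /wstep_term /wbound_term normrM [`|_ * bcoef _ _|]normrM.
rewrite [`|(- t) ^+ m / _|]normrM normfV normrX normrN.
rewrite (ger0_norm t0) normr_nat ler_wpM2l ?divr_ge0 ?exprn_ge0//.
rewrite (ger0_norm (powR_ge0 _ _)); set k := Num.truncn _.
have p0 := wexp_gt0 al01 m.
have kM : n.+1%:R <= k.+1%:R / s by rewrite ler_pdivlMr// mulrC ltW// truncnS_gt.
have h : n.+1%:R `^ wexp al m <= s `^ (- wexp al m) * k.+1%:R `^ wexp al m.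
  have -> : s `^ (- wexp al m) * k.+1%:R `^ wexp al m = (k.+1%:R / s) `^ wexp al m.
    rewrite powRM ?invr_ge0 ?(ltW s0)// mulrC; congr (_ * _).
    by rewrite -(powR_inv1 (ltW s0)) -powRrM mulN1r.
  by apply: (ge0_ler_powR (ltW p0)) kM; rewrite nnegrE// divr_ge0// ltW.
apply: le_trans (ler_wpM2r (normr_ge0 _) h) _.
rewrite -mulrA ler_wpM2l ?powR_ge0// mulrC.
exact: bcoef_bound.
Qed.

Lemma wstep_ge0 t n s : 0 <= t -> 0 <= wstep t n s.
Proof.
by move=> t0; rewrite mulr_ge0 ?powR_ge0// wcoef_ge0// mulr_ge0 ?powR_ge0.
Qed.

(** The majorant decreases in s, which bounds all approximations on [d, +oo[
    by a constant. *)
Lemma wstep_le t n d s : 0 <= t -> 0 < d <= s -> wstep t n s <= wbound t d.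
Proof.
move=> t0 /andP[d0 ds]; have s0 := lt_le_trans d0 ds.
rewrite wstepE//; apply: le_trans (ler_norm _) _.
apply: norm_limn_series; last exact: is_cvg_wbound.
move=> m; apply: le_trans (wstep_term_bound _ _ _ _) _ => //.
rewrite /wbound_term ler_wpM2l ?divr_ge0 ?exprn_ge0//.
rewrite ler_wpM2r ?bbound_ge0// !powRN lef_pV2 ?posrE ?powR_gt0//.
by apply: (ge0_ler_powR (ltW (wexp_gt0 al01 m))) ds; rewrite nnegrE ltW.
Qed.

Lemma truncn_cvg_ratio s : 0 < s ->
  (Num.truncn (s * n.+1%:R))%:R / n.+1%:R @[n --> \oo] --> s.
Proof.
move=> s0.
apply: (@squeeze_cvgr _ _ _ _ (fun n => s - n.+1%:R^-1) (fun=> s)).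
- apply: nearW => n; have n0 : 0 < n.+1%:R :> R by [].
  have /andP[h1 h2] := truncn_itv (mulr_ge0 (ltW s0) (ltW n0)).
  rewrite ler_pdivrMr// h1 andbT ler_pdivlMr// mulrBl mulVf ?gt_eqF//.
  by rewrite lerBlDr ltW// natr1.
- rewrite -[X in _ --> X]subr0; apply: cvgB; first exact: cvg_cst.
  exact: cvg_harmonic.
- exact: cvg_cst.
Qed.

Lemma truncn_cvgy s : 0 < s -> Num.truncn (s * n.+1%:R) @[n --> \oo] --> \oo.
Proof.
move=> s0; apply/cvgnyPge => A.
near=> n.
rewrite truncn_ge_nat; last by rewrite mulr_ge0// ltW.
rewrite -ler_pdivrMl// -natr1; apply: ler_wpDr => //.
by near: n; exact: nbhs_infty_ger.
Unshelve. all: by end_near. Qed.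

(** Gauss's limit along the integer parts k of s (n + 1), with k / (n + 1)
    tending to s. *)
Lemma wstep_term_cvg t s m : 0 < s ->
  wstep_term t n s m @[n --> \oo] --> wfun_term t s m.
Proof.
move=> s0; have p0 := wexp_gt0 al01 m; apply: cvgM; first exact: cvg_cst.
have h1 : bcoef (1 - wexp al m) (Num.truncn (s * n.+1%:R)) *
    (Num.truncn (s * n.+1%:R))%:R `^ wexp al m @[n --> \oo] --> (Gamma (1 - wexp al m))^-1.
  have := @gauss_limit R (1 - wexp al m); rewrite lerBlDr lerDl => /(_ (ltW p0)).
  rewrite opprB subrKC => h.
  exact: (cvg_comp _ _ (truncn_cvgy s0) h).
have h2 : ((Num.truncn (s * n.+1%:R))%:R / n.+1%:R) `^ (- wexp al m) @[n --> \oo] -->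
    s `^ (- wexp al m).
  have c : {for s, continuous (fun x : R => x `^ (- wexp al m))}.
    apply/differentiable_continuous/derivable1_diffP.
    by apply: derivable_powR; rewrite in_itv/= andbT.
  exact: (continuous_cvg _ c (truncn_cvg_ratio s0)).
apply: cvg_trans (cvgM h2 h1); apply: near_eq_cvg; near=> n.
set k := Num.truncn _.
have k0 : 0 < k%:R :> R.
  rewrite ltr0n /k {k}; near: n; have := truncn_cvgy s0.
  by move/cvgnyPgt => /(_ 0%N).
have n0 : 0 < n.+1%:R :> R by [].
rewrite -[LHS]/((k%:R / n.+1%:R) `^ (- wexp al m) *
  (bcoef (1 - wexp al m) k * k%:R `^ wexp al m)).
rewrite [LHS]mulrCA [RHS]mulrC; congr (_ * _).
rewrite powRM ?invr_ge0 ?ler0n// -(powR_inv1 (ltW n0)) -powRrM mulN1r opprK.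
by rewrite mulrAC -powRD ?(gt_eqF k0) ?implybT// addNr powRr0 mul1r.
Unshelve. all: by end_near. Qed.

Lemma wstep_cvg t s : 0 <= t -> 0 < s -> wstep t n s @[n --> \oo] --> wfun t s.
Proof.
move=> t0 s0; rewrite (funext (fun n => wstepE n s t0)).
apply: (tannery (g := wbound_term t s)).
- by move=> n m; exact: wstep_term_bound.
- exact: is_cvg_wbound.
- by move=> m; exact: wstep_term_cvg.
Qed.

Lemma is_cvg_wfun t s : 0 <= t -> 0 < s -> cvgn (series (wfun_term t s)).
Proof.
move=> t0 s0; apply: dominated_cvg_series (is_cvg_wbound t0 s0) => m.
have h : `|wstep_term t n s m| @[n --> \oo] --> `|wfun_term t s m|.
  by apply: cvg_norm; exact: wstep_term_cvg.
rewrite -(cvg_lim _ h)//; apply: limr_le; first by apply: cvgP h.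
by apply: nearW => n; exact: wstep_term_bound.
Qed.

(** Nonnegativity of the Wright function is inherited from its approximations;
    monotone convergence can then be used to sum its moments under the
    integral. *)
Lemma wfun_ge0 t s : 0 <= t -> 0 < s -> 0 <= wfun t s.
Proof.
move=> t0 s0; have h := wstep_cvg t0 s0.
rewrite -(cvg_lim _ h)//; apply: limr_ge; first by apply: cvgP h.
by apply: nearW => n; exact: wstep_ge0.
Qed.

Lemma measurable_wstep t n :
  measurable_fun (`]0, +oo[%classic : set R) (wstep t n).
Proof.
apply: measurable_funM => //.
apply: measurable_funS (measurable_step (wcoef al (t * n.+1%:R `^ al)) (ltr0Sn R n)) => //.
exact: sub_ray.
Qed.

Lemma measurable_wfun t : 0 <= t ->
  measurable_fun (`]0, +oo[%classic : set R) (wfun t).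
Proof.
move=> t0; apply: (measurable_fun_cvg (h := wstep t)).
  by move=> n; exact: measurable_wstep.
by move=> s /=; rewrite in_itv/= andbT => s0; exact: wstep_cvg.
Qed.

End wfun.

(** * Laplace transform of the Wright function *)

Section laplace.
Context {R : realType} (al : R) (al01 : 0 < al < 1).
Notation mu := (@lebesgue_measure R).
Implicit Types (t s lam M : R).

Let al0 : 0 < al. Proof. by case/andP: al01. Qed.
Let al1 : al < 1. Proof. by case/andP: al01. Qed.

(** The Laplace transform in s of the Wright function. *)
Definition wlap t lam : R := lam `^ (al - 1) * expR (- (t * lam `^ al)).

Lemma eseries_EFin (u : nat -> R) l : series u n @[n --> \oo] --> l ->
  (\sum_(k <oo) (u k)%:E = l%:E)%E.
Proof.
move=> h; apply/cvg_lim => //.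
rewrite (_ : (fun n => _) = EFin \o series u).
  by apply/fine_cvgP; split; [exact: nearW|].
by apply/funext => n; rewrite /= sumEFin.
Qed.

(** The Laplace integrand of an approximation, with e^(- lam s) also frozen on
    each cell, so that its integral is exactly a power series in z = e^(-
    lam / (n+1)). *)
Definition damped t lam n s : R :=
  wstep al t n s * expR (- (lam / n.+1%:R)) ^+ Num.truncn (s * n.+1%:R).

(** The frequency at which the integral of the frozen integrand equals the
    limiting transform: (n + 1) (1 - z) with z = e^(- lam / (n + 1)). *)
Definition dlam lam n : R := n.+1%:R * (1 - expR (- (lam / n.+1%:R))).

Lemma damped_ge0 t lam n s : 0 <= t -> 0 <= damped t lam n s.
Proof. by move=> t0; apply: mulr_ge0; [exact: wstep_ge0|exact/exprn_ge0/expR_ge0]. Qed.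

Lemma measurable_damped t lam n :
  measurable_fun (`]0, +oo[%classic : set R) (damped t lam n).
Proof.
apply: measurable_funM; first exact: measurable_wstep.
apply: measurable_funS (measurable_step (fun k => expR (- (lam / n.+1%:R)) ^+ k)
  (ltr0Sn R n)) => //.
exact: sub_ray.
Qed.

(** The integral is the generating function of wcoef at z = e^(- lam/(n+1)),
    by the formula for step functions. *)
Lemma integral_damped t lam n : 0 <= t -> 0 < lam ->
  (\int[mu]_(s in `]0%R, +oo[) (damped t lam n s)%:E = (wlap t (dlam lam n))%:E)%E.
Proof.
move=> t0 lam0; set M : R := n.+1%:R; have M0 : 0 < M by rewrite /M.
set z := expR (- (lam / M)).
have z01 : 0 <= z < 1.
  by rewrite expR_ge0 expR_lt1 oppr_lt0 divr_gt0.
have z1 : 0 <= 1 - z by rewrite subr_ge0 ltW//; case/andP: z01.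
pose a k := M `^ al * wcoef al (t * M `^ al) k * z ^+ k.
have tM : 0 <= t * M `^ al by rewrite mulr_ge0 ?powR_ge0.
have a0 k : 0 <= a k.
  by apply: mulr_ge0; [rewrite mulr_ge0 ?powR_ge0// wcoef_ge0|exact/exprn_ge0/expR_ge0].
rewrite (integral_step M0 a0); apply: eseries_EFin.
have h := wcoef_gf al01 tM z01.
have -> : series (fun k => a k / M) = (fun n => M `^ (al - 1) *
    series (fun k => wcoef al (t * M `^ al) k * z ^+ k) n).
  apply/funext => N; rewrite /series /= mulr_sumr; apply: eq_bigr => k _.
  rewrite /a powRB ?(gt_eqF M0) ?implybT// powRr1 ?(ltW M0)//; ring.
rewrite /wlap /dlam -/M -/z !powRM ?(ltW M0)// mulrA -[_ `^ _ * _ * expR _]mulrA.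
by apply: cvgM; first exact: cvg_cst.
Qed.

Lemma dlam_cvg lam : 0 < lam -> dlam lam n @[n --> \oo] --> lam.
Proof.
move=> lam0.
apply: (@squeeze_cvgr _ _ _ _ (fun n => lam * (1 + lam * n.+1%:R^-1)^-1) (fun=> lam)).
- apply: nearW => n; rewrite /dlam; set M : R := n.+1%:R.
  have M0 : 0 < M by rewrite /M.
  have x0 : 0 < lam / M by rewrite divr_gt0.
  have h1 : 1 - lam / M <= expR (- (lam / M)) := expR_ge1Dx _.
  have h2 : expR (- (lam / M)) <= (1 + lam / M)^-1.
    by rewrite expRN lef_pV2 ?posrE ?expR_gt0 ?addr_gt0// expR_ge1Dx.
  have e : lam = M * (lam / M) by rewrite mulrCA mulfV ?gt_eqF// mulr1.
  apply/andP; split.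
    rewrite {1}e -mulrA ler_pM2l//.
    move: h2 x0; move: (lam / M) (expR _) => x y h2 x0.
    have x1 : 0 < 1 + x by rewrite addr_gt0.
    rewrite (_ : x * (1 + x)^-1 = 1 - (1 + x)^-1); last by field; rewrite gt_eqF.
    lra.
  by rewrite [X in _ <= X]e ler_pM2l// lerBlDr -lerBlDl.
- have : lam * (1 + lam * n.+1%:R^-1)^-1 @[n --> \oo] --> lam * (1 + lam * 0)^-1.
    apply: cvgM; first exact: cvg_cst.
    apply: cvgV; first by rewrite mulr0 addr0.
    apply: cvgD; first exact: cvg_cst.
    by apply: cvgM; [exact: cvg_cst|exact: cvg_harmonic].
  by rewrite mulr0 addr0 invr1 mulr1.
- exact: cvg_cst.
Qed.

Lemma wlap_dlam_cvg t lam : 0 < lam -> wlap t (dlam lam n) @[n --> \oo] --> wlap t lam.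
Proof.
move=> lam0.
have c p : (dlam lam n) `^ p @[n --> \oo] --> lam `^ p.
  have c : {for lam, continuous (fun x : R => x `^ p)}.
    apply/differentiable_continuous/derivable1_diffP.
    by apply: derivable_powR; rewrite in_itv/= andbT.
  exact: (continuous_cvg _ c (dlam_cvg lam0)).
apply: cvgM; first exact: c.
apply: continuous_cvg; first exact: continuous_expR.
by apply: cvgN; apply: cvgM; [exact: cvg_cst|exact: c].
Qed.

Lemma damped_le t lam n d s : 0 <= t -> 0 < lam -> 0 < d <= s ->
  damped t lam n s <= wbound al t d * expR lam * expR (- (lam * s)).
Proof.
move=> t0 lam0 ds; have /andP[d0 ds'] := ds; have s0 := lt_le_trans d0 ds'.
rewrite /damped -mulrA; apply: ler_pM; [exact: wstep_ge0|exact/exprn_ge0/expR_ge0|exact: wstep_le|].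
rewrite -expRM_natr -expRD ler_expR; set k := Num.truncn _.
have M0 : 0 < n.+1%:R :> R by [].
have h : s * n.+1%:R < k.+1%:R by rewrite truncnS_gt.
have M1 : 1 <= n.+1%:R :> R by rewrite ler1n.
have h1 : lam * s <= lam + lam / n.+1%:R * k%:R.
  rewrite -(ler_pM2r M0) mulrDl -[X in _ <= _ + X]mulrA [k%:R * _]mulrC mulrA.
  rewrite mulfVK ?gt_eqF// -mulrA.
  rewrite -mulrDr ler_pM2l//; rewrite -natr1 in h; lra.
by rewrite mulNr lerNl opprB lerBlDl.
Qed.

Lemma damped_cvg t lam s : 0 <= t -> 0 < s ->
  damped t lam n s @[n --> \oo] --> wfun al t s * expR (- (lam * s)).
Proof.
move=> t0 s0; apply: cvgM; first exact: wstep_cvg.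
under eq_fun do rewrite -expRM_natr.
apply: continuous_cvg; first exact: continuous_expR.
under eq_fun do rewrite mulNr -mulrA [_^-1 * _]mulrC.
apply: cvgN; apply: cvgM; [exact: cvg_cst|exact: truncn_cvg_ratio].
Qed.

(** Near 0 there is no uniform bound on the approximations. There, however,
    the damping of rate lam is at most 1 and the one of rate m + 1 is at least
    1/e, so the rate may be raised to m + 1 at the cost of a factor e; the
    transform at m + 1 is small. *)
Lemma damped_near0 t lam m n s : 0 <= t -> 0 < lam -> 0 < s <= m.+1%:R^-1 ->
  damped t lam n s <= expR 1 * damped t m.+1%:R n s.
Proof.
move=> t0 lam0 /andP[s0 sm]; rewrite /damped mulrCA ler_wpM2l ?wstep_ge0//.
have M0 : 0 < n.+1%:R :> R by [].
rewrite -!expRM_natr; apply: (@le_trans _ _ 1).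
  by rewrite -expR0 ler_expR mulNr oppr_le0 mulr_ge0// divr_ge0// ltW.
rewrite -expRD -[leLHS]expR0 ler_expR mulNr subr_ge0 -mulrA.
rewrite -ler_pdivlMl// mulr1 mulrC ler_pdivrMr//.
apply: le_trans (_ : s * n.+1%:R <= _); first by rewrite truncn_le mulr_ge0// ltW.
by rewrite ler_pM2r.
Qed.

End laplace.

Section laplace2.
Context {R : realType} (al : R) (al01 : 0 < al < 1).
Notation mu := (@lebesgue_measure R).
Implicit Types (t s lam M : R).

Let al0 : 0 < al. Proof. by case/andP: al01. Qed.
Let al1 : al < 1. Proof. by case/andP: al01. Qed.

Lemma measurable_expRN (c : R) (D : set R) :
  measurable_fun D (fun s : R => expR (- (c * s))).
Proof.
apply: measurable_funTS; apply: (measurableT_comp (@measurable_expR R)).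
by apply: measurable_funN; apply: measurable_funM.
Qed.

Lemma integrable_expRN (c : R) : 0 < c ->
  mu.-integrable (`]0%R, +oo[%classic : set R) (EFin \o (fun s => expR (- (c * s)))).
Proof.
move=> c0; apply/integrableP; split.
  by apply/measurable_EFinP; exact: measurable_expRN.
rewrite (_ : \int[_]_(_ in _) _ = (c^-1)%:E)%E ?ltry//.
rewrite -integral_expRN//; apply: eq_integral => s _ /=.
by rewrite ger0_norm ?expR_ge0.
Qed.

Definition ray_from (m : nat) : set R := `]m.+1%:R^-1, +oo[.

Lemma ray_fromP m s : ray_from m s <-> m.+1%:R^-1 < s.
Proof. by rewrite /ray_from/= in_itv/= andbT. Qed.

Lemma ray_from_sub m : ray_from m `<=` (`]0, +oo[%classic : set R).
Proof.
by move=> s /ray_fromP h; rewrite /= in_itv/= andbT (lt_trans _ h).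
Qed.

Lemma measurable_ray_from m : measurable (ray_from m : set (measurableTypeR R)).
Proof. exact: measurable_itv. Qed.

Lemma bigcup_ray_from : \bigcup_m ray_from m = `]0, +oo[%classic.
Proof.
apply/seteqP; split => s; first by move=> [m _]; exact: ray_from_sub.
rewrite /= in_itv/= andbT => s0; exists (Num.truncn s^-1) => //.
by apply/ray_fromP; rewrite invf_plt ?posrE// truncnS_gt.
Qed.

Lemma nondecreasing_ray_from : nondecreasing_seq ray_from.
Proof.
apply/nondecreasing_seqP => m; rewrite subsetEset => s /ray_fromP h.
by apply/ray_fromP; apply: le_lt_trans h; rewrite lef_pV2 ?posrE// ler_nat.
Qed.

Definition wdamped t lam s : R := wfun al t s * expR (- (lam * s)).

Lemma wdamped_ge0 t lam s : 0 <= t -> 0 < s -> 0 <= wdamped t lam s.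
Proof. by move=> t0 s0; apply: mulr_ge0; [exact: wfun_ge0|exact: expR_ge0]. Qed.

Lemma measurable_wdamped t lam : 0 <= t ->
  measurable_fun (`]0, +oo[%classic : set R) (wdamped t lam).
Proof.
move=> t0; apply: measurable_funM; first exact: measurable_wfun.
exact: measurable_expRN.
Qed.

Lemma integral_damped_cvg t lam m : 0 <= t -> 0 < lam ->
  (\int[mu]_(s in ray_from m) (damped al t lam n s)%:E @[n --> \oo] -->
   \int[mu]_(s in ray_from m) (wdamped t lam s)%:E)%E.
Proof.
move=> t0 lam0; pose d : R := m.+1%:R^-1.
have ig : mu.-integrable (ray_from m)
   (EFin \o (fun s => wbound al t d * expR lam * expR (- (lam * s)))).
  have h := integrableS measurable_ray (measurable_ray_from m)
    (@ray_from_sub m) (integrable_expRN lam0).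
  have := integrableZl (measurable_ray_from m) (wbound al t d * expR lam) h.
  by apply: (eq_integrable (measurable_ray_from m)) => s _; rewrite /= EFinM.
have [] := @dominated_convergence _ (measurableTypeR R) R mu (ray_from m)
  (measurable_ray_from m) (fun n => EFin \o damped al t lam n) (EFin \o wdamped t lam)
  _ _ _ _ ig.
- move=> n; apply/measurable_EFinP.
  apply: measurable_funS (measurable_damped al t lam n) => //.
  exact: ray_from_sub.
- apply/measurable_EFinP; apply: measurable_funS (measurable_wdamped lam t0) => //.
  exact: ray_from_sub.
- apply: aeW => s /ray_from_sub; rewrite /= in_itv/= andbT => s0.
  by apply/fine_cvgP; split; [exact: nearW|exact: damped_cvg].
- apply: aeW => s n /ray_fromP ds; rewrite /= lee_fin ger0_norm.
    by apply: damped_le => //; rewrite /d (ltW ds) andbT.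
  exact: damped_ge0.
- by [].
Qed.

(** Away from 0 the integral is squeezed by the full transform, up to the mass
    near 0, which is at most e times the transform at m + 1. *)
Lemma integral_damped_split t lam m n : 0 <= t -> 0 < lam ->
  (\int[mu]_(s in ray_from m) (damped al t lam n s)%:E <= (wlap al t (dlam lam n))%:E /\
  (wlap al t (dlam lam n))%:E <= \int[mu]_(s in ray_from m) (damped al t lam n s)%:E
   + (expR 1 * wlap al t (dlam m.+1%:R n))%:E)%E.
Proof.
move=> t0 lam0; rewrite -(integral_damped al01 n t0 lam0).
have md l : measurable_fun (`]0, +oo[%classic : set R) (EFin \o damped al t l n).
  by apply/measurable_EFinP; exact: measurable_damped.
have dge0 l s : (0 <= (damped al t l n s)%:E)%E by rewrite lee_fin damped_ge0.
split.
  apply: (@ge0_subset_integral _ (measurableTypeR R) R mu).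
  - exact: measurable_ray_from.
  - exact: measurable_ray.
  - exact: md.
  - by [].
  - exact: ray_from_sub.
have msm : measurable (`]0, m.+1%:R^-1] : set (measurableTypeR R)).
  exact: measurable_itv.
have ssm : (`]0, m.+1%:R^-1] : set R) `<=` `]0, +oo[%classic.
  by move=> s /=; rewrite !in_itv/= andbT => /andP[].
have e : (`]0, +oo[%classic : set R) = ray_from m `|` `]0, m.+1%:R^-1].
  apply/seteqP; split => s; last by move=> [/ray_from_sub|/ssm].
  rewrite /= in_itv/= andbT => s0; have [h|h] := ltP m.+1%:R^-1 s.
    by left; apply/ray_fromP.
  by right; rewrite /= in_itv/= s0.
rewrite {1}e ge0_integral_setU//; last 3 first.
- exact: measurable_ray_from.
- by rewrite -e; exact: md.
- apply/disj_setPS => s [/ray_fromP h]; rewrite /= in_itv/= => /andP[_].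
  by rewrite leNgt h.
apply: leeD => //.
have mdc : measurable_fun (`]0%R, +oo[%classic : set (measurableTypeR R))
    (fun s => (expR 1)%:E * (damped al t m.+1%:R n s)%:E)%E.
  by apply: (@emeasurable_funM _ (measurableTypeR R)) => //; exact: md.
rewrite EFinM -(integral_damped al01 n t0 (ltr0Sn R m)).
rewrite -(@ge0_integralZl _ (measurableTypeR R) R mu _ measurable_ray _ (md m.+1%:R)) ?lee_fin ?expR_ge0//; last first.
  by move=> s _; exact: dge0.
apply: (@le_trans _ _ (\int[mu]_(s in `]0%R, m.+1%:R^-1%R])
   ((expR 1)%:E * (damped al t m.+1%:R n s)%:E))%E).
  apply: ge0_le_integral => //.
  - exact: measurable_funS measurable_ray ssm (md lam).
  - exact: measurable_funS measurable_ray ssm mdc.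
  - move=> s; rewrite /= in_itv/= => sm; rewrite -EFinM lee_fin.
    exact: damped_near0.
apply: (@ge0_subset_integral _ (measurableTypeR R) R mu).
- exact: msm.
- exact: measurable_ray.
- exact: mdc.
- by move=> s _; rewrite mule_ge0// lee_fin ?expR_ge0// damped_ge0.
- exact: ssm.
Qed.

Lemma wlap_cvg0 t : 0 <= t -> wlap al t m.+1%:R @[m --> \oo] --> 0.
Proof.
move=> t0.
have h : (m.+1%:R^-1 : R) `^ (1 - al) @[m --> \oo] --> 0.
  have : 0 < 1 - al by rewrite subr_gt0.
  move=> /(@powR_cvg0 R) /cvg_at_rightP; apply; split => //.
  exact: cvg_harmonic.
apply: (@squeeze_cvgr _ _ _ _ (fun=> 0) (fun m => m.+1%:R^-1 `^ (1 - al))) => //.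
- apply: nearW => m; rewrite /wlap mulr_ge0 ?powR_ge0 ?expR_ge0//=.
  have m0 : 0 < m.+1%:R :> R by [].
  have -> : m.+1%:R^-1 `^ (1 - al) = m.+1%:R `^ (al - 1).
    by rewrite -(powR_inv1 (ltW m0)) -powRrM mulN1r opprB.
  rewrite ler_piMr ?powR_ge0//.
  by rewrite -expR0 ler_expR oppr_le0 mulr_ge0 ?powR_ge0.
- exact: cvg_cst.
Qed.

(** Dominated convergence on [1/(m+1), +oo[ and the squeeze for the mass near
    0 give the transform up to an error that vanishes as m tends to infinity;
    monotone convergence then fills up the half-line. *)
Theorem laplace_wfun t lam : 0 <= t -> 0 < lam ->
  (\int[mu]_(s in `]0%R, +oo[) (wdamped t lam s)%:E = (wlap al t lam)%:E)%E.
Proof.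
move=> t0 lam0.
have Ef l : 0 < l -> ((wlap al t (dlam l n))%:E @[n --> \oo] --> (wlap al t l)%:E)%E.
  by move=> l0; apply/fine_cvgP; split; [exact: nearW|exact: wlap_dlam_cvg].
have up m : (\int[mu]_(s in ray_from m) (wdamped t lam s)%:E <= (wlap al t lam)%:E)%E.
  have h1 := @integral_damped_cvg t lam m t0 lam0; have h2 := Ef _ lam0.
  rewrite -(cvg_lim _ h1)// -(cvg_lim _ h2)//; apply: lee_lim.
  - by apply: cvgP h1.
  - by apply: cvgP h2.
  - by apply: nearW => n; have [] := @integral_damped_split t lam m n t0 lam0.
have lo m : ((wlap al t lam)%:E <= \int[mu]_(s in ray_from m) (wdamped t lam s)%:E +
    (expR 1 * wlap al t m.+1%:R)%:E)%E.
  have h1 : (\int[mu]_(s in ray_from m) (damped al t lam n s)%:E +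
      (expR 1 * wlap al t (dlam m.+1%:R n))%:E @[n --> \oo] -->
      \int[mu]_(s in ray_from m) (wdamped t lam s)%:E + (expR 1 * wlap al t m.+1%:R)%:E)%E.
    apply: cvgeD; [by rewrite fin_num_adde_defl|exact: integral_damped_cvg|].
    apply/fine_cvgP; split; first exact: nearW.
    by apply: cvgM; [exact: cvg_cst|exact: wlap_dlam_cvg].
  have h2 := Ef _ lam0.
  rewrite -(cvg_lim _ h1)// -(cvg_lim _ h2)//; apply: lee_lim.
  - by apply: cvgP h2.
  - by apply: cvgP h1.
  - by apply: nearW => n; have [] := @integral_damped_split t lam m n t0 lam0.
have lim : (\int[mu]_(s in ray_from m) (wdamped t lam s)%:E @[m --> \oo] -->
    \int[mu]_(s in `]0%R, +oo[) (wdamped t lam s)%:E)%E.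
  rewrite -bigcup_ray_from.
  apply: (@ge0_nondecreasing_set_cvg_integral _ (measurableTypeR R) R ray_from
    (EFin \o wdamped t lam) mu).
  - exact: nondecreasing_ray_from.
  - exact: measurable_ray_from.
  - move=> m; apply/measurable_EFinP; apply: measurable_funS (measurable_wdamped lam t0) => //.
    exact: ray_from_sub.
  - move=> m s /ray_from_sub; rewrite /= in_itv/= andbT => s0.
    by rewrite lee_fin wdamped_ge0.
apply/eqP; rewrite eq_le; apply/andP; split.
  rewrite -(cvg_lim _ lim)//; apply: lime_le; first by apply: cvgP lim.
  exact: nearW.
have lim2 : (\int[mu]_(s in ray_from m) (wdamped t lam s)%:E +
      (expR 1 * wlap al t m.+1%:R)%:E @[m --> \oo] -->
      \int[mu]_(s in `]0%R, +oo[) (wdamped t lam s)%:E + (expR 1 * 0)%:E)%E.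
  apply: cvgeD => //; first by rewrite fin_num_adde_defl.
  apply/fine_cvgP; split; first exact: nearW.
  by apply: cvgM; [exact: cvg_cst|exact: wlap_cvg0].
rewrite mulr0 adde0 in lim2.
rewrite -(cvg_lim _ lim2)//; apply: lime_ge; first by apply: cvgP lim2.
exact: nearW.
Qed.

End laplace2.

(** * Exponential moments of the Wright function *)

Section power_series_uniqueness.
Context {R : realType}.
Implicit Types (e : nat -> R) (z : R).

(** The value at 0 is the limit of the values at small positive z, by
    dominated series; only positive z are used since the identities below are
    known only there. *)
Lemma pseries0_head e : (forall z, 0 < z < 1 -> pseries e z n @[n --> \oo] --> (0 : R)) ->
  e 0%N = 0.
Proof.
move=> h; pose z0 : R := 2^-1.
have z01 : 0 < z0 < 1 by rewrite /z0 invr_gt0 invf_lt1 ?ltr1n ?ltr0n.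
(* The points w n are at most 1/4, inside the disc of radius 1/2 where the
   series converges absolutely. *)
pose w n : R := n.+4%:R^-1.
have w0 n : 0 < w n by rewrite /w invr_gt0.
have wz n : w n <= 4^-1 by rewrite /w lef_pV2 ?posrE// ler_nat.
have cg : cvgn (series (fun m => `|e m| * 4^-1 ^+ m)).
  have c0 : cvgn (pseries e z0) by apply: cvgP (h _ z01).
  have := is_cvg_pseries_inside_norm c0; apply.
  by rewrite !gtr0_norm ?invr_gt0// /z0 ltf_pV2 ?posrE// ltr_nat.
have e1 : limn (series (fun m => if m == 0%N then e 0%N else 0)) = e 0%N.
  apply/cvg_lim => //; rewrite -cvg_shiftS.
  rewrite (_ : (fun n => _) = fun=> e 0%N); first exact: cvg_cst.
  by apply/funext => n; rewrite /series /= big_nat_recl//= big1_seq ?addr0.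
have e2 n : limn (series (fun m => e m * w n ^+ m)) = 0.
  apply/cvg_lim => //; apply: h.
  by rewrite w0 (le_lt_trans (wz n))// invf_lt1 ?ltr1n.
have : limn (series (fun m => e m * w n ^+ m)) @[n --> \oo] -->
    limn (series (fun m => if m == 0%N then e 0%N else 0)).
  apply: tannery cg _.
    move=> n m; rewrite normrM normrX (gtr0_norm (w0 n)) ler_wpM2l//.
    by rewrite lerXn2r// nnegrE ?invr_ge0// ltW.
  move=> [|m] /=; first by under eq_fun do rewrite expr0 mulr1; exact: cvg_cst.
  have hw : w n @[n --> \oo] --> 0.
    by have := @cvg_harmonic R; rewrite -(cvg_shiftn 3); under eq_fun do rewrite addn3.
  have : e m.+1 * w n ^+ m.+1 @[n --> \oo] --> e m.+1 * 0 ^+ m.+1.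
    apply: cvgM; first exact: cvg_cst.
    exact: (continuous_cvg _ (@exprn_continuous R m.+1 0) hw).
  by rewrite expr0n /= mulr0.
rewrite e1 (funext e2) => H.
by rewrite -(cvg_lim _ H)// lim_cst.
Qed.

Lemma pseries0 e : (forall z, 0 < z < 1 -> pseries e z n @[n --> \oo] --> (0 : R)) ->
  forall k, e k = 0.
Proof.
move=> h k; elim: k e h => [|k IH] e h; first exact: pseries0_head.
apply: (IH (fun j => e j.+1)) => z z01.
have e0 := pseries0_head h; have /andP[z0 _] := z01.
have := h z z01; rewrite -cvg_shiftS.
have -> : (fun n => pseries e z n.+1) = (fun n => z * pseries (fun j => e j.+1) z n).
  apply/funext => n; rewrite /pseries /series /= big_nat_recl// e0 mul0r add0r.
  by rewrite mulr_sumr; apply: eq_bigr => i _; rewrite exprS mulrCA.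
move=> H.
have : z^-1 * (z * pseries (fun j => e j.+1) z n) @[n --> \oo] --> z^-1 * 0.
  by apply: cvgM => //; exact: cvg_cst.
rewrite mulr0; under eq_fun do rewrite mulKf ?gt_eqF//.
by [].
Qed.

Lemma pseries_inj e1 e2 (f : R -> R) :
  (forall z, 0 < z < 1 -> pseries e1 z n @[n --> \oo] --> f z) ->
  (forall z, 0 < z < 1 -> pseries e2 z n @[n --> \oo] --> f z) ->
  forall k, e1 k = e2 k.
Proof.
move=> h1 h2 k; apply/eqP; rewrite -subr_eq0; apply/eqP.
apply: (@pseries0 (fun k => e1 k - e2 k)) => z z01.
have -> : pseries (fun k => e1 k - e2 k) z = (fun n => pseries e1 z n - pseries e2 z n).
  apply/funext => n; rewrite /pseries /series /= -sumrB.
  by apply: eq_bigr => i _; rewrite mulrBl.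
by rewrite -(subrr (f z)); apply: cvgB; [exact: h1|exact: h2].
Qed.

Lemma eseries_EFin_cvg (u : nat -> R) l :
  (\sum_(k <oo) (u k)%:E = l%:E)%E -> (forall k, 0 <= u k) ->
  series u n @[n --> \oo] --> l.
Proof.
move=> h u0.
have c : cvgn (fun n => (\sum_(0 <= k < n) (u k)%:E)%E).
  by apply: is_cvg_nneseries => k _ _; rewrite lee_fin.
have : (fun n => (\sum_(0 <= k < n) (u k)%:E)%E) n @[n --> \oo] --> (l%:E)%E.
  by rewrite -h.
rewrite (_ : (fun n => _) = EFin \o series u); first by move/fine_cvgP => [].
by apply/funext => n; rewrite /= sumEFin.
Qed.

End power_series_uniqueness.

Section moments.
Context {R : realType} (al : R) (al01 : 0 < al < 1).
Notation mu := (@lebesgue_measure R).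
Implicit Types (t s h : R).

Let al0 : 0 < al. Proof. by case/andP: al01. Qed.
Let al1 : al < 1. Proof. by case/andP: al01. Qed.

(** The integrand of the inner integral of the subordination formula. *)
Definition wmoment t h (n : nat) s : R :=
  expR (- (h^-1 * s)) * (s ^+ n / n`!%:R) * wfun al t s.

Lemma wmoment_ge0 t h n s : 0 <= t -> 0 < s -> 0 <= wmoment t h n s.
Proof.
move=> t0 s0; apply: mulr_ge0; last exact: wfun_ge0.
by rewrite mulr_ge0 ?expR_ge0// divr_ge0// exprn_ge0// ltW.
Qed.

Lemma measurable_wmoment t h n : 0 <= t ->
  measurable_fun (`]0, +oo[%classic : set R) (wmoment t h n).
Proof.
move=> t0; apply: measurable_funM; last exact: measurable_wfun.
apply: measurable_funM; first exact: measurable_expRN.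
by apply: measurable_funM => //; exact: measurable_funX.
Qed.

(** Summing z^n s^n / (h^n n!) inside the integral gives e^(z s / h), so the
    generating function of the moments is the Laplace transform at
    (1 - z) / h. *)
Lemma integral_wmoment_gf t h z : 0 <= t -> 0 < h -> 0 < z < 1 ->
  (\sum_(n <oo) ((z / h) ^+ n)%:E * \int[mu]_(s in `]0%R, +oo[) (wmoment t h n s)%:E =
   (wlap al t ((1 - z) / h))%:E)%E.
Proof.
move=> t0 h0 /andP[z0 z1].
have lam0 : 0 < (1 - z) / h by rewrite divr_gt0// subr_gt0.
have zh : 0 <= z / h by rewrite divr_ge0// ltW.
rewrite -(laplace_wfun al01 t0 lam0).
have mw n : measurable_fun (`]0%R, +oo[%classic : set (measurableTypeR R))
    (EFin \o wmoment t h n).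
  by apply/measurable_EFinP; exact: measurable_wmoment.
transitivity (\sum_(n <oo) \int[mu]_(s in `]0%R, +oo[)
    (((z / h) ^+ n)%:E * (wmoment t h n s)%:E))%E.
  apply: eq_eseriesr => n _.
  rewrite (@ge0_integralZl _ (measurableTypeR R) R mu _ measurable_ray _ (mw n))//.
    by move=> s; rewrite /= in_itv/= andbT => s0; rewrite lee_fin wmoment_ge0.
  by rewrite lee_fin exprn_ge0.
rewrite -(@integral_nneseries _ (measurableTypeR R) R mu _ measurable_ray); last 2 first.
- move=> n; apply: (@emeasurable_funM _ (measurableTypeR R)) => //; exact: mw.
- move=> n s; rewrite /= in_itv/= andbT => s0.
  by rewrite -EFinM lee_fin mulr_ge0 ?exprn_ge0// wmoment_ge0.
apply: eq_integral => s /set_mem; rewrite /= in_itv/= andbT => s0.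
under eq_eseriesr do rewrite -EFinM.
apply: eseries_EFin.
have -> : series (fun n => (z / h) ^+ n * wmoment t h n s) =
   (fun N => expR (- (h^-1 * s)) * wfun al t s * series (exp_coeff (z / h * s)) N).
  apply/funext => N; rewrite /series /= mulr_sumr; apply: eq_bigr => n _.
  by rewrite /wmoment /exp_coeff /= !exprMn; ring.
rewrite /wdamped (_ : - ((1 - z) / h * s) = - (h^-1 * s) + z / h * s); last by ring.
rewrite expRD mulrA [wfun al t s * _]mulrC.
by apply: cvgM; [exact: cvg_cst|exact: is_cvg_series_exp_coeff].
Qed.

(** Both sides have the same generating function on ]0, 1[. Finiteness of each
    moment, needed before coefficients are compared, comes from the sum at
    z = 1/2. *)
Theorem integral_wmoment t h n : 0 <= t -> 0 < h ->
  (\int[mu]_(s in `]0%R, +oo[) (wmoment t h n s)%:E =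
   (h ^+ n * h `^ (1 - al) * wcoef al (t * h `^ (- al)) n)%:E)%E.
Proof.
move=> t0 h0; pose A n := (\int[mu]_(s in `]0%R, +oo[) (wmoment t h n s)%:E)%E.
have A0 k : (0 <= A k)%E.
  apply: integral_ge0 => s; rewrite /= in_itv/= andbT => s0.
  by rewrite lee_fin wmoment_ge0.
(* A single term of the convergent generating series at z = 1/2 bounds A
   k. *)
have Afin k : A k \is a fin_num.
  have z01 : 0 < (2^-1 : R) < 1 by rewrite invr_gt0 ltr0n invf_lt1 ?ltr1n.
  have gf := integral_wmoment_gf t0 h0 z01.
  have c0 : 0 < (2^-1 / h) ^+ k by rewrite exprn_gt0// divr_gt0// invr_gt0.
  have : (((2^-1 / h) ^+ k)%:E * A k <= (wlap al t ((1 - 2^-1) / h))%:E)%E.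
    rewrite -gf.
    have pos j : (0 <= ((2^-1 / h) ^+ j)%:E * A j)%E.
      by apply: mule_ge0 => //; rewrite lee_fin exprn_ge0// divr_ge0// ?invr_ge0// ltW.
    apply: (@le_trans _ _ (\sum_(0 <= j < k.+1) (((2^-1 / h) ^+ j)%:E * A j))%E).
      by rewrite big_nat_recr//= leeDr// sume_ge0.
    by apply: nneseries_lim_ge => j _ _; exact: pos.
  have := A0 k; case: (A k) => [r|_|//]; first by [].
  by rewrite gt0_muley ?lte_fin// leye_eq.
pose a k := h ^- k * fine (A k).
have aE k : a k = h `^ (1 - al) * wcoef al (t * h `^ (- al)) k.
  apply: (@pseries_inj R a (fun k => h `^ (1 - al) * wcoef al (t * h `^ (- al)) k)
    (fun z => wlap al t ((1 - z) / h))).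
    move=> z z01; have /andP[z0 z1] := z01; apply: eseries_EFin_cvg.
      rewrite -(integral_wmoment_gf t0 h0 z01); apply: eq_eseriesr => j _.
      rewrite -/(A j) -(fineK (Afin j)) -EFinM; congr EFin.
      by rewrite /a expr_div_n /=; ring.
    move=> j /=; apply: mulr_ge0; last by rewrite exprn_ge0// ltW.
    by apply: mulr_ge0; [rewrite invr_ge0 exprn_ge0// ltW|exact/fine_ge0/A0].
  move=> z /andP[z0 z1].
  have z01 : 0 <= z < 1 by rewrite ltW.
  have T0 : 0 <= t * h `^ (- al) by rewrite mulr_ge0 ?powR_ge0.
  rewrite pseriesZ.
  have -> : wlap al t ((1 - z) / h) = h `^ (1 - al) * ((1 - z) `^ (al - 1) *
     expR (- (t * h `^ (- al) * (1 - z) `^ al))).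
    have z1' : 0 <= 1 - z by rewrite subr_ge0 ltW.
    have hp p : h^-1 `^ p = h `^ (- p).
      by rewrite -(powR_inv1 (ltW h0)) -powRrM mulN1r.
    rewrite /wlap !powRM ?invr_ge0 ?(ltW h0)// !hp opprB.
    rewrite (_ : t * ((1 - z) `^ al * h `^ (- al)) =
      t * h `^ (- al) * (1 - z) `^ al); ring.
  rewrite -[_ *: _]/(fun n => h `^ (1 - al) * pseries _ z n).
  by apply: cvgM; [exact: cvg_cst|exact: wcoef_gf].
have := aE n; rewrite /a -/(A n) -(fineK (Afin n)) => e; congr EFin.
by rewrite -mulrA -e mulVKf// expf_neq0// gt_eqF.
Qed.

Corollary integrable_wmoment t h n : 0 <= t -> 0 < h ->
  mu.-integrable (`]0%R, +oo[%classic : set R) (EFin \o wmoment t h n).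
Proof.
move=> t0 h0; apply/integrableP; split.
  by apply/measurable_EFinP; exact: measurable_wmoment.
rewrite (_ : \int[_]_(_ in _) _ = \int[mu]_(s in `]0%R, +oo[) (wmoment t h n s)%:E)%E.
  by rewrite integral_wmoment// ltry.
apply: eq_integral => s /set_mem; rewrite /= in_itv/= andbT => s0.
by rewrite ger0_norm// wmoment_ge0.
Qed.

End moments.

(** * Logarithm of 1 - z on a circle *)

Section real_derivatives.
Context {R : realType}.
Implicit Types (f g : R -> R) (x df dg : R).

Lemma drv_cst (c x : R) : is_derive x (1 : R) (fun=> c) 0.
Proof. exact: is_derive_cst. Qed.

Lemma drv_id x : is_derive x (1 : R) (fun y => y) 1.
Proof. exact: is_derive_id. Qed.

Lemma drvD f g x df dg : is_derive x (1 : R) f df -> is_derive x 1 g dg ->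
  is_derive x 1 (fun y => f y + g y) (df + dg).
Proof. by move=> hf hg; exact: is_deriveD. Qed.

Lemma drvB f g x df dg : is_derive x (1 : R) f df -> is_derive x 1 g dg ->
  is_derive x 1 (fun y => f y - g y) (df - dg).
Proof. by move=> hf hg; exact: is_deriveB. Qed.

Lemma drvN f x df : is_derive x (1 : R) f df -> is_derive x 1 (fun y => - f y) (- df).
Proof. by move=> hf; exact: is_deriveN. Qed.

Lemma drvM f g x df dg : is_derive x (1 : R) f df -> is_derive x 1 g dg ->
  is_derive x 1 (fun y => f y * g y) (f x * dg + g x * df).
Proof. by move=> hf hg; exact: is_deriveM. Qed.

Lemma drv_comp f g x df dg : is_derive (g x) (1 : R) f df -> is_derive x 1 g dg ->
  is_derive x 1 (fun y => f (g y)) (df * dg).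
Proof. by move=> hf hg; exact: is_derive1_comp. Qed.

Lemma drvV f x df : f x != 0 -> is_derive x (1 : R) f df ->
  is_derive x 1 (fun y => (f y)^-1) (- (f x) ^- 2 * df).
Proof.
move=> f0 hf; have [d e] := hf.
by apply: DeriveDef; [exact: derivableV|rewrite deriveV// e].
Qed.

Lemma drv_continuous f x df : is_derive x (1 : R) f df -> {for x, continuous f}.
Proof.
by move=> h; apply/differentiable_continuous/derivable1_diffP; exact: ex_derive.
Qed.

End real_derivatives.

Section argument.
Context {R : realType}.
Implicit Types (A B a h : R).

(** The real part of the principal logarithm of A + iB. *)
Definition logmod A B : R := 2^-1 * ln (A ^+ 2 + B ^+ 2).
(** The imaginary part of the principal logarithm of A + iB when A > 0; unlike
    the formula with arccos it is differentiable across the real axis. *)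
Definition argpos A B : R := atan (B / A).

Lemma sumsq_gt0 A B : 0 < A -> 0 < A ^+ 2 + B ^+ 2.
Proof. by move=> A0; rewrite ltr_pwDl ?exprn_gt0 ?sqr_ge0. Qed.

Lemma expR_logmod A B : 0 < A -> expR (logmod A B) = Num.sqrt (A ^+ 2 + B ^+ 2).
Proof.
move=> A0; have D0 := sumsq_gt0 B A0.
by rewrite /logmod -ln_powR powR12_sqrt ?ltW// lnK// posrE sqrtr_gt0.
Qed.

Lemma cos_argpos A B : 0 < A -> expR (logmod A B) * cos (argpos A B) = A.
Proof.
move=> A0; have D0 := sumsq_gt0 B A0.
rewrite expR_logmod// cos_atan.
have -> : 1 + (B / A) ^+ 2 = (A ^+ 2 + B ^+ 2) / A ^+ 2.
  by field; rewrite gt_eqF.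
rewrite sqrtrM ?(ltW D0)// sqrtrV ?sqr_ge0// sqrtr_sqr gtr0_norm// invfM invrK.
by rewrite mulrA mulfV ?mul1r// sqrtr_eq0 -ltNge.
Qed.

Lemma sin_argpos A B : 0 < A -> expR (logmod A B) * sin (argpos A B) = B.
Proof.
move=> A0; have c := cos_argpos B A0.
have c0 : cos (argpos A B) != 0.
  by apply: contra_eq_neq c => ->; rewrite mulr0 lt_eqF.
have : tan (argpos A B) = B / A by rewrite /argpos atanK.
rewrite /tan => /(congr1 (fun x => x * cos (argpos A B))); rewrite divfK// => ->.
by rewrite mulrCA c divfK// gt_eqF.
Qed.

Lemma cmodE A B : cmod (A +i* B) = Num.sqrt (A ^+ 2 + B ^+ 2).
Proof. by []. Qed.

Lemma cargE A B : 0 < A -> carg (A +i* B) = argpos A B.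
Proof.
move=> A0; have D0 := sumsq_gt0 B A0; rewrite /carg cmodE /=.
have -> : A / Num.sqrt (A ^+ 2 + B ^+ 2) = cos (argpos A B).
  rewrite -{1}(cos_argpos B A0) expR_logmod// mulrC mulKf//.
  by rewrite sqrtr_eq0 -ltNge.
have up := atan_ltpi2 (B / A); have lo := atan_gtNpi2 (B / A).
have pi0 := pi_gt0 R.
case: ifPn => [B0|].
  rewrite cosK// in_itv/= {1}/argpos -[X in X <= _]atan0 le_atan ?divr_ge0 ?(ltW A0)//=.
  by rewrite /argpos; lra.
rewrite -ltNge => B0; rewrite cosKN ?opprK//.
apply/andP; split; first by rewrite /argpos; lra.
by rewrite /argpos -[leRHS]atan0 le_atan// pmulr_lle0 ?invr_gt0// ltW.
Qed.

(** On the right half-plane, which contains 1 - z for |z| < 1, principal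
    powers are exponentials of the smooth logarithm. *)
Lemma cpowE A B a : 0 < A -> cpow (A +i* B) a =
  (expR (a * logmod A B) * cos (a * argpos A B)) +i*
  (expR (a * logmod A B) * sin (a * argpos A B)).
Proof.
move=> A0; rewrite /cpow cargE// cmodE -expR_logmod//.
rewrite /powR gt_eqF ?expR_gt0// expRK /cis.
by apply/eqP; rewrite eq_complex /=; apply/andP; split; apply/eqP; ring.
Qed.

End argument.

Section complex_logarithm.
Context {R : realType}.
Context (A B : R -> R) (x dA dB : R) (A0 : 0 < A x).
Context (hA : is_derive x (1 : R) A dA) (hB : is_derive x (1 : R) B dB).

Lemma drv_logmod : is_derive x 1 (fun y => logmod (A y) (B y))
  ((A x * dA + B x * dB) / (A x ^+ 2 + B x ^+ 2)).
Proof.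
have D0 := sumsq_gt0 (B x) A0.
have hD : is_derive x 1 (fun y => A y ^+ 2 + B y ^+ 2) _ :=
  drvD (drvM hA hA) (drvM hB hB).
have hl := drvM (drv_cst 2^-1 x) (@drv_comp R (@ln R) _ x _ _ (is_derive1_ln D0) hD).
apply: (is_derive_eq hl); field; rewrite gt_eqF//.
Qed.

Lemma drv_argpos : is_derive x 1 (fun y => argpos (A y) (B y))
  ((A x * dB - B x * dA) / (A x ^+ 2 + B x ^+ 2)).
Proof.
have An : A x != 0 by rewrite gt_eqF.
have D0 := sumsq_gt0 (B x) A0.
have hQ := drvM hB (drvV An hA).
have hl := @drv_comp R (@atan R) _ x _ _ (is_derive1_atan _) hQ.
apply: (is_derive_eq hl).
have e : 1 + (B x * (A x)^-1) ^+ 2 = (A x ^+ 2 + B x ^+ 2) / A x ^+ 2.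
  by field; rewrite An.
rewrite e; move: D0; move: (A x) (B x) An => a b a0 D0; field.
by rewrite a0 gt_eqF.
Qed.

End complex_logarithm.

Section polar.
Context {R : realType}.
Implicit Types (a c q th : R).

Definition disc1 q th : R := (1 - q * cos th) ^+ 2 + (- (q * sin th)) ^+ 2.
(** With [parg], the real and imaginary parts of log (1 - z) at z = q
    e^(i th). *)
Definition plog q th : R := logmod (1 - q * cos th) (- (q * sin th)).
Definition parg q th : R := argpos (1 - q * cos th) (- (q * sin th)).
(** With [pY], the real and imaginary parts of e^(i th) / (1 - q e^(i th)),
    the function by which differentiation multiplies powers of 1 - z. *)
Definition pX q th : R := (cos th - q) / disc1 q th.
Definition pY q th : R := sin th / disc1 q th.

Lemma re1mz_gt0 q th : `|q| < 1 -> 0 < 1 - q * cos th.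
Proof.
move=> q1; rewrite subr_gt0; apply: le_lt_trans (ler_norm _) _.
rewrite normrM; apply: le_lt_trans q1; rewrite ler_piMr//.
by rewrite ler_norml cos_geN1 cos_le1.
Qed.

Lemma disc1_gt0 q th : `|q| < 1 -> 0 < disc1 q th.
Proof. by move=> q1; apply: sumsq_gt0; exact: re1mz_gt0. Qed.

Lemma disc1_neq0 q th : `|q| < 1 -> disc1 q th != 0.
Proof. by move=> q1; rewrite gt_eqF// disc1_gt0. Qed.

Lemma drv_re1mz_th q th : is_derive th 1 (fun y => 1 - q * cos y) (q * sin th).
Proof.
have h := drvB (drv_cst 1 th) (drvM (drv_cst q th) (is_derive_cos th)).
by apply: (is_derive_eq h); ring.
Qed.

Lemma drv_im1mz_th q th : is_derive th 1 (fun y => - (q * sin y)) (- (q * cos th)).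
Proof.
have h := drvN (drvM (drv_cst q th) (is_derive_sin th)).
by apply: (is_derive_eq h); ring.
Qed.

Lemma drv_re1mz_q q th : is_derive q 1 (fun y => 1 - y * cos th) (- cos th).
Proof.
have h := drvB (drv_cst 1 q) (drvM (drv_id q) (drv_cst (cos th) q)).
by apply: (is_derive_eq h); ring.
Qed.

Lemma drv_im1mz_q q th : is_derive q 1 (fun y => - (y * sin th)) (- sin th).
Proof.
have h := drvN (drvM (drv_id q) (drv_cst (sin th) q)).
by apply: (is_derive_eq h); ring.
Qed.

Lemma drv_plog_th q th : `|q| < 1 ->
  is_derive th 1 (plog q) (q * pY q th).
Proof.
move=> q1; have h := @drv_logmod R (fun y => 1 - q * cos y) (fun y => - (q * sin y)) th _ _
  (re1mz_gt0 th q1) (drv_re1mz_th q th) (drv_im1mz_th q th).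
by apply: (is_derive_eq h); rewrite /pY -/(disc1 q th); ring.
Qed.

Lemma drv_parg_th q th : `|q| < 1 ->
  is_derive th 1 (parg q) (- (q * pX q th)).
Proof.
move=> q1; have h := @drv_argpos R (fun y => 1 - q * cos y) (fun y => - (q * sin y)) th _ _
  (re1mz_gt0 th q1) (drv_re1mz_th q th) (drv_im1mz_th q th).
apply: (is_derive_eq h); rewrite /pX -/(disc1 q th).
have -> : (1 - q * cos th) * - (q * cos th) - - (q * sin th) * (q * sin th) =
  q ^+ 2 * (cos th ^+ 2 + sin th ^+ 2) - q * cos th by ring.
by rewrite cos2Dsin2; ring.
Qed.

Lemma drv_plog_q q th : `|q| < 1 ->
  is_derive q 1 (plog^~ th) (- pX q th).
Proof.
move=> q1; have h := @drv_logmod R (fun y => 1 - y * cos th) (fun y => - (y * sin th)) q _ _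
  (re1mz_gt0 th q1) (drv_re1mz_q q th) (drv_im1mz_q q th).
apply: (is_derive_eq h); rewrite /pX -/(disc1 q th).
have -> : (1 - q * cos th) * - cos th + - (q * sin th) * - sin th =
  q * (cos th ^+ 2 + sin th ^+ 2) - cos th by ring.
by rewrite cos2Dsin2; ring.
Qed.

Lemma drv_parg_q q th : `|q| < 1 ->
  is_derive q 1 (parg^~ th) (- pY q th).
Proof.
move=> q1; have h := @drv_argpos R (fun y => 1 - y * cos th) (fun y => - (y * sin th)) q _ _
  (re1mz_gt0 th q1) (drv_re1mz_q q th) (drv_im1mz_q q th).
by apply: (is_derive_eq h); rewrite /pY -/(disc1 q th); ring.
Qed.

Lemma inv1mz_cos q th : `|q| < 1 -> expR (- plog q th) * cos (th - parg q th) = pX q th.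
Proof.
move=> q1; have D0 := disc1_neq0 th q1.
have c := cos_argpos (- (q * sin th)) (re1mz_gt0 th q1).
have s := sin_argpos (- (q * sin th)) (re1mz_gt0 th q1).
have e2 : expR (plog q th) ^+ 2 = disc1 q th.
  by rewrite expR_logmod ?re1mz_gt0// sqr_sqrtr ?ltW// disc1_gt0.
have e0 : expR (plog q th) != 0 by rewrite gt_eqF// expR_gt0.
rewrite cosB expRN; apply: (mulfI e0); rewrite mulrA mulfV// mul1r.
apply: (mulfI e0); rewrite mulrA -expr2 e2 /pX [RHS]mulrC divfK//.
rewrite mulrDr [expR _ * (cos th * _)]mulrCA [expR _ * (sin th * _)]mulrCA c s.
have -> : cos th * (1 - q * cos th) + sin th * - (q * sin th) =
  cos th - q * (cos th ^+ 2 + sin th ^+ 2) by ring.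
by rewrite cos2Dsin2 mulr1.
Qed.

Lemma inv1mz_sin q th : `|q| < 1 -> expR (- plog q th) * sin (th - parg q th) = pY q th.
Proof.
move=> q1; have D0 := disc1_neq0 th q1.
have c := cos_argpos (- (q * sin th)) (re1mz_gt0 th q1).
have s := sin_argpos (- (q * sin th)) (re1mz_gt0 th q1).
have e2 : expR (plog q th) ^+ 2 = disc1 q th.
  by rewrite expR_logmod ?re1mz_gt0// sqr_sqrtr ?ltW// disc1_gt0.
have e0 : expR (plog q th) != 0 by rewrite gt_eqF// expR_gt0.
rewrite sinB expRN; apply: (mulfI e0); rewrite mulrA mulfV// mul1r.
apply: (mulfI e0); rewrite mulrA -expr2 e2 /pY [RHS]mulrC divfK//.
rewrite mulrBr [expR _ * (cos th * _)]mulrCA [expR _ * (sin th * _)]mulrCA c s.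
by ring.
Qed.

(** With [Esin], the real and imaginary parts of (1 - z)^a e^(- i c th) at
    z = q e^(i th); on the circle of radius q the exponential plays the role
    of z^(-c). *)
Definition Ecos a c q th : R := expR (a * plog q th) * cos (a * parg q th - c * th).
Definition Esin a c q th : R := expR (a * plog q th) * sin (a * parg q th - c * th).

(** Lowering a and c by 1 multiplies by e^(i th) / (1 - z). *)
Lemma Ecos_pred a c q th : `|q| < 1 -> Ecos (a - 1) (c - 1) q th =
  Ecos a c q th * pX q th - Esin a c q th * pY q th.
Proof.
move=> q1; rewrite -inv1mz_cos// -inv1mz_sin// /Ecos /Esin.
rewrite (_ : (a - 1) * plog q th = a * plog q th + - plog q th); last by ring.
rewrite (_ : (a - 1) * parg q th - (c - 1) * th =
  (a * parg q th - c * th) + (th - parg q th)); last by ring.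
by rewrite expRD (cosD (a * parg q th - c * th)); ring.
Qed.

Lemma Esin_pred a c q th : `|q| < 1 -> Esin (a - 1) (c - 1) q th =
  Esin a c q th * pX q th + Ecos a c q th * pY q th.
Proof.
move=> q1; rewrite -inv1mz_cos// -inv1mz_sin// /Ecos /Esin.
rewrite (_ : (a - 1) * plog q th = a * plog q th + - plog q th); last by ring.
rewrite (_ : (a - 1) * parg q th - (c - 1) * th =
  (a * parg q th - c * th) + (th - parg q th)); last by ring.
by rewrite expRD (sinD (a * parg q th - c * th)); ring.
Qed.

Lemma drv_Ecos_th a c q th : `|q| < 1 ->
  is_derive th 1 (Ecos a c q) (a * q * Esin (a - 1) (c - 1) q th + c * Esin a c q th).
Proof.
move=> q1.
have hp := drvB (drvM (drv_cst a th) (drv_parg_th th q1)) (drvM (drv_cst c th) (drv_id th)).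
have he := @drv_comp R expR _ th _ _ (is_derive_expR _) (drvM (drv_cst a th) (drv_plog_th th q1)).
have h := drvM he (@drv_comp R (@cos R) _ th _ _ (is_derive_cos _) hp).
by apply: (is_derive_eq h); rewrite Esin_pred// /Ecos /Esin; ring.
Qed.

Lemma drv_Esin_th a c q th : `|q| < 1 ->
  is_derive th 1 (Esin a c q) (- (a * q * Ecos (a - 1) (c - 1) q th + c * Ecos a c q th)).
Proof.
move=> q1.
have hp := drvB (drvM (drv_cst a th) (drv_parg_th th q1)) (drvM (drv_cst c th) (drv_id th)).
have he := @drv_comp R expR _ th _ _ (is_derive_expR _) (drvM (drv_cst a th) (drv_plog_th th q1)).
have h := drvM he (@drv_comp R (@sin R) _ th _ _ (is_derive_sin _) hp).
by apply: (is_derive_eq h); rewrite Ecos_pred// /Ecos /Esin; ring.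
Qed.

(** The radial derivative of (1 - z)^a is - a e^(i th) (1 - z)^(a - 1). *)
Lemma drv_Ecos_q a q th : `|q| < 1 ->
  is_derive q 1 ((Ecos a 0)^~ th) (- (a * Ecos (a - 1) (0 - 1) q th)).
Proof.
move=> q1.
have hp := drvB (drvM (drv_cst a q) (drv_parg_q th q1)) (drv_cst (0 * th) q).
have he := @drv_comp R expR _ q _ _ (is_derive_expR _) (drvM (drv_cst a q) (drv_plog_q th q1)).
have h := drvM he (@drv_comp R (@cos R) _ q _ _ (is_derive_cos _) hp).
by apply: (is_derive_eq h); rewrite Ecos_pred// /Ecos /Esin; ring.
Qed.

Lemma drv_Esin_q a q th : `|q| < 1 ->
  is_derive q 1 ((Esin a 0)^~ th) (- (a * Esin (a - 1) (0 - 1) q th)).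
Proof.
move=> q1.
have hp := drvB (drvM (drv_cst a q) (drv_parg_q th q1)) (drv_cst (0 * th) q).
have he := @drv_comp R expR _ q _ _ (is_derive_expR _) (drvM (drv_cst a q) (drv_plog_q th q1)).
have h := drvM he (@drv_comp R (@sin R) _ q _ _ (is_derive_sin _) hp).
by apply: (is_derive_eq h); rewrite Esin_pred// /Ecos /Esin; ring.
Qed.

End polar.

(** * Taylor coefficients of (1 - z)^a as integrals over a circle *)

Section circle.
Context {R : realType}.
Notation mu := (@lebesgue_measure R).
Implicit Types (a c q th : R).

Definition turn : set R := `[0, 2 * pi].

Lemma measurable_turn : measurable (turn : set (measurableTypeR R)).
Proof. exact: measurable_itv. Qed.

Lemma integrable_turn (f : R -> R) : (forall th, {for th, continuous f}) ->
  mu.-integrable turn (EFin \o f).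
Proof.
move=> cf; apply: continuous_compact_integrable; first exact: segment_compact.
by apply: continuous_in_subspaceT => x _; exact: cf.
Qed.

Lemma integral_turn_derive (f F : R -> R) :
  (forall th, is_derive th 1 F (f th)) -> (forall th, {for th, continuous f}) ->
  F (2 * pi) = F 0 -> \int[mu]_(th in turn) f th = 0.
Proof.
move=> dF cf e; rewrite /Rintegral (@derive_integral R f F) ?e ?subrr//.
by rewrite mulr_gt0// pi_gt0.
Qed.

Lemma continuous_Ecos a c q : `|q| < 1 -> forall th, {for th, continuous (Ecos a c q)}.
Proof. by move=> q1 th; exact: drv_continuous (drv_Ecos_th a c th q1). Qed.

Lemma continuous_Esin a c q : `|q| < 1 -> forall th, {for th, continuous (Esin a c q)}.
Proof. by move=> q1 th; exact: drv_continuous (drv_Esin_th a c th q1). Qed.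

Lemma integrable_Ecos a c q : `|q| < 1 -> mu.-integrable turn (EFin \o Ecos a c q).
Proof. by move=> q1; apply: integrable_turn; exact: continuous_Ecos. Qed.

Lemma integrable_Esin a c q : `|q| < 1 -> mu.-integrable turn (EFin \o Esin a c q).
Proof. by move=> q1; apply: integrable_turn; exact: continuous_Esin. Qed.

Lemma cos_nat2pi n : cos (n%:R * (2 * pi)) = 1 :> R.
Proof.
elim: n => [|n IH]; first by rewrite mul0r cos0.
by rewrite [2 * pi]mulr_natl in IH *; rewrite -natr1 mulrDl mul1r cosD2pi.
Qed.

Lemma sin_nat2pi n : sin (n%:R * (2 * pi)) = 0 :> R.
Proof.
elim: n => [|n IH]; first by rewrite mul0r sin0.
by rewrite [2 * pi]mulr_natl in IH *; rewrite -natr1 mulrDl mul1r sinD2pi.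
Qed.

Lemma plog_2pi q : plog q (2 * pi) = plog q 0.
Proof. by rewrite /plog [2 * pi]mulr_natl cos2pi sin2pi cos0 sin0. Qed.

Lemma parg_2pi q : parg q (2 * pi) = 0.
Proof. by rewrite /parg /argpos [2 * pi]mulr_natl sin2pi mulr0 oppr0 mul0r atan0. Qed.

Lemma parg_0 q : parg q 0 = 0.
Proof. by rewrite /parg /argpos sin0 mulr0 oppr0 mul0r atan0. Qed.

Lemma Ecos_2pi a n q : Ecos a n%:R q (2 * pi) = Ecos a n%:R q 0.
Proof.
rewrite /Ecos plog_2pi parg_2pi parg_0 !mulr0 !sub0r cosN oppr0 cos0.
by rewrite cos_nat2pi.
Qed.

Lemma Esin_2pi a n q : Esin a n%:R q (2 * pi) = Esin a n%:R q 0.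
Proof.
rewrite /Esin plog_2pi parg_2pi parg_0 !mulr0 !sub0r sinN oppr0 sin0.
by rewrite sin_nat2pi oppr0.
Qed.

Definition Icos a c q : R := \int[mu]_(th in turn) Ecos a c q th.
Definition Isin a c q : R := \int[mu]_(th in turn) Esin a c q th.

Lemma int_lin (f g : R -> R) a b : mu.-integrable turn (EFin \o f) ->
  mu.-integrable turn (EFin \o g) ->
  \int[mu]_(th in turn) (a * f th + b * g th) =
  a * \int[mu]_(th in turn) f th + b * \int[mu]_(th in turn) g th.
Proof.
move=> hf hg; have mt := measurable_turn.
have Z k (u : R -> R) : mu.-integrable turn (EFin \o u) ->
    mu.-integrable turn (EFin \o (fun th => k * u th)).
  move=> hu; have := integrableZl mt k hu.
  by apply: (eq_integrable mt) => x _; rewrite /= EFinM.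
by rewrite RintegralD ?RintegralZl//; exact: Z.
Qed.

(** The integral over a full turn of the derivative in th of (1 - z)^a
    e^(- i n th) is 0, which relates index n to index n - 1. *)
Lemma Icos_rec a n q : `|q| < 1 ->
  n%:R * Icos a n%:R q = - (a * q) * Icos (a - 1) (n%:R - 1) q.
Proof.
move=> q1.
have := @integral_turn_derive (fun th => - (a * q * Ecos (a - 1) (n%:R - 1) q th +
  n%:R * Ecos a n%:R q th)) (Esin a n%:R q) (fun th => drv_Esin_th a n%:R th q1).
have e : (fun th => - (a * q * Ecos (a - 1) (n%:R - 1) q th + n%:R * Ecos a n%:R q th)) =
   (fun th => - (a * q) * Ecos (a - 1) (n%:R - 1) q th + - n%:R * Ecos a n%:R q th).
  by apply/funext => th; rewrite opprD !mulNr.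
rewrite e => /(_ _ (Esin_2pi a n q)).
rewrite int_lin; [|exact: integrable_Ecos|exact: integrable_Ecos].
rewrite -/(Icos (a - 1) (n%:R - 1) q) -/(Icos a n%:R q) => H.
have {}H := H _.
have : - (a * q) * Icos (a - 1) (n%:R - 1) q + - n%:R * Icos a n%:R q = 0.
  apply: H => th; apply: continuousD; apply: continuousM;
    by [exact: cst_continuous|exact: continuous_Ecos].
by move=> /eqP; rewrite addr_eq0 mulNr opprK => /eqP ->.
Qed.

Lemma Isin_rec a n q : `|q| < 1 ->
  n%:R * Isin a n%:R q = - (a * q) * Isin (a - 1) (n%:R - 1) q.
Proof.
move=> q1.
have := @integral_turn_derive (fun th => a * q * Esin (a - 1) (n%:R - 1) q th +
  n%:R * Esin a n%:R q th) (Ecos a n%:R q) (fun th => drv_Ecos_th a n%:R th q1).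
move=> /(_ _ (Ecos_2pi a n q)).
rewrite int_lin; [|exact: integrable_Esin|exact: integrable_Esin].
rewrite -/(Isin (a - 1) (n%:R - 1) q) -/(Isin a n%:R q) => H.
have : a * q * Isin (a - 1) (n%:R - 1) q + n%:R * Isin a n%:R q = 0.
  apply: H => th; apply: continuousD; apply: continuousM;
    by [exact: cst_continuous|exact: continuous_Esin].
by move=> /eqP; rewrite addrC addr_eq0 => /eqP ->; rewrite mulNr.
Qed.

Lemma plog_bound q u th : `|q| <= u -> u < 1 -> `|plog q th| <= - ln (1 - u).
Proof.
move=> qu u1; have q1 : `|q| < 1 by exact: le_lt_trans u1.
have u0 : 0 <= u by exact: le_trans qu.
have u1' : 0 < 1 - u by rewrite subr_gt0.
have D0 := disc1_gt0 th q1.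
have c1 : `|q * cos th| <= u.
  rewrite normrM; apply: le_trans qu; rewrite ler_piMr//.
  by rewrite ler_norml cos_geN1 cos_le1.
have c2 : `|q * sin th| <= u.
  rewrite normrM; apply: le_trans qu; rewrite ler_piMr//.
  by rewrite ler_norml sin_geN1 sin_le1.
have lo : (1 - u) ^+ 2 <= disc1 q th.
  rewrite /disc1; apply: le_trans (_ : (1 - q * cos th) ^+ 2 <= _).
    rewrite lerXn2r ?nnegrE ?(ltW u1')//; move: c1; rewrite ler_norml; lra.
  by rewrite lerDl sqr_ge0.
have up : disc1 q th <= (1 - u) ^- 2.
  have : disc1 q th <= (1 + u) ^+ 2.
    have -> : disc1 q th = 1 - 2 * (q * cos th) + q ^+ 2.
      rewrite /disc1 (_ : _ + _ = 1 - 2 * (q * cos th) +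
        q ^+ 2 * (cos th ^+ 2 + sin th ^+ 2)); last by ring.
      by rewrite cos2Dsin2 mulr1.
    have : q ^+ 2 <= u ^+ 2 by rewrite -[q ^+ 2]real_normK ?num_real// lerXn2r ?nnegrE.
    move: c1; rewrite ler_norml => /andP[c1 _].
    rewrite (_ : (1 + u) ^+ 2 = 1 + 2 * u + u ^+ 2); last by ring.
    lra.
  move=> /le_trans; apply; rewrite -exprVn.
  have : 1 + u <= (1 - u)^-1.
    rewrite -[leRHS]mul1r ler_pdivlMr// (_ : _ * _ = 1 - u ^+ 2); last by ring.
    by rewrite gerBl sqr_ge0.
  by move=> h; rewrite lerXn2r ?nnegrE ?addr_ge0// ?invr_ge0 ltW.
rewrite /plog /logmod -/(disc1 q th) ler_norml; apply/andP; split.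
  rewrite opprK -ler_pdivrMl ?invr_gt0// invrK mulr_natl -lnXn//.
  by rewrite ler_ln ?posrE ?exprn_gt0.
rewrite -ler_pdivlMl ?invr_gt0// invrK mulrN mulr_natl -lnXn// -lnV ?posrE ?exprn_gt0//.
by rewrite ler_ln ?posrE ?invr_gt0 ?exprn_gt0.
Qed.

Lemma Ecos_bound a c q u th : `|q| <= u -> u < 1 ->
  `|Ecos a c q th| <= expR (`|a| * - ln (1 - u)).
Proof.
move=> qu u1; rewrite /Ecos normrM -[leRHS]mulr1; apply: ler_pM => //.
  rewrite ger0_norm ?expR_ge0// ler_expR; apply: le_trans (ler_norm _) _.
  by rewrite normrM ler_wpM2l// plog_bound.
by rewrite ler_norml cos_geN1 cos_le1.
Qed.

Lemma Esin_bound a c q u th : `|q| <= u -> u < 1 ->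
  `|Esin a c q th| <= expR (`|a| * - ln (1 - u)).
Proof.
move=> qu u1; rewrite /Esin normrM -[leRHS]mulr1; apply: ler_pM => //.
  rewrite ger0_norm ?expR_ge0// ler_expR; apply: le_trans (ler_norm _) _.
  by rewrite normrM ler_wpM2l// plog_bound.
by rewrite ler_norml sin_geN1 sin_le1.
Qed.

(** Differentiation under the integral sign in the radius, on a neighbourhood
    where the radial derivative is bounded. *)
Lemma turn_radius_derive (E E' : R -> R -> R) (a K q u : R) : `|q| < u -> u < 1 ->
  (forall x : R, `|x| < 1 -> mu.-integrable turn (EFin \o E x)) ->
  (forall x : R, `|x| < 1 -> mu.-integrable turn (EFin \o E' x)) ->
  (forall x y : R, `|x| < 1 -> is_derive x (1 : R) (E^~ y) (- (a * E' x y))) ->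
  (forall x y : R, `|x| <= u -> `|E' x y| <= K) ->
  is_derive q (1 : R) (fun x : R => \int[mu]_(th in turn) E x th)
    (- a * \int[mu]_(th in turn) E' q th).
Proof.
move=> qu u1 hE hE' dE0 bK.
have Iq : (`]- u, u[%classic : set R) q by rewrite /= in_itv/= -ltr_norml.
have I1 (x : R) : (`]- u, u[%classic : set R) x -> `|x| <= u.
  by rewrite /= in_itv/= -ltr_norml => /ltW.
have I2 (x : R) : (`]- u, u[%classic : set R) x -> `|x| < 1.
  by move=> /I1 h; exact: le_lt_trans u1.
pose G := fun _ : R => `|a| * K.
have K0 : 0 <= K by apply: le_trans (bK q 0 (ltW qu)).
have G0 y : 0 <= G y by rewrite mulr_ge0.
have iG : mu.-integrable turn (EFin \o G).
  by apply: integrable_turn => th; exact: cst_continuous.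
have iE (x : R) : (`]- u, u[%classic : set R) x -> mu.-integrable turn (EFin \o E x).
  by move=> /I2; exact: hE.
have dE (x y : R) : (`]- u, u[%classic : set R) x -> turn y -> derivable (E^~ y) x 1.
  by move=> /I2 x1 _; apply: ex_derive; exact: dE0.
have pE (x y : R) : (`]- u, u[%classic : set R) x -> partial1of2 E x y = - (a * E' x y).
  by move=> /I2 x1; rewrite partial1of2E; apply: derive_val; exact: dE0.
have bE (x y : R) : (`]- u, u[%classic : set R) x -> turn y -> `|partial1of2 E x y| <= G y.
  by move=> Ix _; rewrite pE// normrN normrM ler_wpM2l// bK// I1.
have D := derivable_under_integral measurable_turn Iq iE dE G0 iG bE.
have V := differentiation_under_integral measurable_turn Iq iE dE G0 iG bE.
apply: DeriveDef; first exact: D.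
rewrite -derive1E V -[RHS]RintegralZl; [|exact: measurable_turn|exact/hE'/I2].
by apply: eq_Rintegral => y _; rewrite pE// mulNr.
Qed.

(** The hypothesis on the integral of E' is the relation of index n = 0
    between a and a - 1; it makes the radial derivative vanish for positive
    radii, so the integral equals its value at radius 0. *)
Lemma turn_radius_cst (E E' : R -> R -> R) (a : R) (q K : R) : 0 < q < 1 ->
  (forall x : R, `|x| < 1 -> mu.-integrable turn (EFin \o E x)) ->
  (forall x : R, `|x| < 1 -> mu.-integrable turn (EFin \o E' x)) ->
  (forall x y : R, `|x| < 1 -> is_derive x (1 : R) (E^~ y) (- (a * E' x y))) ->
  (forall x y : R, `|x| <= (1 + q) / 2 -> `|E' x y| <= K) ->
  (forall x : R, `|x| < 1 -> a * x * \int[mu]_(th in turn) E' x th = 0) ->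
  \int[mu]_(th in turn) E q th = \int[mu]_(th in turn) E 0 th.
Proof.
move=> /andP[q0 q1] hE hE' dE bK z.
have n1 (x : R) : 0 <= x <= q -> `|x| < (1 + q) / 2.
  by move=> /andP[x0 xq]; rewrite ger0_norm//; lra.
have u1 : (1 + q) / 2 < 1 by lra.
have D (x : R) : 0 <= x <= q -> is_derive x (1 : R) (fun x : R => \int[mu]_(th in turn) E x th)
    (- a * \int[mu]_(th in turn) E' x th).
  by move=> /n1 xu; apply: (turn_radius_derive xu u1) => //; exact: bK.
have [||x xq] := @MVT R (fun x : R => \int[mu]_(th in turn) E x th)
  (fun x : R => - a * \int[mu]_(th in turn) E' x th) 0 q q0.
- by move=> x; rewrite in_itv/= => /andP[x0 xq]; apply: D; rewrite !ltW.
- apply: derivable_within_continuous => x; rewrite in_itv/= => xq.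
  by apply: ex_derive; exact: D.
move: xq; rewrite in_itv/= => /andP[x0 xq].
have x1 : `|x| < 1 by apply: lt_trans u1; apply: n1; rewrite !ltW.
have : a * \int[mu]_(th in turn) E' x th = 0.
  have /eqP := z x x1; rewrite mulrAC mulf_eq0 (gt_eqF x0) orbF.
  by move/eqP.
by move=> e; rewrite mulNr e oppr0 mul0r => /eqP; rewrite subr_eq0 => /eqP.
Qed.

(** This is the mean value property of (1 - z)^a at 0, obtained by shrinking
    the circle. *)
Lemma Icos0 a q : 0 < q < 1 -> Icos a 0 q = 2 * pi.
Proof.
move=> q01; have u1 : (1 + q) / 2 < 1 by move: q01; lra.
transitivity (Icos a 0 0).
  apply: (@turn_radius_cst (Ecos a 0) (Ecos (a - 1) (0 - 1)) a q
    (expR (`|a - 1| * - ln (1 - (1 + q) / 2)))) => //.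
  - by move=> x; exact: integrable_Ecos.
  - by move=> x; exact: integrable_Ecos.
  - by move=> x y; exact: drv_Ecos_q.
  - by move=> x y xu; exact: Ecos_bound.
  - move=> x x1; have := @Icos_rec a 0 x x1; rewrite mul0r mulNr => /esym/eqP.
    by rewrite oppr_eq0 => /eqP.
rewrite /Icos /Rintegral (@eq_integral _ _ _ _ _ (cst (1%R : R)%:E)).
  rewrite integral_cst; last exact: measurable_turn.
  rewrite mul1e [X in fine X]lebesgue_measure_itv /= lte_fin mulr_gt0 ?pi_gt0//=.
  by rewrite subr0.
move=> th _; rewrite /Ecos /plog /logmod /parg /argpos !mul0r subr0 oppr0 !mul0r.
by rewrite ?oppr0 ?addr0 expr1n ?expr0n ?addr0 ln1 !mulr0 expR0 atan0 ?mulr0 ?subr0 ?oppr0 ?addr0 cos0 mulr1.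
Qed.

Lemma Isin0 a q : 0 < q < 1 -> Isin a 0 q = 0.
Proof.
move=> q01; have u1 : (1 + q) / 2 < 1 by move: q01; lra.
transitivity (Isin a 0 0).
  apply: (@turn_radius_cst (Esin a 0) (Esin (a - 1) (0 - 1)) a q
    (expR (`|a - 1| * - ln (1 - (1 + q) / 2)))) => //.
  - by move=> x; exact: integrable_Esin.
  - by move=> x; exact: integrable_Esin.
  - by move=> x y; exact: drv_Esin_q.
  - by move=> x y xu; exact: Esin_bound.
  - move=> x x1; have := @Isin_rec a 0 x x1; rewrite mul0r mulNr => /esym/eqP.
    by rewrite oppr_eq0 => /eqP.
rewrite /Isin /Rintegral (@eq_integral _ _ _ _ _ (cst (0%R : R)%:E)).
  by rewrite integral_cst; [rewrite mul0e|exact: measurable_turn].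
move=> th _; rewrite /Esin /plog /logmod /parg /argpos !mul0r subr0 oppr0 !mul0r.
by rewrite atan0 ?mulr0 ?oppr0 ?addr0 sin0 mulr0.
Qed.

(** Induction on n: the recursions for the integrals and for the coefficients
    agree, and the mean value property is the base case. *)
Theorem Icos_bcoef a n q : 0 < q < 1 ->
  Icos a n%:R q = 2 * pi * q ^+ n * bcoef (- a) n.
Proof.
move=> q01; have /andP[q0 q1] := q01.
have q1' : `|q| < 1 by rewrite gtr0_norm.
elim: n a => [|n IH] a; first by rewrite Icos0// expr0 bcoef0 !mulr1.
have n0 : n.+1%:R != 0 :> R by [].
have nm1 : n.+1%:R - 1 = n%:R :> R by rewrite -natr1 addrK.
apply: (mulfI n0); rewrite Icos_rec// nm1 IH [RHS]mulrCA bcoefSl exprS.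
by rewrite opprB (addrC 1); ring.
Qed.

Theorem Isin_eq0 a n q : 0 < q < 1 -> Isin a n%:R q = 0.
Proof.
move=> q01; have /andP[q0 q1] := q01.
have q1' : `|q| < 1 by rewrite gtr0_norm.
elim: n a => [|n IH] a; first exact: Isin0.
have n0 : n.+1%:R != 0 :> R by [].
have nm1 : n.+1%:R - 1 = n%:R :> R by rewrite -natr1 addrK.
by apply: (mulfI n0); rewrite Isin_rec// nm1 IH !mulr0.
Qed.

End circle.

(** * The contour integral in closed form *)

Section contour.
Context {R : realType}.
Notation mu := (@lebesgue_measure R).
Implicit Types (a b q th : R) (z : R[i]).

Lemma cisD a b : cis (a + b) = cis a * cis b :> R[i].
Proof.
apply/eqP; rewrite eq_complex /= cosD sinD; apply/andP; split; apply/eqP; ring.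
Qed.

Lemma cis0 : cis 0 = 1 :> R[i].
Proof. by rewrite /cis cos0 sin0. Qed.

Lemma cisX a n : cis a ^+ n = cis (n%:R * a) :> R[i].
Proof.
elim: n => [|n IH]; first by rewrite expr0 mul0r cis0.
by rewrite exprS IH -cisD -natr1 mulrDl mul1r addrC.
Qed.

Lemma cis_neq0 a : cis a != 0 :> R[i].
Proof.
apply/eqP => /(congr1 (fun z => z * cis (- a))).
by rewrite mul0r -cisD subrr cis0 => /eqP; rewrite oner_eq0.
Qed.

Lemma cisV a : (cis a)^-1 = cis (- a) :> R[i].
Proof.
by apply: (mulfI (cis_neq0 a)); rewrite mulfV ?cis_neq0// -cisD subrr cis0.
Qed.

(** The a-th power of the number with logarithm L + iA. *)
Definition polar (L A a : R) : R[i] := (expR (a * L))%:C * cis (a * A).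

Lemma polarD L A a b : polar L A (a + b) = polar L A a * polar L A b.
Proof. by rewrite /polar !mulrDl expRD cisD rmorphM mulrACA. Qed.

Lemma polarX L A a n : polar L A a ^+ n = polar L A (a * n%:R).
Proof.
elim: n => [|n IH]; first by rewrite mulr0 /polar !mul0r expR0 cis0 mulr1.
by rewrite exprS IH -polarD -[in RHS]natr1 mulrDr mulr1 addrC.
Qed.

Lemma polarV L A a : (polar L A a)^-1 = polar L A (- a).
Proof.
by rewrite /polar invfM cisV -fmorphV/= -expRN !mulNr.
Qed.

Lemma logmod_div A B (h : R) : 0 < A -> 0 < h ->
  logmod (A / h) (B / h) = logmod A B - ln h.
Proof.
move=> A0 h0; rewrite /logmod.
have -> : (A / h) ^+ 2 + (B / h) ^+ 2 = (A ^+ 2 + B ^+ 2) * (h ^+ 2)^-1.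
  by field; rewrite gt_eqF.
rewrite lnM ?posrE ?sumsq_gt0 ?invr_gt0 ?exprn_gt0// lnV ?posrE ?exprn_gt0//.
by rewrite lnXn// -mulr_natl; field.
Qed.

Lemma argpos_div A B (h : R) : 0 < h -> argpos (A / h) (B / h) = argpos A B.
Proof. by move=> h0; rewrite /argpos invfM invrK mulrACA mulVf ?gt_eqF// mulr1. Qed.

Lemma cpow_circle q th (h a : R) : `|q| < 1 -> 0 < h ->
  cpow ((1 - q%:C * cis th) / h%:C) a = polar (plog q th - ln h) (parg q th) a.
Proof.
move=> q1 h0; have A0 := re1mz_gt0 th q1.
have -> : (1 - q%:C * cis th) / h%:C =
    ((1 - q * cos th) / h) +i* ((- (q * sin th)) / h) :> R[i].
  rewrite -fmorphV/=; apply/eqP; rewrite eq_complex /=.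
  by apply/andP; split; apply/eqP; ring.
rewrite cpowE ?divr_gt0// logmod_div// argpos_div// -/(plog q th) -/(parg q th).
rewrite /polar /cis; apply/eqP; rewrite eq_complex /=.
by apply/andP; split; apply/eqP; ring.
Qed.

Lemma polar_circle q th (h a : R) n : 0 < h ->
  polar (plog q th - ln h) (parg q th) a * cis (- (n%:R * th)) =
  (h `^ (- a) * Ecos a n%:R q th) +i* (h `^ (- a) * Esin a n%:R q th).
Proof.
move=> h0; rewrite /polar -mulrA -cisD mulrBr expRD /cis /Ecos /Esin /powR gt_eqF//.
rewrite mulNr; apply/eqP; rewrite eq_complex /=.
by apply/andP; split; apply/eqP; ring.
Qed.

Lemma Rintegral_turn_sum (F : nat -> R -> R) (c : nat -> R) n :
  (forall i th, {for th, continuous (F i)}) ->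
  \int[mu]_(th in turn) (\sum_(i < n) c i * F i th) =
  \sum_(i < n) c i * \int[mu]_(th in turn) F i th.
Proof.
move=> cF.
elim: n => [|n IH].
  rewrite big_ord0 /Rintegral (@eq_integral _ _ _ _ _ (cst (0%R : R)%:E)).
    by rewrite integral_cst; [rewrite mul0e|exact: measurable_turn].
  by move=> th _; rewrite big_ord0.
rewrite big_ord_recr/= -IH -[X in X + _]mul1r -int_lin.
- by apply: eq_Rintegral => th _; rewrite mul1r big_ord_recr.
- apply: integrable_turn => th; elim: {IH} n => [|n IH].
    have -> : (fun th => \sum_(i < 0) c i * F i th) = cst 0.
      by apply/funext => y; rewrite big_ord0.
    exact: cst_continuous.
  have -> : (fun th => \sum_(i < n.+1) c i * F i th) =
    (fun th => \sum_(i < n) c i * F i th + c n * F n th).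
    by apply/funext => y; rewrite big_ord_recr.
  by apply: continuousD => //; apply: continuousM; [exact: cst_continuous|].
- exact: integrable_turn.
Qed.

Lemma sum_complex (A B : nat -> R) n :
  \sum_(i < n) (A i +i* B i) = (\sum_(i < n) A i) +i* (\sum_(i < n) B i) :> R[i].
Proof. by elim: n => [|n IH]; rewrite ?big_ord0// !big_ord_recr/= IH. Qed.

Lemma cintegral_split (D : set R) (f : R -> R[i]) (A B : R -> R) :
  (forall x, f x = A x +i* B x) ->
  cintegral D f = (\int[mu]_(x in D) A x) +i* (\int[mu]_(x in D) B x).
Proof.
by move=> e; rewrite /cintegral; congr (_ +i* _); apply: eq_Rintegral => x _; rewrite e.
Qed.

Definition wright_coef (r h : R) n j l : R := (r ^+ n)^-1 * ('C(j, l)%:R * (- h) ^+ l).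

Lemma contour_integrand (r h al b th : R) n j : 0 < r < 1 -> 0 < h ->
  let z := r%:C * cis th in
  (z ^+ n.+1)^-1 * ((1 - h%:C * cpow ((1 - z) / h%:C) al) ^+ j /
     cpow ((1 - z) / h%:C) b) * (0 +i* 1) * z =
  (\sum_(l < j.+1) - (wright_coef r h n j l * h `^ (b - al * l%:R)) *
     Esin (al * l%:R - b) n%:R r th) +i*
  (\sum_(l < j.+1) (wright_coef r h n j l * h `^ (b - al * l%:R)) *
     Ecos (al * l%:R - b) n%:R r th).
Proof.
move=> /andP[r0 r1] h0 z; have r1' : `|r| < 1 by rewrite gtr0_norm.
have zn : z != 0.
  by rewrite /z mulf_neq0 ?cis_neq0// (inj_eq (@complexI R)) gt_eqF.
rewrite /z !cpow_circle// -/z polarV.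
have -> y : (z ^+ n.+1)^-1 * y * (0 +i* 1) * z = y * ('i%C * (z ^+ n)^-1).
  by rewrite exprSr; field; rewrite expf_neq0.
have -> : (z ^+ n)^-1 = ((r ^+ n)^-1)%:C * cis (- (n%:R * th)).
  by rewrite /z exprMn invfM cisX cisV -rmorphXn/= -fmorphV/=.
rewrite exprDn mulr_suml mulr_suml.
apply: (etrans _ (sum_complex
  (fun l => - (wright_coef r h n j l * h `^ (b - al * l%:R)) * Esin (al * l%:R - b) n%:R r th)
  (fun l => wright_coef r h n j l * h `^ (b - al * l%:R) * Ecos (al * l%:R - b) n%:R r th) _)).
apply: eq_bigr => l _.
set L := plog r th - ln h; set A := parg r th.
rewrite expr1n mul1r -mulNr exprMn polarX -mulr_natl.
have := @polar_circle r th h (al * l%:R - b) n h0; rewrite opprB polarD -/L -/A.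
set p := polar L A _; set q := polar L A _ => e.
rewrite (_ : _ * _ * q * _ = 'i%C * (wright_coef r h n j l)%:C *
    (p * q * cis (- (n%:R * th)))); last first.
  rewrite /wright_coef !rmorphM/= rmorphXn/= rmorphN/= -(rmorph_nat (real_complex R)).
  by ring.
rewrite e; apply/eqP; rewrite eq_complex /=; apply/andP; split; apply/eqP; ring.
Qed.

(** The j-th power is expanded, so that each summand is a single power of
    1 - z. The Esin parts integrate to 0, and multiplication by i of dz = i z
    d(th) moves the Ecos parts to the imaginary part, where division by 2 pi i
    makes the result real. *)
Theorem discrete_wrightE (r h al b : R) n j : 0 < r < 1 -> 0 < h ->
  discrete_wright r h al b n j =
  (\sum_(l < j.+1) 'C(j, l)%:R * (- h) ^+ l * h `^ (b - al * l%:R) *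
     bcoef (b - al * l%:R) n)%:C.
Proof.
move=> r01 h0; have /andP[r0 r1] := r01; have r1' : `|r| < 1 by rewrite gtr0_norm.
rewrite /discrete_wright /circle_integral.
rewrite (cintegral_split _ (fun th => contour_integrand al b th n j r01 h0)).
rewrite (@Rintegral_turn_sum (fun l => Esin (al * l%:R - b) n%:R r)
   (fun l => - (wright_coef r h n j l * h `^ (b - al * l%:R)))); last first.
  by move=> i th; exact: continuous_Esin.
rewrite (@Rintegral_turn_sum (fun l => Ecos (al * l%:R - b) n%:R r)
   (fun l => wright_coef r h n j l * h `^ (b - al * l%:R))); last first.
  by move=> i th; exact: continuous_Ecos.
rewrite big1; last first.
  by move=> l _; rewrite -/(Isin (al * l%:R - b) n%:R r) Isin_eq0// mulr0.
have pi0 : (2 * pi : R) != 0 by rewrite gt_eqF// mulr_gt0// pi_gt0.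
under eq_bigr do rewrite -/(Icos _ n%:R r) Icos_bcoef// opprB.
rewrite (_ : \sum_(i < _) _ = 2 * pi * \sum_(l < j.+1) 'C(j, l)%:R * (- h) ^+ l *
  h `^ (b - al * l%:R) * bcoef (b - al * l%:R) n); last first.
  rewrite mulr_sumr; apply: eq_bigr => l _; rewrite /wright_coef.
  by field; rewrite expf_neq0// gt_eqF.
move: (\sum_(l < _) _) => S.
have -> : 0 +i* (2 * pi * S) = (2 * pi)%:C * (0 +i* 1) * S%:C :> R[i].
  by apply/eqP; rewrite eq_complex /=; apply/andP; split; apply/eqP; ring.
rewrite mulKf// mulf_neq0//; first by rewrite (inj_eq (@complexI R)).
by rewrite eq_complex /= oner_eq0 andbF.
Qed.

Lemma bin_bin m d i : (i <= d)%N ->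
  ('C(m + d, m + i) * 'C(m + i, m) = 'C(m + d, m) * 'C(d, i))%N.
Proof.
move=> id; apply/eqP.
have p : (0 < m`! * (i`! * (d - i)`!))%N by rewrite !muln_gt0 !fact_gt0.
rewrite -(eqn_pmul2r p); apply/eqP.
have := @bin_fact (m + d) (m + i); rewrite leq_add2l subnDl => /(_ id) e1.
have := @bin_fact (m + i) m; rewrite leq_addr addKn => /(_ isT) e2.
have := @bin_fact (m + d) m; rewrite leq_addr addKn => /(_ isT) e3.
have e4 := bin_fact id.
transitivity (m + d)`!%N.
  by rewrite -e1 -e2 !mulnA.
by rewrite -e3 -e4 -!mulnA; congr (_ * _)%N; rewrite mulnCA.
Qed.

(** Since C(j, l) C(l, m) = C(j, m) C(j - m, l - m), what remains is the
    binomial theorem for the exponent j - m. *)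
Lemma sum_binomial_product (w : R) j m :
  \sum_(l < j.+1) ('C(j, l)%:R * 'C(l, m)%:R * (- w) ^+ l) =
  'C(j, m)%:R * (- w) ^+ m * (1 - w) ^+ (j - m).
Proof.
case: (ltnP j m) => [jm|mj].
  rewrite big1 ?bin_small ?mul0r// => l _.
  by rewrite (@bin_small l m) ?mulr0 ?mul0r//; have := ltn_ord l; lia.
have [d ->] : exists d, j = (m + d)%N by exists (j - m)%N; rewrite subnKC.
rewrite -addnS big_split_ord/= big1 ?add0r => [|l _]; last first.
  by rewrite (@bin_small l m) ?ltn_ord// mulr0 mul0r.
rewrite addKn exprDn mulr_sumr; apply: eq_bigr => i _.
rewrite -natrM bin_bin; last by rewrite -ltnS.
rewrite natrM expr1n mul1r exprD -[X in _ = _ * X]mulr_natl.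
by rewrite mulrACA.
Qed.

(** The Newton expansion of the Taylor coefficients has a length independent
    of l, so the sum over l can be done first; it collapses to a power of
    1 - h^(1 - al). *)
Theorem discrete_wright_newton (r h al : R) n j : 0 < r < 1 -> 0 < h ->
  discrete_wright r h al (1 - al) n j =
  (h `^ (1 - al) * \sum_(m < n.+1) newton al (1 - al) m n * h `^ (1 - al) ^+ m *
     ('C(j, m)%:R * (1 - h `^ (1 - al)) ^+ (j - m)))%:C.
Proof.
move=> r01 h0; rewrite discrete_wrightE//; congr (_%:C).
set w := h `^ (1 - al).
have hl l : (- h) ^+ l * h `^ (1 - al - al * l%:R) = w * (- w) ^+ l.
  have hn : h != 0 by rewrite gt_eqF.
  have e : w ^+ l = h ^+ l * h `^ (- (al * l%:R)).
    rewrite -!powR_mulrn ?(ltW h0) ?powR_ge0// -powRrM -powRD ?hn ?implybT//.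
    by congr (_ `^ _); ring.
  rewrite powRD ?hn ?implybT// -/w -[- h]mulN1r -[- w]mulN1r !exprMn e; ring.
transitivity (\sum_(l < j.+1) \sum_(m < n.+1) w * (newton al (1 - al) m n * (-1) ^+ m *
   ('C(j, l)%:R * 'C(l, m)%:R * (- w) ^+ l))).
  apply: eq_bigr => l _; rewrite -(mulrA 'C(j, l)%:R) hl bcoef_newton_trunc mulr_sumr.
  by apply: eq_bigr => m _; ring.
rewrite exchange_big mulr_sumr; apply: eq_bigr => m _.
rewrite -mulr_sumr -mulr_sumr; congr (w * _).
rewrite sum_binomial_product -[- w]mulN1r exprMn mulN1r.
have : (-1) ^+ m * (-1) ^+ m = 1 :> R by rewrite -exprMn mulrNN mulr1 expr1n.
move: ((-1) ^+ m) => e ee.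
move: (newton _ _ _ _) (w ^+ m) ('C(j, m)%:R) ((1 - w) ^+ (j - m)) => x y c v.
by rewrite (_ : x * e * _ = (e * e) * (x * y * (c * v))); [rewrite ee mul1r|ring].
Qed.

End contour.
(** * Real series and integrands seen in the complex plane *)

Section real_in_complex.
Context {R : realType}.
Implicit Types (u : nat -> R).

Lemma normC_real (x : R) : `|x%:C| = `|x|%:C :> R[i].
Proof. by rewrite normc_def /= expr0n addr0 sqrtr_sqr. Qed.

Lemma cvg_real_complex u (l : R) : u @ \oo --> l ->
  (fun k => (u k)%:C : R[i]^o) @ \oo --> (l%:C : R[i]^o).
Proof.
move=> ul; apply/cvgrPdist_lt => e e0.
have /andP[/eqP ei er] : (complex.Im e == 0) && (0 < complex.Re e).
  by move: e0; rewrite ltcE /= eq_sym.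
have /cvgrPdist_lt/(_ _ er) := ul; apply: filterS => k hk.
by rewrite -rmorphB/= normC_real ltcE /= ei eqxx hk.
Qed.

Lemma cvg_complex_Re (u : nat -> R[i]) (l : R[i]) : (u : nat -> R[i]^o) @ \oo --> (l : R[i]^o) ->
  (fun k => complex.Re (u k)) @ \oo --> complex.Re l.
Proof.
move=> ul; apply/cvgrPdist_lt => e e0.
have e0' : 0 < e%:C :> R[i] by rewrite ltcR.
have /cvgrPdist_lt/(_ _ e0') := ul; apply: filterS => k hk.
rewrite -ltcR; apply: le_lt_trans hk.
have := normc_ge_Re (l - u k); by case: (l) (u k) => [a b] [c d].
Qed.

Lemma series_real_complex u :
  series (fun k => (u k)%:C : R[i]^o) = (fun k => (series u k)%:C : R[i]^o).
Proof.
apply/funext => k; rewrite /series /=.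
by rewrite -(@raddf_sum _ _ (real_complex R)).
Qed.

(** Real parts are continuous, so convergence in the complex plane descends to
    the reals. *)
Lemma cseries_cvg_real u : cseries_cvg (fun k => (u k)%:C) <-> cvgn (series u).
Proof.
rewrite /cseries_cvg series_real_complex; split => h.
  by apply/cvg_ex; exists (complex.Re (lim ((fun k => (series u k)%:C : R[i]^o) @ \oo)));
    exact: (@cvg_complex_Re (fun k => (series u k)%:C) _ h).
by apply/cvg_ex; exists (limn (series u))%:C; exact: cvg_real_complex.
Qed.

Lemma cseries_sum_real u : cvgn (series u) ->
  cseries_sum (fun k => (u k)%:C) = (limn (series u))%:C.
Proof.
move=> h; rewrite /cseries_sum series_real_complex.
exact: (@cvg_lim R[i]^o (@norm_hausdorff _ R[i]^o) _ _ _ _ _ (cvg_real_complex h)).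
Qed.

End real_in_complex.

Section real_integrand.
Context {R : realType} (al : R) (al01 : 0 < al < 1).

(** The powers of s from the prefactor and from the m-th power of the argument
    combine into the single power s^(- al (m + 1)). *)
Lemma scaled_wright_wfun (t s : R) : 0 <= t -> 0 < s ->
  scaled_wright al (1 - al) s t%:C = (wfun al t s)%:C.
Proof.
move=> t0 s0; have sn : s != 0 by rewrite gt_eqF.
rewrite /scaled_wright /wright.
pose v m : R := wfun_term al t s m * s `^ al.
have -> : (fun m : nat => (- t%:C * (s `^ (- al))%:C) ^+ m *
    ((m`!%:R)^-1 * (Gamma (- al * m%:R + (1 - al)))^-1)%:C) = (fun m => (v m)%:C).
  apply/funext => m; rewrite -rmorphN/= -rmorphM/= -rmorphXn/= -rmorphM/=.
  congr (_%:C); rewrite /v /wfun_term exprMn -[(s `^ _) ^+ m]powR_mulrn ?powR_ge0//.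
  rewrite -powRrM.
  (* The prefactor s^(1 - al - 1) contributes the missing power s^(- al). *)
  have -> : - al * m%:R = - wexp al m + al by rewrite /wexp -natr1; ring.
  rewrite powRD ?sn ?implybT//.
  have -> : - wexp al m + al + (1 - al) = 1 - wexp al m by ring.
  by ring.
have c := is_cvg_wfun al01 t0 s0.
have cv := @cvg_seriesZr R _ (s `^ al) c.
rewrite (cseries_sum_real (cvgP _ cv)) (cvg_lim _ cv)//.
rewrite -rmorphM/= -/(wfun al t s); congr (_%:C).
rewrite mulrCA -powRD ?sn ?implybT// (_ : 1 - al - 1 + al = 0) ?powRr0 ?mulr1//.
by ring.
Qed.

Lemma subord_integrand_real (N n : nat) (h : R) (x : 'rV[R]_N) (s t : R) :
  0 <= t -> 0 < s ->
  subord_integrand al n h x s t = (wmoment al t h n.-1 s * gauss t x)%:C.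
Proof.
move=> t0 s0; rewrite /subord_integrand scaled_wright_wfun// -!rmorphM/=.
by rewrite /wmoment (mulrC s).
Qed.

End real_integrand.

(** * Abel summation and growth of binomial sums *)

Section abel.
Context {R : realType}.
Implicit Types (a : nat -> R) (S r : R).

(** Summation by parts, centred at the expected limit S. *)
Lemma abel_summation a S r J :
  series (fun j => a j * r ^+ j) J - S =
  (1 - r) * (\sum_(j < J) (series a j.+1 - S) * r ^+ j) + (series a J - S) * r ^+ J.
Proof.
elim: J => [|J IH].
  by rewrite /series /= !big_geq// big_ord0 expr0; ring.
rewrite seriesSr addrAC IH big_ord_recr/= !seriesSr exprS; ring.
Qed.

Lemma geometric_le r J : 0 <= r < 1 -> (1 - r) * (\sum_(j < J) r ^+ j) <= 1.
Proof.
move=> /andP[r0 r1]; have -> : (1 - r) * (\sum_(j < J) r ^+ j) = 1 - r ^+ J.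
  elim: J => [|J IH]; first by rewrite big_ord0 mulr0 expr0 subrr.
  by rewrite big_ord_recr/= mulrDr IH exprS; ring.
by rewrite gerBl exprn_ge0.
Qed.

(** The partial sums beyond K are within e of S and carry a total weight at
    most 1; the first K ones are damped by the factor 1 - r. *)
Lemma abel_bound a S r F e K : 0 <= r < 1 -> 0 <= e ->
  series a n @[n --> \oo] --> S ->
  series (fun j => a j * r ^+ j) n @[n --> \oo] --> F ->
  (forall j, (K <= j)%N -> `|series a j.+1 - S| <= e) ->
  `|F - S| <= (1 - r) * (\sum_(j < K) `|series a j.+1 - S|) + e.
Proof.
move=> r01 e0 aS aF small; have /andP[r0 r1] := r01.
have c : `|series (fun j => a j * r ^+ j) n - S - (series a n - S) * r ^+ n|
    @[n --> \oo] --> `|F - S - (S - S) * 0|.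
  apply: cvg_norm; apply: cvgB; first by apply: cvgB => //; exact: cvg_cst.
  apply: cvgM; first by apply: cvgB => //; exact: cvg_cst.
  by apply: cvg_expr; rewrite ger0_norm.
rewrite subrr mul0r subr0 in c.
rewrite -(cvg_lim _ c)//; apply: limr_le; first exact: cvgP c.
near=> n; have Kn : (K <= n)%N by near: n; exists K.
rewrite abel_summation addrK normrM ger0_norm ?subr_ge0 ?(ltW r1)//.
apply: le_trans (_ : (1 - r) * (\sum_(j < K) `|series a j.+1 - S| + e * \sum_(j < n) r ^+ j) <= _).
  apply: ler_wpM2l; first by rewrite subr_ge0 ltW.
  apply: le_trans (ler_norm_sum _ _ _) _.
  rewrite -(subnKC Kn) !big_split_ord/=; apply: lerD.
    apply: ler_sum => j _; rewrite normrM ler_piMr// normrX ger0_norm// exprn_ile1// ltW//.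
  rewrite mulrDr -[leLHS]add0r; apply: lerD.
    by rewrite mulr_ge0// sumr_ge0// => j _; rewrite exprn_ge0.
  rewrite mulr_sumr; apply: ler_sum => j _; rewrite normrM ler_pM//.
    by apply: small; rewrite leq_addr.
  by rewrite normrX ger0_norm.
rewrite mulrDr lerD2l mulrCA ler_piMr// geometric_le//.
Unshelve. all: by end_near. Qed.

Theorem abel_limit a S (r F : nat -> R) :
  series a n @[n --> \oo] --> S -> (forall k, 0 <= r k < 1) -> r k @[k --> \oo] --> (1 : R) ->
  (forall k, series (fun j => a j * r k ^+ j) n @[n --> \oo] --> F k) ->
  F k @[k --> \oo] --> S.
Proof.
move=> aS r01 r1 aF; apply/cvgrPdist_le => e e0.
have e2 : 0 < e / 2 by rewrite divr_gt0.
have [K _ small] : \forall j \near \oo, `|series a j.+1 - S| <= e / 2.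
  have : series a j.+1 @[j --> \oo] --> S by rewrite cvg_shiftS.
  by move/cvgrPdist_le => /(_ _ e2); apply: filterS => j; rewrite distrC.
set B := \sum_(j < K) `|series a j.+1 - S|.
have : (1 - r k) * B @[k --> \oo] --> ((1 : R) - 1) * B.
  by apply: cvgM; [apply: cvgB => //; exact: cvg_cst|exact: cvg_cst].
rewrite subrr mul0r => /cvgrPdist_le => /(_ _ e2); apply: filterS => k.
rewrite sub0r normrN => h.
rewrite distrC; apply: le_trans (abel_bound (r01 k) (ltW e2) aS (aF k) _) _.
  by move=> j; exact: small.
rewrite -/B [leRHS](splitr e) lerD2r; exact: le_trans (ler_norm _) h.
Qed.

(** Taking differences in j lowers the index of every binomial coefficient by
    1 and preserves the limit 0, so the claim reduces to a constant
    sequence. *)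
Lemma binomial_cvg0 (c : nat -> R) k :
  \sum_(m < k.+1) c m * 'C(j, m)%:R @[j --> \oo] --> (0 : R) -> c k = 0.
Proof.
elim: k c => [|k IH] c h.
  have e : (fun j : nat => \sum_(m < 1) c m * 'C(j, m)%:R) = (fun=> c 0%N).
    by apply/funext => j; rewrite big_ord1 bin0 mulr1.
  rewrite e in h.
  exact: (@cvg_unique _ (@Rhausdorff R) _ _ (c 0%N) _ (cvg_cst _) h).
apply: (IH (fun m => c m.+1)).
pose F j : R := \sum_(m < k.+2) c m * 'C(j, m)%:R.
have h1 : F j.+1 @[j --> \oo] --> (0 : R) by rewrite cvg_shiftS.
have h2 : (fun j => F j.+1 - F j) @ \oo --> (0 : R).
  by rewrite -[X in _ --> X](subrr 0); exact: cvgB.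
rewrite (_ : (fun j => F j.+1 - F j) =
  (fun j => \sum_(m < k.+1) c m.+1 * 'C(j, m)%:R)) in h2; first exact: h2.
apply/funext => j; rewrite -sumrB big_ord_recl/= !bin0 subrr add0r; apply: eq_bigr => m _.
by rewrite /bump leq0n add1n binS natrD; ring.
Qed.

End abel.

Section exponential.
Context {R : realType}.

Lemma exp_binomial_le (q Y : R) m J : 0 <= Y ->
  `|series (fun j => 'C(j, m)%:R * q ^+ (j - m) * (Y ^+ j / j`!%:R)) J| <=
  Y ^+ m / m`!%:R * expR (`|q| * Y).
Proof.
move=> Y0; have c := @exp_binomial_cvg R `|q| Y m.
rewrite -(cvg_lim _ c)//.
apply: le_trans (nondecreasing_cvgn_le _ (cvgP _ c) J); last first.
  apply/nondecreasing_seqP => j; rewrite seriesSr lerDl.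
  by rewrite mulr_ge0 ?divr_ge0 ?exprn_ge0// mulr_ge0 ?exprn_ge0.
apply: le_trans (ler_norm_sum _ _ _) _; rewrite /series/=; apply: ler_sum => j _.
rewrite !normrM normfV !normrX !normr_nat ler_wpM2l ?mulr_ge0 ?exprn_ge0//.
by rewrite (ger0_norm Y0).
Qed.

End exponential.

(** * Weighted gamma averages of a bounded kernel *)

Section kernel.
Context {R : realType}.
Notation mu := (@lebesgue_measure R).
Notation ray := (`]0%R, +oo[%classic : set R).
Context (g : R -> R) (M lam : R) (mg : measurable_fun ray g)
  (g0 : forall t, 0 < t -> 0 <= g t) (gM : forall t, 0 < t -> g t <= M)
  (lam0 : 0 < lam).
Implicit Types (q rho t c C : R) (e : nat -> R).

Lemma ray_gt0 t : ray t -> 0 < t.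
Proof. by rewrite /= in_itv/= andbT. Qed.

Lemma integrable_scale (f : R -> R) c : mu.-integrable ray (EFin \o f) ->
  mu.-integrable ray (EFin \o (fun t => c * f t)).
Proof.
move=> hf; have := integrableZl (@measurable_ray R) c hf.
by apply: (eq_integrable (@measurable_ray R)) => t _; rewrite /= EFinM.
Qed.

(** All integrands in t below are exponentially small at infinity and bounded
    near 0. *)
Lemma integrable_expR_dominated (F : R -> R) c C : 0 < c ->
  measurable_fun ray F -> (forall t : R, 0 < t -> `|F t| <= C * expR (- (c * t))) ->
  mu.-integrable ray (EFin \o F).
Proof.
move=> c0 mF bF; have iE := integrableZl (@measurable_ray R) C (integrable_expRN c0).
apply: (le_integrable (@measurable_ray R)) iE; first exact/measurable_EFinP.
move=> t /ray_gt0 t0; rewrite /= lee_fin; apply: le_trans (bF t t0) _.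
exact: ler_norm.
Qed.

(** The density of the gamma distribution of shape j + 1 and rate lam, up to
    the factor lam, times the kernel g. *)
Definition pulse (j : nat) t : R := expR (- (lam * t)) * ((lam * t) ^+ j / j`!%:R) * g t.

(** The mean of g under the gamma distribution of shape j + 1 and rate lam. *)
Definition kmean (j : nat) : R := lam * \int[mu]_(t in ray) pulse j t.

Lemma measurable_poly_term (j : nat) (D : set R) :
  measurable_fun D (fun t : R => (lam * t) ^+ j / j`!%:R).
Proof.
apply: measurable_funTS; apply: measurable_funM; last exact: measurable_cst.
by apply: measurable_funX; apply: measurable_funM.
Qed.

Lemma measurable_pulse j : measurable_fun ray (pulse j).
Proof.
apply: measurable_funM => //; apply: measurable_funM; first exact: measurable_expRN.
exact: measurable_poly_term.
Qed.

Lemma pow_fact_le (d y : R) m : 0 < d -> 0 <= y ->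
  y ^+ m / m`!%:R <= (d ^+ m)^-1 * expR (d * y).
Proof.
move=> d0 y0; rewrite -ler_pdivrMl ?invr_gt0 ?exprn_gt0// invrK mulrA -exprMn.
by apply: pow_le_fact_expR; rewrite mulr_ge0// ltW.
Qed.

Lemma integrable_pulse j : mu.-integrable ray (EFin \o pulse j).
Proof.
apply: (@integrable_expR_dominated _ (lam / 2) ((2^-1 ^+ j)^-1 * M)) => [||t t0].
- by rewrite divr_gt0.
- exact: measurable_pulse.
have lt0 : 0 <= lam * t by rewrite mulr_ge0// ltW.
rewrite ger0_norm; last first.
  by rewrite mulr_ge0 ?g0// mulr_ge0 ?expR_ge0// divr_ge0 ?exprn_ge0.
rewrite /pulse (_ : _ * M * _ = expR (- (lam * t)) *
   ((2^-1 ^+ j)^-1 * expR (2^-1 * (lam * t))) * M); last first.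
  rewrite (_ : - (lam / 2 * t) = - (lam * t) + 2^-1 * (lam * t)); last by field.
  by rewrite expRD; ring.
have p := @pow_fact_le 2^-1 (lam * t) j.
apply: ler_pM; [by rewrite mulr_ge0 ?expR_ge0// divr_ge0 ?exprn_ge0|exact: g0| |exact: gM].
by rewrite ler_wpM2l ?expR_ge0// p// invr_gt0.
Qed.

(** For w = h^(1 - al), q = 1 - w and e m = newton al (1 - al) m k w^m, this
    is the discrete Wright function divided by w. *)
Definition mixweight (e : nat -> R) q (k j : nat) : R :=
  \sum_(m < k.+1) e m * ('C(j, m)%:R * q ^+ (j - m)).

(** The sum over j of mixweight j rho^j times the pulses; the radius rho is
    there for Abel means. *)
Definition mixture (e : nat -> R) q rho (k : nat) t : R :=
  expR (- (lam * t)) * (\sum_(m < k.+1) e m *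
    ((rho * lam * t) ^+ m / m`!%:R * expR (q * (rho * lam * t)))) * g t.

Lemma measurable_mixture e q rho k : measurable_fun ray (mixture e q rho k).
Proof.
apply: measurable_funM => //; apply: measurable_funM; first exact: measurable_expRN.
apply: measurable_sum => m; apply: measurable_funM => //; apply: measurable_funM.
  apply: measurable_funTS; apply: measurable_funM; last exact: measurable_cst.
  by apply: measurable_funX; apply: measurable_funM.
apply: measurable_funTS; apply: (measurableT_comp (@measurable_expR R)).
by apply: measurable_funM => //; apply: measurable_funM.
Qed.

Lemma partial_mixture e q rho k J t :
  \sum_(j < J) mixweight e q k j * rho ^+ j * pulse j t =
  expR (- (lam * t)) * (\sum_(m < k.+1) e m *
    series (fun j => 'C(j, m)%:R * q ^+ (j - m) * ((rho * lam * t) ^+ j / j`!%:R)) J) * g t.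
Proof.
rewrite mulr_sumr mulr_suml.
under [RHS]eq_bigr => m _ do rewrite /series/= big_mkord !mulr_sumr mulr_suml.
rewrite exchange_big/=; apply: eq_bigr => j _.
rewrite /mixweight /pulse !mulr_suml; apply: eq_bigr => m _.
have -> : (rho * lam * t) ^+ j = rho ^+ j * (lam * t) ^+ j by rewrite -mulrA exprMn.
by move: ('C(j, m)%:R) (_ ^+ (j - m)) (j`!%:R) => x y z; ring.
Qed.

Lemma partial_mixture_cvg e q rho k t :
  \sum_(j < J) mixweight e q k j * rho ^+ j * pulse j t @[J --> \oo] -->
  mixture e q rho k t.
Proof.
under eq_fun do rewrite partial_mixture.
apply: cvgM; last exact: cvg_cst.
apply: cvgM; first exact: cvg_cst.
apply: cvg_sumr => m _; apply: cvgM; first exact: cvg_cst.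
exact: exp_binomial_cvg.
Qed.

(** For any d > 0 it bounds the polynomial factor by a multiple of e^(d y),
    with d as small as needed to keep an exponential decay. *)
Definition mixbound (e : nat -> R) (d : R) k : R := \sum_(m < k.+1) `|e m| * (d ^+ m)^-1.

Lemma poly_exp_bound e q (d y : R) k (u : nat -> R) : 0 < d -> 0 <= y ->
  (forall m, `|u m| <= y ^+ m / m`!%:R * expR (q * y)) ->
  `|\sum_(m < k.+1) e m * u m| <= mixbound e d k * expR ((q + d) * y).
Proof.
move=> d0 y0 bu; apply: le_trans (ler_norm_sum _ _ _) _.
rewrite mulr_suml; apply: ler_sum => m _; rewrite normrM -mulrA ler_wpM2l//.
apply: le_trans (bu m) _; rewrite mulrDl expRD mulrCA mulrC ler_wpM2l ?expR_ge0//.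
exact: pow_fact_le.
Qed.

Lemma mixture_dominated e (b rho d c t S : R) k : 0 < d -> 0 <= rho <= 1 -> 0 < t ->
  c = lam * (1 - (b + d) * rho) ->
  `|S| <= mixbound e d k * expR ((b + d) * (rho * lam * t)) ->
  `|expR (- (lam * t)) * S * g t| <= mixbound e d k * M * expR (- (c * t)).
Proof.
move=> d0 /andP[r0 r1] t0 -> bS.
rewrite normrM [`|expR _ * _|]normrM ger0_norm ?expR_ge0// (ger0_norm (g0 t0)).
have -> : - (lam * (1 - (b + d) * rho) * t) =
  - (lam * t) + (b + d) * (rho * lam * t) by ring.
rewrite expRD (_ : _ * M * _ = expR (- (lam * t)) * (mixbound e d k *
  expR ((b + d) * (rho * lam * t))) * M); last by ring.
apply: ler_pM; [by rewrite mulr_ge0 ?expR_ge0|exact: g0| |exact: gM].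
by rewrite ler_wpM2l ?expR_ge0.
Qed.

(** For rho = 1 the exponent is - lam (1 - q) t, so only the sign of 1 - q
    matters and |q| may be large; this is the right-hand side of the final
    identity for every h. *)
Lemma integrable_mixture e q k : q < 1 ->
  mu.-integrable ray (EFin \o mixture e q 1 k).
Proof.
move=> q1; pose d : R := (1 - q) / 2.
have d0 : 0 < d by rewrite divr_gt0// subr_gt0.
have c0 : 0 < lam * (1 - (q + d) * 1) by rewrite mulr_gt0// /d; lra.
apply: (integrable_expR_dominated c0 (C := mixbound e d k * M)).
  exact: measurable_mixture.
move=> t t0; apply: (mixture_dominated (b := q) (rho := 1) d0) => //.
  by rewrite ler01 lexx.
apply: (@poly_exp_bound e q d (1 * lam * t) k
  (fun m => (1 * lam * t) ^+ m / m`!%:R * expR (q * (1 * lam * t)))) => //.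
  by rewrite mul1r mulr_ge0// ltW.
have y0 : 0 <= 1 * lam * t by rewrite mul1r mulr_ge0// ltW.
by move=> m; rewrite ger0_norm// mulr_ge0 ?expR_ge0// divr_ge0 ?exprn_ge0.
Qed.

(** Dominated convergence for the partial sums: their absolute values grow at
    most like e^((|q| + d) rho lam t), which the factor e^(- lam t) still
    beats for small d. *)
Lemma mix_series_cvg e q rho k : 0 <= rho <= 1 -> `|q| * rho < 1 ->
  series (fun j => mixweight e q k j * kmean j * rho ^+ j) n @[n --> \oo] -->
  lam * \int[mu]_(t in ray) mixture e q rho k t.
Proof.
move=> rho01 qrho; have /andP[r0 r1] := rho01.
(* Half of the exponential decay left by |q| rho < 1 is spent on the
   polynomial factors. *)
pose d : R := (1 - `|q| * rho) / 2.
have d0 : 0 < d by rewrite divr_gt0// subr_gt0.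
pose c := lam * (1 - (`|q| + d) * rho).
have c0 : 0 < c.
  rewrite mulr_gt0// subr_gt0 mulrDl.
  have : d * rho <= d by rewrite ler_piMr// ltW.
  have : d + d = 1 - `|q| * rho by rewrite /d -splitr.
  lra.
have iE : mu.-integrable ray (EFin \o (fun t => mixbound e d k * M * expR (- (c * t)))).
  by apply: integrable_scale; exact: integrable_expRN.
pose S J t : R := \sum_(j < J) mixweight e q k j * rho ^+ j * pulse j t.
have Y0 t : ray t -> 0 <= rho * lam * t.
  by move=> /ray_gt0 t0; rewrite mulr_ge0 ?(ltW t0)// mulr_ge0// ltW.
have mS J : measurable_fun ray (S J).
  by apply: measurable_sum => j; apply: measurable_funM => //; exact: measurable_pulse.
have [] := @dominated_convergence _ (measurableTypeR R) R mu ray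
  (@measurable_ray R) (fun J => EFin \o S J) (EFin \o mixture e q rho k)
  _ _ _ _ iE.
- by move=> J; apply/measurable_EFinP; exact: mS.
- by apply/measurable_EFinP; exact: measurable_mixture.
- apply: aeW => t _.
  by apply/fine_cvgP; split; [exact: nearW|exact: partial_mixture_cvg].
- apply: aeW => t J rt; rewrite /= lee_fin /S partial_mixture.
  apply: (@mixture_dominated e `|q| rho d c t _ k d0 rho01 (ray_gt0 rt)) => //.
  apply: (@poly_exp_bound e `|q| d (rho * lam * t) k (fun m => series (fun j =>
    'C(j, m)%:R * q ^+ (j - m) * ((rho * lam * t) ^+ j / j`!%:R)) J)) => //.
    exact: Y0.
  by move=> m; apply: exp_binomial_le; exact: Y0.
move=> iM _ h.
have fM : (\int[mu]_(t in ray) (mixture e q rho k t)%:E)%E \is a fin_num.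
  exact: integrable_fin_num.
move: h; rewrite -[X in _ --> X]fineK// => /fine_cvgP[_ h].
have -> : series (fun j => mixweight e q k j * kmean j * rho ^+ j) =
  (fun J => lam * \int[mu]_(t in ray) S J t).
  apply/funext => J; rewrite /series/= big_mkord /Rintegral /S.
  have -> : (fun t => (\sum_(j < J) mixweight e q k j * rho ^+ j * pulse j t)%:E) =
    (fun t => \sum_(j < J) (mixweight e q k j * rho ^+ j * pulse j t)%R%:E)%E.
    by apply/funext => t; rewrite sumEFin.
  have iP j : mu.-integrable ray (EFin \o (fun t => mixweight e q k j * rho ^+ j * pulse j t)).
    by apply: integrable_scale; exact: integrable_pulse.
  rewrite (@integral_sum _ _ _ _ _ (@measurable_ray R) _
    (fun (j : 'I_J) t => (mixweight e q k j * rho ^+ j * pulse j t)%R%:E)); last by move=> j; exact (iP j).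
  rewrite -sum_fine; last first.
    by move=> j _; exact (integrable_fin_num (@measurable_ray R) (iP j)).
  rewrite mulr_sumr; apply: eq_bigr => j _.
  rewrite -/(Rintegral _ _ _) RintegralZl; [|exact: measurable_ray|exact: integrable_pulse].
  by rewrite /kmean; ring.
by apply: cvgM => //; exact: cvg_cst.
Qed.

End kernel.

Section unit_kernel.
Context {R : realType}.
Notation mu := (@lebesgue_measure R).
Notation ray := (`]0%R, +oo[%classic : set R).

(** Gamma densities have mass 1. The generating function of the masses is the
    integral of e^(- (1 - z) lam t), that is, the geometric series. *)
Lemma kmean1 (lam : R) j : 0 < lam -> kmean (fun=> 1) lam j = 1.
Proof.
move=> lam0; move: j; apply: (@pseries_inj R _ _ (fun z => (1 - z)^-1)) => z /andP[z0 z1].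
- have h := @mix_series_cvg R (fun=> 1) 1 lam (measurable_cst _) (fun _ _ => ler01)
    (fun _ _ => lexx _) lam0 (fun=> 1) 1 z 0.
  have e : (fun j => mixweight (fun=> 1) 1 0 j * kmean (fun=> 1) lam j * z ^+ j) =
      (fun j => kmean (fun=> 1) lam j * z ^+ j).
    by apply/funext => j; rewrite /mixweight big_ord1 bin0 subn0 expr1n !mul1r.
  rewrite e in h; rewrite /pseries.
  rewrite (_ : (1 - z)^-1 = lam * \int[mu]_(t in ray) mixture (fun=> 1) lam (fun=> 1) 1 z 0 t).
    by apply: h; rewrite ?ltW//= normr1 mul1r.
  have z1' : 0 < 1 - z by rewrite subr_gt0.
  have := @integral_expRN R (lam * (1 - z)) (mulr_gt0 lam0 z1') => H.
  rewrite (_ : \int[mu]_(t in ray) _ = (lam * (1 - z))^-1).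
    by field; rewrite ?gt_eqF// mulr_gt0.
  apply: (etrans _ (congr1 fine H)); rewrite /Rintegral; congr fine.
  apply: eq_integral => t _; congr (_%:E).
  rewrite /mixture big_ord1 fact0 expr0 divr1 !mul1r mulr1 -expRD; congr expR; ring.
- rewrite /pseries.
  have : `|z| < 1 by rewrite gtr0_norm.
  move/(@cvg_geometric_series R 1 z); rewrite mul1r /geometric; exact.
Qed.

End unit_kernel.

Section kernel_limit.
Context {R : realType}.
Notation mu := (@lebesgue_measure R).
Notation ray := (`]0%R, +oo[%classic : set R).
Context (g : R -> R) (M lam : R) (mg : measurable_fun ray g)
  (g0 : forall t : R, 0 < t -> 0 <= g t) (gM : forall t : R, 0 < t -> g t <= M)
  (lam0 : 0 < lam).
Implicit Types (q rho t c C p : R) (e : nat -> R).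

Lemma kmean_ge0 j : 0 <= kmean g lam j.
Proof.
apply: mulr_ge0; first exact: ltW.
apply: Rintegral_ge0 => t /ray_gt0 t0.
by apply: mulr_ge0; [rewrite mulr_ge0 ?expR_ge0// divr_ge0// exprn_ge0// mulr_ge0// ltW|exact: g0].
Qed.

(** Where t >= 1 the kernel is bounded below by an exponential, which turns
    the pulse into a pulse of rate p lam. The part of that pulse over ]0, 1]
    is removed by subtracting a multiple of e^(1 - t), larger than it there;
    the subtracted quantity is negligible because of the factorial. *)
Lemma kmean_lower c p j : 0 < c -> 1 < p ->
  (forall t, 1 <= t -> c * expR (- ((p - 1) * lam * t)) <= g t) ->
  c * (p^-1 - lam * expR 1 * ((p * lam) ^+ j / j`!%:R)) <= p ^+ j * kmean g lam j.
Proof.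
move=> c0 p1 gL; have p0 : 0 < p by rewrite (lt_trans _ p1).
have pl0 : 0 < p * lam by rewrite mulr_gt0.
pose F t : R := c * pulse (fun=> 1) (p * lam) j t +
  - (c * expR 1 * ((p * lam) ^+ j / j`!%:R)) * expR (- (1 * t)).
have iU : mu.-integrable ray (EFin \o (fun t => c * pulse (fun=> 1) (p * lam) j t)).
  apply: integrable_scale.
  exact: (@integrable_pulse R (fun=> 1) 1 (p * lam) (measurable_cst _) (fun _ _ => ler01)
    (fun _ _ => lexx _) pl0).
have iV : mu.-integrable ray (EFin \o (fun t =>
    - (c * expR 1 * ((p * lam) ^+ j / j`!%:R)) * expR (- (1 * t)))).
  by apply: integrable_scale; exact: integrable_expRN.
have iF : mu.-integrable ray (EFin \o F).
  apply: (eq_integrable (@measurable_ray R)) (integrableD (@measurable_ray R) iU iV).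
  by move=> t _; rewrite /= EFinD.
have iP : mu.-integrable ray (EFin \o (fun t => p ^+ j * pulse g lam j t)).
  apply: integrable_scale; exact: (integrable_pulse mg g0 gM lam0 j).
have le : \int[mu]_(t in ray) F t <= \int[mu]_(t in ray) (p ^+ j * pulse g lam j t).
  apply: (le_Rintegral (@measurable_ray R) iF iP) => t /ray_gt0 t0; rewrite /F /pulse mul1r.
  set A := (p * lam) ^+ j / j`!%:R.
  have A0 : 0 <= A by rewrite divr_ge0// exprn_ge0// ltW.
  have t0' : 0 <= t ^+ j by rewrite exprn_ge0// ltW.
  have -> : p ^+ j * (expR (- (lam * t)) * ((lam * t) ^+ j / j`!%:R) * g t) =
      expR (- (lam * t)) * g t * (t ^+ j * A).
    by rewrite /A !exprMn; ring.
  have -> : c * (expR (- (p * lam * t)) * ((p * lam * t) ^+ j / j`!%:R) * 1) +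
      - (c * expR 1 * A) * expR (- t) =
      c * (expR (- (p * lam * t)) * (t ^+ j * A) - expR (1 - t) * A).
    by rewrite /A [(p * lam * t) ^+ j]exprMn expRD; ring.
  have [t1|t1] := leP 1 t.
    apply: le_trans (_ : c * expR (- (p * lam * t)) * (t ^+ j * A) <= _).
      by rewrite -[leRHS]mulrA ler_pM2l// gerBl mulr_ge0 ?expR_ge0.
    apply: ler_wpM2r; first by rewrite mulr_ge0.
    rewrite (_ : - (p * lam * t) = - (lam * t) + - ((p - 1) * lam * t)); last by ring.
    by rewrite expRD mulrCA ler_wpM2l ?expR_ge0// gL.
  apply: le_trans (_ : 0 <= _); last first.
    by apply: mulr_ge0; apply: mulr_ge0; rewrite ?expR_ge0 ?g0.
  rewrite pmulr_rle0// subr_le0 mulrA ler_wpM2r//; apply: le_trans (_ : 1 <= _).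
    apply: mulr_ile1; rewrite ?expR_ge0//.
      by rewrite -expR0 ler_expR oppr_le0 mulr_ge0// ltW.
    by rewrite exprn_ile1// ltW.
  by rewrite -[leLHS]expR0 ler_expR subr_ge0 ltW.
move: le; rewrite RintegralZl; [|exact: measurable_ray|exact: (integrable_pulse mg g0 gM lam0 j)].
rewrite /F RintegralD//.
rewrite RintegralZl; [|exact: measurable_ray|]; last first.
  exact: (@integrable_pulse R (fun=> 1) 1 (p * lam) (measurable_cst _) (fun _ _ => ler01)
    (fun _ _ => lexx _) pl0).
rewrite RintegralZl; [|exact: measurable_ray|exact: integrable_expRN].
have -> : \int[mu]_(t in ray) expR (- (1 * t)) = 1.
  by rewrite /Rintegral integral_expRN// invr1.
have k1 := kmean1 j pl0.
have -> : \int[mu]_(t in ray) pulse (fun=> 1) (p * lam) j t = (p * lam)^-1.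
  by apply: (mulfI (lt0r_neq0 pl0)); rewrite -/(kmean (fun=> 1) (p * lam) j) k1 mulfV// gt_eqF.
move=> le; rewrite /kmean [leRHS]mulrCA.
apply: le_trans (ler_wpM2l (ltW lam0) le).
rewrite le_eqVlt; apply/orP; left; apply/eqP; field.
by rewrite !gt_eqF// factr_gt0.
Qed.

(** The terms are q^j kmean j times a polynomial in j with leading coefficient
    proportional to e k. With p = - q the factor p^j kmean j stays away from
    0, so if the terms vanish in the limit then so does the polynomial. *)
Lemma mix_series_diverges e q k c : q < -1 -> 0 < c ->
  (forall t, 1 <= t -> c * expR (- ((- q - 1) * lam * t)) <= g t) ->
  cvgn (series (fun j => mixweight e q k j * kmean g lam j)) -> e k = 0.
Proof.
move=> q1 c0 gL cv; set p := - q in gL; have p1 : 1 < p by rewrite /p; lra.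
have p0 : 0 < p by rewrite (lt_trans _ p1).
have q0 : q != 0 by rewrite lt_eqF//; lra.
have a0 : mixweight e q k j * kmean g lam j @[j --> \oo] --> (0 : R) := cvg_series_cvg_0 cv.
have : c * (p^-1 - lam * expR 1 * ((p * lam) ^+ j / j`!%:R)) @[j --> \oo] -->
    c * (p^-1 - lam * expR 1 * 0).
  apply: cvgM; first exact: cvg_cst.
  apply: cvgB; first exact: cvg_cst.
  apply: cvgM; first exact: cvg_cst.
  exact: cvg_exp_coeff.
rewrite mulr0 subr0 => low.
have cp : 0 < c * p^-1 / 2 by rewrite divr_gt0// divr_gt0.
have ev : \forall j \near \oo, c * p^-1 / 2 <= p ^+ j * kmean g lam j.
  have /cvgrPdist_le/(_ _ cp) := low; apply: filterS => j.
  rewrite ler_norml => /andP[_ h]; apply: le_trans (kmean_lower j c0 p1 gL).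
  move: h; rewrite (_ : c / p = c / p / 2 + c / p / 2); last by rewrite -splitr.
  lra.
suff : e k * q ^- k = 0.
  by move/eqP; rewrite mulf_eq0 invr_eq0 expf_eq0 (negPf q0) andbF orbF => /eqP.
apply: (@binomial_cvg0 R (fun m => e m * q ^- m)).
(* The polynomial in j that remains once q^j is factored out of the
   weight. *)
pose P j : R := \sum_(m < k.+1) e m * q ^- m * 'C(j, m)%:R.
have PE j : mixweight e q k j = q ^+ j * P j.
  rewrite /mixweight /P mulr_sumr; apply: eq_bigr => m _.
  have [jm|mj] := ltnP j m; first by rewrite bin_small// !(mul0r, mulr0).
  have -> : q ^+ j = q ^+ (j - m) * q ^+ m by rewrite -exprD subnK.
  move: ('C(j, m)%:R) (q ^+ (j - m)) => x y; field; rewrite expf_neq0//.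
apply/cvgrPdist_le => eps eps0.
have ec : 0 < eps * (c * p^-1 / 2) by rewrite mulr_gt0.
have /cvgrPdist_le/(_ _ ec) := a0; apply: filterS2 ev => j h1.
rewrite !sub0r !normrN PE -/(P j) => h2.
have qp : `|q| = p by rewrite ltr0_norm//; lra.
have e1 : `|q ^+ j * P j * kmean g lam j| = `|P j| * (p ^+ j * kmean g lam j).
  by rewrite normrM (ger0_norm (kmean_ge0 j)) normrM normrX qp; ring.
rewrite -(ler_pM2r cp); apply: le_trans h2; rewrite e1.
by rewrite ler_wpM2l.
Qed.

End kernel_limit.

Section kernel_sum.
Context {R : realType}.
Notation mu := (@lebesgue_measure R).
Notation ray := (`]0%R, +oo[%classic : set R).
Context (g : R -> R) (M lam : R) (mg : measurable_fun ray g)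
  (g0 : forall t : R, 0 < t -> 0 <= g t) (gM : forall t : R, 0 < t -> g t <= M)
  (lam0 : 0 < lam).
Implicit Types (q rho t c C p : R) (e : nat -> R).

(** At q = -1 the growing factor y^m / m! is absorbed by e^(-y), uniformly in
    rho. *)
Lemma mixture_bound e rho t k : 0 <= rho -> 0 < t ->
  `|mixture g lam e (-1) rho k t| <= (\sum_(m < k.+1) `|e m|) * M * expR (- (lam * t)).
Proof.
move=> r0 t0; rewrite /mixture.
have y0 : 0 <= rho * lam * t by rewrite mulr_ge0 ?(ltW t0)// mulr_ge0// ltW.
rewrite normrM (ger0_norm (g0 t0)) normrM ger0_norm ?expR_ge0// (mulrC _ (expR _)) -mulrA.
rewrite ler_wpM2l ?expR_ge0//; apply: ler_pM => //; [exact: g0| |exact: gM].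
apply: le_trans (ler_norm_sum _ _ _) _; apply: ler_sum => m _.
rewrite normrM ler_piMr// ger0_norm; last by rewrite mulr_ge0 ?expR_ge0// divr_ge0 ?exprn_ge0.
apply: le_trans (_ : expR (rho * lam * t) * expR (-1 * (rho * lam * t)) <= _).
  by rewrite ler_wpM2r ?expR_ge0// pow_le_fact_expR.
by rewrite -expRD mulN1r subrr expR0.
Qed.

Lemma integral_mixture_cvg e k (r : nat -> R) :
  (forall n, 0 <= r n) -> r n @[n --> \oo] --> (1 : R) ->
  \int[mu]_(t in ray) mixture g lam e (-1) (r n) k t @[n --> \oo] -->
  \int[mu]_(t in ray) mixture g lam e (-1) 1 k t.
Proof.
move=> r0 r1.
have iE : mu.-integrable ray
    (EFin \o (fun t => (\sum_(m < k.+1) `|e m|) * M * expR (- (lam * t)))).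
  by apply: integrable_scale; exact: integrable_expRN.
have [] := @dominated_convergence _ (measurableTypeR R) R mu ray
  (@measurable_ray R) (fun n => EFin \o mixture g lam e (-1) (r n) k)
  (EFin \o mixture g lam e (-1) 1 k) _ _ _ _ iE.
- by move=> J; apply/measurable_EFinP; exact: measurable_mixture.
- by apply/measurable_EFinP; exact: measurable_mixture.
- apply: aeW => t _; apply/fine_cvgP; split; first exact: nearW.
  have c : r n * lam * t @[n --> \oo] --> 1 * lam * t.
    apply: cvgM; last exact: cvg_cst.
    by apply: cvgM => //; exact: cvg_cst.
  apply: cvgM; last exact: cvg_cst.
  apply: cvgM; first exact: cvg_cst.
  apply: cvg_sumr => m _; apply: cvgM; first exact: cvg_cst.
  apply: cvgM.
    apply: cvgM; last exact: cvg_cst.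
    by apply: (continuous_cvg _ (@exprn_continuous _ m _)).
  apply: (continuous_cvg _ (@continuous_expR R _)).
  by apply: cvgM => //; exact: cvg_cst.
- apply: aeW => t J rt; rewrite /= lee_fin.
  exact: mixture_bound (ray_gt0 rt).
move=> iM _ h.
have fM : (\int[mu]_(t in ray) (mixture g lam e (-1) 1 k t)%:E)%E \is a fin_num.
  exact (integrable_fin_num (@measurable_ray R) iM).
by move: h; rewrite -[X in _ --> X]fineK// => /fine_cvgP[_ h].
Qed.

(** For |q| < 1 this is dominated convergence, for q < -1 the series diverges,
    and at q = -1 the sum is the limit of its Abel means, to which dominated
    convergence applies again. *)
Theorem mix_series_sum e q k c : q < 1 -> e k != 0 -> 0 < c ->
  (q < -1 -> forall t, 1 <= t -> c * expR (- ((- q - 1) * lam * t)) <= g t) ->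
  cvgn (series (fun j => mixweight e q k j * kmean g lam j)) ->
  limn (series (fun j => mixweight e q k j * kmean g lam j)) =
  lam * \int[mu]_(t in ray) mixture g lam e q 1 k t.
Proof.
move=> q1 ek c0 gL cv.
have [qm|qm] := ltP q (-1).
  by move: ek; rewrite (mix_series_diverges mg g0 gM lam0 qm c0 (gL qm) cv) eqxx.
have qa : `|q| <= 1 by rewrite ler_norml qm ltW.
have [q1'|] := ltP `|q| 1.
  have := @mix_series_cvg R g M lam mg g0 gM lam0 e q 1 k.
  rewrite ler01 lexx mulr1 => /(_ isT q1') h.
  apply: cvg_lim => //; move: h.
  rewrite (_ : (fun j => _ * 1 ^+ j) = (fun j => mixweight e q k j * kmean g lam j))//.
  by apply/funext => j; rewrite expr1n mulr1.
move=> q1'.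
have {gL q1' qa qm q1} qE : q = -1.
  by apply/eqP; rewrite eq_le qm andbT; move: q1'; rewrite ler_normr; case/orP; lra.
rewrite {q}qE in cv *.
(* Radii of the Abel means. *)
pose r n : R := 1 - n.+1%:R^-1.
have r01 n : 0 <= r n < 1.
  by rewrite /r subr_ge0 invf_le1// ler1n/= gtrBl invr_gt0.
have r1 : r n @[n --> \oo] --> (1 : R).
  rewrite -[X in _ --> X]subr0; apply: cvgB; first exact: cvg_cst.
  exact: cvg_harmonic.
have F n : series (fun j => mixweight e (-1) k j * kmean g lam j * r n ^+ j) J @[J --> \oo] -->
    lam * \int[mu]_(t in ray) mixture g lam e (-1) (r n) k t.
  have /andP[rn0 rn1] := r01 n.
  by apply: (mix_series_cvg mg g0 gM); rewrite ?rn0 ?ltW// normrN1 mul1r.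
have h1 := abel_limit cv r01 r1 F.
have h2 : lam * \int[mu]_(t in ray) mixture g lam e (-1) (r n) k t @[n --> \oo] -->
    lam * \int[mu]_(t in ray) mixture g lam e (-1) 1 k t.
  apply: cvgM; first exact: cvg_cst.
  by apply: integral_mixture_cvg => // n; case/andP: (r01 n).
exact: cvg_unique h1 h2.
Qed.

End kernel_sum.

(** * The Gaussian kernel in the time variable *)

Section gauss_kernel.
Context {R : realType} (N : nat) (x : 'rV[R]_N) (x0 : x != 0).
Notation ray := (`]0%R, +oo[%classic : set R).
Implicit Types (t c kap : R).

Lemma sqnorm_gt0 : 0 < sqnorm x.
Proof.
have s0 : 0 <= sqnorm x by rewrite /sqnorm sumr_ge0// => i _; rewrite sqr_ge0.
rewrite lt_neqAle s0 andbT eq_sym; apply: contraNneq x0 => /eqP.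
rewrite psumr_eq0 => [/allP h|i _]; last exact: sqr_ge0.
apply/eqP/rowP => i; rewrite mxE; apply/eqP.
by have := h i (mem_index_enum _); rewrite sqrf_eq0.
Qed.

Lemma gauss_ge0 t : 0 <= gauss t x.
Proof. by rewrite /gauss mulr_ge0 ?powR_ge0 ?expR_ge0. Qed.

Lemma measurable_gauss : measurable_fun ray (fun t => gauss t x).
Proof.
have e : {in ray, (fun t => (4 * pi * t) `^ (- (N%:R / 2)) *
   expR (- (sqnorm x / 4 * t `^ (-1)))) =1 (fun t => gauss t x)}.
  move=> t; rewrite inE => /ray_gt0 t0; rewrite /gauss powR_inv1 ?(ltW t0)//.
  by congr (_ * expR (- _)); rewrite invfM mulrA.
apply: (eq_measurable_fun _ e); apply: measurable_funTS; apply: measurable_funM.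
  apply: (measurableT_comp (measurable_powR _)).
  by apply: measurable_funM.
apply: (measurableT_comp (@measurable_expR R)); apply: measurable_funN.
by apply: measurable_funM => //; exact: measurable_powR.
Qed.

Definition gauss_sup : R := (pi * sqnorm x) `^ (- (N%:R / 2)) * (1 + N`!%:R).

Lemma powR_half_le (u : R) : 0 < u -> u `^ (N%:R / 2) <= 1 + u ^+ N.
Proof.
move=> u0; have [u1|u1] := leP u 1.
  apply: le_trans (_ : 1 <= _); last by rewrite lerDl exprn_ge0// ltW.
  have e : 1 `^ (N%:R / 2) = 1 :> R by rewrite powR1.
  by rewrite -[leRHS]e ge0_ler_powR ?nnegrE ?(ltW u0).
apply: le_trans (_ : u `^ N%:R <= _).
  by rewrite ler_powR ?(ltW u1)// ler_pdivrMr// ler_peMr// ler1n.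
by rewrite powR_mulrn ?(ltW u0)// lerDr.
Qed.

(** Writing u = |x|^2 / (4 t), the kernel is a constant times u^(N/2) e^(-u).
    Boundedness near t = 0 is where x <> 0 is used. *)
Lemma gauss_le t : 0 < t -> gauss t x <= gauss_sup.
Proof.
move=> t0; have S0 := sqnorm_gt0; have pi0 := pi_gt0 R.
set u := sqnorm x / (4 * t).
have u0 : 0 < u by rewrite divr_gt0// mulr_gt0.
rewrite /gauss -/u (_ : 4 * pi * t = pi * sqnorm x * u^-1); last first.
  by rewrite /u; field; rewrite !gt_eqF.
rewrite powRM ?mulr_ge0 ?invr_ge0 ?(ltW u0) ?(ltW pi0) ?(ltW S0)//.
rewrite /gauss_sup -mulrA ler_wpM2l ?powR_ge0//.
rewrite -powR_inv1 ?(ltW u0)// -powRrM mulN1r opprK.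
apply: le_trans (_ : (1 + u ^+ N) * expR (- u) <= _).
  by rewrite ler_wpM2r ?expR_ge0// powR_half_le.
rewrite mulrDl mul1r lerD//; first by rewrite -[leRHS]expR0 ler_expR oppr_le0 ltW.
rewrite expRN ler_pdivrMr ?expR_gt0// -ler_pdivrMl ?ltr0n ?fact_gt0// mulrC.
by rewrite pow_le_fact_expR// ltW.
Qed.

(** For t >= 1 the kernel decays only polynomially, hence dominates a multiple
    of any decaying exponential. *)
Lemma gauss_lower kap : 0 < kap ->
  exists2 c, 0 < c & forall t, 1 <= t -> c * expR (- (kap * t)) <= gauss t x.
Proof.
move=> kap0; have S0 := sqnorm_gt0; have pi0 := pi_gt0 R.
have N0 : 0 < N`!%:R :> R by rewrite ltr0n fact_gt0.
exists (((4 * pi) ^+ N)^-1 * (kap ^+ N / N`!%:R) * expR (- (sqnorm x / 4))).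
  by rewrite !mulr_gt0 ?expR_gt0 ?invr_gt0 ?exprn_gt0// mulr_gt0.
move=> t t1; have t0 : 0 < t by rewrite (lt_le_trans _ t1).
have pt1 : 1 <= 4 * pi * t.
  have : 1 <= 4 * pi :> R by have := pi_ge2 R; lra.
  by move=> h; rewrite mulr_ege1.
have pt0 : 0 < 4 * pi * t by rewrite (lt_le_trans _ pt1).
rewrite mulrAC /gauss; apply: ler_pM.
- by rewrite !mulr_ge0 ?expR_ge0// ?invr_ge0 ?exprn_ge0 ?mulr_ge0 ?ltW// ltW.
- exact: expR_ge0.
- apply: le_trans (_ : (4 * pi * t) `^ (- N%:R) <= _); last first.
    by rewrite ler_powR// lerN2 ler_pdivrMr// ler_peMr// ler1n.
  rewrite powRN powR_mulrn ?(ltW pt0)// [(4 * pi * t) ^+ N]exprMn invfM -[leLHS]mulrA ler_wpM2l//.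
    by rewrite invr_ge0 exprn_ge0// mulr_ge0// ltW.
  rewrite expRN ler_pdivrMr ?expR_gt0// ler_pdivrMr//.
  rewrite -mulrA ler_pdivlMl ?exprn_gt0//.
  have := @pow_le_fact_expR R (kap * t) N (mulr_ge0 (ltW kap0) (ltW t0)).
  by rewrite ler_pdivrMr// exprMn mulrC.
- rewrite ler_expR lerN2 ler_pM2l// lef_pV2 ?posrE ?mulr_gt0//.
  by rewrite ler_peMr.
Qed.

End gauss_kernel.

(** * The fundamental solution *)

Section complex_integrals.
Context {R : realType}.
Notation mu := (@lebesgue_measure R).
Notation ray := (`]0%R, +oo[%classic : set R).

Lemma cintegral_real (f : R -> R[i]) (F : R -> R) :
  (forall t, 0 < t -> f t = (F t)%:C) ->
  cintegral ray f = (\int[mu]_(t in ray) F t)%:C.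
Proof.
move=> e; rewrite /cintegral; congr (_ +i* _).
  by apply: eq_Rintegral => t; rewrite inE => /ray_gt0 t0; rewrite e.
rewrite /Rintegral (@eq_integral _ _ _ _ _ (cst (0%R : R)%:E)).
  by rewrite integral_cst; [rewrite mul0e|exact: measurable_ray].
by move=> t; rewrite inE => /ray_gt0 t0; rewrite e.
Qed.

Lemma cintegrable_real (f : R -> R[i]) (F : R -> R) :
  (forall t, 0 < t -> f t = (F t)%:C) -> mu.-integrable ray (EFin \o F) ->
  cintegrable ray f.
Proof.
move=> e iF; split.
  apply: (eq_integrable (@measurable_ray R)) iF => t.
  by rewrite inE => /ray_gt0 t0; rewrite /= e.
apply: (eq_integrable (@measurable_ray R)) (integrable0 mu ray) => t.
by rewrite inE => /ray_gt0 t0; rewrite /= e.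
Qed.

End complex_integrals.

Section fundamental_solution.
Context {R : realType} (N : nat) (h al r : R) (h0 : 0 < h) (al01 : 0 < al < 1)
  (r01 : 0 < r < 1) (k : nat) (x : 'rV[R]_N) (x0 : x != 0).
Notation mu := (@lebesgue_measure R).
Notation ray := (`]0%R, +oo[%classic : set R).

Let g t : R := gauss t x.
Let lam := h^-1.
Let w := h `^ (1 - al).
Let e m := newton al (1 - al) m k * w ^+ m.
Let lam0 : 0 < lam. Proof. by rewrite invr_gt0. Qed.
Let w0 : 0 < w. Proof. by rewrite powR_gt0. Qed.
Let mg : measurable_fun ray g := measurable_gauss x.
Let g0 : forall t : R, 0 < t -> 0 <= g t := fun t _ => gauss_ge0 x t.
Let gM : forall t : R, 0 < t -> g t <= gauss_sup x := fun t t0 => gauss_le x0 t0.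

Lemma discrete_gauss_kmean j : discrete_gauss j.+1 h x = kmean g lam j.
Proof.
have hj : h ^+ j * j`!%:R != 0 :> R by rewrite mulf_neq0 ?expf_neq0 ?gt_eqF// ltr0n fact_gt0.
rewrite /discrete_gauss /kmean /Gamma ltr0Sn Gamma_pos_nat.
have -> : \int[mu]_(t in ray) (expR (- (t / h)) * t ^+ j * gauss t x) =
    \int[mu]_(t in ray) (h ^+ j * j`!%:R * pulse g lam j t).
  apply: eq_Rintegral => t _; rewrite /pulse /lam /g (mulrC t) exprMn exprVn.
  by field; rewrite ?expf_neq0 ?gt_eqF// ltr0n fact_gt0.
rewrite RintegralZl; [|exact: measurable_ray|exact: (integrable_pulse mg g0 gM lam0)].
by rewrite /lam exprS; field; rewrite ?expf_neq0 ?gt_eqF// ltr0n fact_gt0.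
Qed.

(** The terms of the fundamental solution without the factor h^(1 - al). *)
Definition mixterm j : R := mixweight e (1 - w) k j * kmean g lam j.

Lemma fund_sol_termE : fund_sol_term r al k.+1 h x = (fun j => (mixterm j * w)%:C).
Proof.
apply/funext => j; rewrite /fund_sol_term discrete_wright_newton// discrete_gauss_kmean.
rewrite -rmorphM/= /mixterm -/w; congr (_%:C).
by rewrite /mixweight -/w; ring.
Qed.

Lemma fund_sol_cvg_small : w < 2 -> cvgn (series mixterm).
Proof.
move=> w2; have := @mix_series_cvg R g _ lam mg g0 gM lam0 e (1 - w) 1 k.
rewrite ler01 lexx mulr1 => /(_ isT) H.
have w1 : `|1 - w| < 1 by rewrite ltr_norml; have := w0; lra.
rewrite /mixterm; have := cvgP _ (H w1).
rewrite (_ : (fun j => _ * 1 ^+ j) = mixterm)//.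
by apply/funext => j; rewrite expr1n mulr1.
Qed.

Lemma fund_sol_cvg_iff : cseries_cvg (fund_sol_term r al k.+1 h x) <-> cvgn (series mixterm).
Proof.
rewrite fund_sol_termE; split => [/cseries_cvg_real c|c]; last first.
  by apply/cseries_cvg_real; apply: cvgP; exact: cvg_seriesZr.
have -> : mixterm = (fun j => mixterm j * w * w^-1).
  by apply/funext => j; rewrite mulfK// gt_eqF.
by apply: cvgP; exact: cvg_seriesZr.
Qed.

(** The lower bound on the Gaussian kernel serves to exclude convergence when
    h^(1 - al) > 2; below this threshold it is vacuous, hence the witness
    1. *)
Lemma fund_sol_value : cvgn (series mixterm) ->
  fund_sol r al k.+1 h x = (lam * w * \int[mu]_(t in ray) mixture g lam e (1 - w) 1 k t)%:C.
Proof.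
move=> c; rewrite /fund_sol fund_sol_termE cseries_sum_real; last first.
  by apply: cvgP; exact: cvg_seriesZr.
rewrite (cvg_lim _ (@cvg_seriesZr R mixterm w c))//; congr (_%:C).
have [d d0 gL] : exists2 d : R, 0 < d & (1 - w < -1 -> forall t, 1 <= t ->
    d * expR (- ((- (1 - w) - 1) * lam * t)) <= g t).
  have [w2|w2] := ltP (1 - w) (-1); last by exists 1.
  have kap0 : 0 < (- (1 - w) - 1) * lam by rewrite mulr_gt0//; lra.
  by have [d d0 H] := gauss_lower x0 kap0; exists d.
have w1 : 1 - w < 1 by have := w0; lra.
have ek : e k != 0.
  have /andP[al0 _] := al01.
  by rewrite /e newton_diag mulf_neq0 ?expf_neq0 ?gt_eqF.
by rewrite (mix_series_sum mg g0 gM lam0 w1 ek d0 gL c); ring.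
Qed.

(** The exponent splits as - w lam t = - lam t + (1 - w) lam t, which exhibits
    the same mixture as on the series side. *)
Lemma subord_inner t : 0 < t ->
  cintegral ray (fun s => subord_integrand al k.+1 h x s t) =
  (h ^+ k * w * mixture g lam e (1 - w) 1 k t)%:C.
Proof.
move=> t0.
rewrite (@cintegral_real R _ (fun s => g t * wmoment al t h k s)); last first.
  by move=> s s0; rewrite subord_integrand_real ?(ltW t0)// mulrC.
congr (_%:C); rewrite RintegralZl; [|exact: measurable_ray|].
  have -> : \int[mu]_(s in ray) wmoment al t h k s = h ^+ k * w * wcoef al (t * h `^ (- al)) k.
    by rewrite /Rintegral integral_wmoment ?(ltW t0).
  have tE : t * h `^ (- al) = w * (lam * t).
    rewrite /w /lam -[in RHS]powR_inv1 ?(ltW h0)// mulrA -powRD; last first.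
      by rewrite (gt_eqF h0) implybT.
    by rewrite (_ : 1 - al + -1 = - al) 1?mulrC//; ring.
  rewrite tE wcoefE// /mixture -/g mul1r.
  have -> : - (w * (lam * t)) = - (lam * t) + (1 - w) * (lam * t) by ring.
  rewrite expRD.
  set E2 := expR ((1 - w) * _).
  have -> : \sum_(m < k.+1) e m * ((lam * t) ^+ m / m`!%:R * E2) =
      E2 * \sum_(m < k.+1) newton al (1 - al) m k * (w * (lam * t)) ^+ m / m`!%:R.
    by rewrite mulr_sumr; apply: eq_bigr => m _; rewrite /e !exprMn; ring.
  ring.
by apply: integrable_wmoment => //; exact: ltW.
Qed.

Lemma integrable_gauss_mixture :
  mu.-integrable ray (EFin \o mixture g lam e (1 - w) 1 k).
Proof.
by apply: (integrable_mixture mg g0 gM lam0); have := w0; lra.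
Qed.

End fundamental_solution.

Theorem proposition5p2 (R : realType) (N : nat) (h alpha r : R)
    (hN : (0 < N)%N) (hh : 0 < h) (halpha : 0 < alpha < 1) (hr : 0 < r < 1)
    (n : nat) (hn : (0 < n)%N) (x : 'rV[R]_N) (hx : x != 0) :
  (h `^ (1 - alpha) < 2 -> cseries_cvg (fund_sol_term r alpha n h x)) /\
  (forall t : R, 0 < t ->
     cintegrable `]0, +oo[ (fun s => subord_integrand alpha n h x s t)) /\
  cintegrable `]0, +oo[ (fun t =>
     cintegral `]0, +oo[ (fun s => subord_integrand alpha n h x s t)) /\
  (cseries_cvg (fund_sol_term r alpha n h x) ->
     fund_sol r alpha n h x =
     (h ^+ n)^-1%:C * cintegral `]0, +oo[ (fun t =>
       cintegral `]0, +oo[ (fun s => subord_integrand alpha n h x s t))).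
Proof.
case: n hn => // k _.
split; first by move=> w2; apply/(fund_sol_cvg_iff alpha hh hr k hx); exact: fund_sol_cvg_small.
split.
  move=> t t0.
  apply: (cintegrable_real (F := fun s => gauss t x * wmoment alpha t h k s)).
    by move=> s s0; rewrite subord_integrand_real ?(ltW t0)// mulrC.
  by apply: integrable_scale; apply: integrable_wmoment => //; exact: ltW.
have inner := subord_inner hh halpha k x.
split; first apply: (cintegrable_real inner).
  by refine (integrable_scale _ _); exact: integrable_gauss_mixture.
move=> /(fund_sol_cvg_iff alpha hh hr k hx) c.
rewrite (fund_sol_value hh halpha hr hx c) (cintegral_real inner).
rewrite RintegralZl; [|exact: measurable_ray|exact: integrable_gauss_mixture].
rewrite -rmorphM/=; congr (_%:C).
by rewrite exprS; field; rewrite ?expf_neq0 ?gt_eqF.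
Qed.
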